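(* There exist infinitely many primes $p$ for which there exists $a\in(\mathbb{Z}/7p\mathbb{Z})^*$ such that $a\bmod p$ generates $(\mathbb{Z}/p\mathbb{Z})^*$, $a^{(p-1)/2}\equiv-1\pmod{7p}$, and $S=S_{7p}(a)$ satisfies $|S\cap(S+1)|\equiv-2\pmod 7$.
   Context: $S_{pq}(a)=\{a^j:0\le j<p-1\}\subseteq\mathbb{Z}/pq\mathbb{Z}$ and $S+1=\{s+1:s\in S\}$. *)

(* Defs.v *)
From mathcomp Require Import all_boot.
Set Implicit Arguments. Unset Strict Implicit. Unset Printing Implicit Defensive.

Definition Spq (p q a : nat) : {set 'I_(p * q)} :=
  [set x : 'I_(p * q) | [exists j : 'I_(p.-1), nat_of_ord x == a ^ j %% (p * q)]].

Definition shift1 (n : nat) (S : {set 'I_n}) : {set 'I_n} :=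
  [set x : 'I_n | [exists y in S, nat_of_ord x == (nat_of_ord y).+1 %% n]].

Definition generates_units_mod (p a : nat) : Prop :=
  coprime a p /\ forall b, coprime b p -> exists k, b = a ^ k %[mod p].

(* Main.v *)
(* Let chi : F_p -> F_7 be the character of order 6 that sends the generator a mod p to a mod 7.
   Then S consists of the nonzero x with x mod 7 = chi (x mod p), and x |-> 1 - x identifies
   S :&: (S + 1) with the solutions z <> 0, 1 of chi z + chi (1 - z) = 1.  Expanding the
   indicator of this equation as a polynomial over F_7 gives Jacobi sums of the powers of chi.
   When p = 7 modulo 12 all of them can be expressed by chi 4 and by the reduction modulo 7 of
   the cubic Jacobi sum, which is - pi for a primary prime pi of norm p in Z[w]; and chi 4 is
   read off from pi modulo 2.  So the congruence depends only on the class of pi modulo 28.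

   It remains to find primes of Z[w] of arbitrarily large norm in the right classes.  Restrict
   to the right classes of norm 1 modulo 7 and take each nontrivial character psi with
   multiplicity 5 - S(psi), where S(psi) is the sum of psi over these classes.  If there were no
   such primes of large norm, then up to a bounded factor the product of all the 1 / |L(s, psi)|
   would be at most the product of 1 - p ^ - s over the primes p = 1 modulo 21, each of which is
   the norm of a prime of Z[w] of norm 1 modulo 7.  This tends to 0 as s tends to 1, whereas the
   |L(s, psi)| are bounded above.  Only s = 1 + 2 ^ - j and truncated sums and products are used,
   so that everything takes place in a real closed field.  The primes 1 modulo 21 are dealt with
   by numerical lower bounds for the L-series modulo 21. *)

From HB Require Import structures.
Require Import Defs.
From mathcomp Require Import all_boot all_order all_algebra all_solvable all_field.
From mathcomp Require Import all_real_closed.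
From mathcomp Require Import zify ring lra.
Set Implicit Arguments. Unset Strict Implicit. Unset Printing Implicit Defensive.
Import Order.TTheory GRing.Theory Num.Theory.
Import ComplexField.Normc.
Local Open Scope ring_scope.
Local Open Scope complex_scope.
Local Notation Re := complex.Re.
Local Notation Im := complex.Im.

(** * Weights *)

(** For [p = 7] modulo 12 the number [(p - 1) / 2] is an odd multiple of 3, so either primitive root
    3 or 5 modulo 7 as the residue of [a] gives [chi (-1) = -1]: this is the half-power condition,
    and it fixes the sign when S :&: (S + 1) becomes an equation. Exchanging 3 and 5 conjugates the
    cubic Jacobi sum, so the right classes may be closed under conjugation.

    With norm 1 modulo 7 there are six right classes: three solutions of one equation and their
    conjugates. On classes of norm 1 conjugation is inversion, so S(psi) is real. The constant 5 is
    chosen because S(psi) stays below 5 for nontrivial psi, so that 5 - S(psi) is a genuine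
    multiplicity, while 5 is less than 6, so that the weighted sum of characters is positive on the
    remaining classes of norm 1.

    This slack is what shapes the proof: the usual density argument would require that the L-series
    of Z[w] do not vanish at 1, whereas here their boundedness suffices. Nonvanishing enters only
    for the eleven nonprincipal characters modulo 21, where a numerical check is possible. *)

Section Weight.
Variable R : archiRcfType.
Implicit Types (j k m n : nat) (x y : R).

Definition root2 j x : R := iter j Num.sqrt x.

Lemma root2_ge0 j x : 0 <= x -> 0 <= root2 j x.
Proof. by case: j => [|j] //= _; rewrite sqrtr_ge0. Qed.

Lemma root2_gt0 j x : 0 < x -> 0 < root2 j x.
Proof. by move=> x0; elim: j => [|j IH] //=; rewrite sqrtr_gt0. Qed.

Lemma root2M j x y : 0 <= x -> root2 j (x * y) = root2 j x * root2 j y.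
Proof.
by move=> x0; elim: j => [|j IH] //=; rewrite IH sqrtrM // root2_ge0.
Qed.

Lemma ler_root2 j x y : x <= y -> root2 j x <= root2 j y.
Proof. by move=> xy; elim: j => [|j IH] //=; exact: ler_wsqrtr. Qed.

Lemma root2_1 j : root2 j 1 = 1 :> R.
Proof. by elim: j => [|j IH] //=; rewrite IH sqrtr1. Qed.

Lemma root2_ge1 j x : 1 <= x -> 1 <= root2 j x.
Proof. by move=> /(ler_root2 j); rewrite root2_1. Qed.

Lemma sqrtr_le x : 1 <= x -> Num.sqrt x <= x.
Proof.
move=> x1; have x0 : 0 <= x by lra.
have h : x <= x ^+ 2 by rewrite expr2; nra.
by apply: le_trans (ler_wsqrtr h) _; rewrite sqrtr_sqr ger0_norm.
Qed.

Lemma root2_le j x : 1 <= x -> root2 j x <= x.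
Proof.
move=> x1; elim: j => [|j IH] //=.
by apply: le_trans IH; apply: sqrtr_le; exact: root2_ge1.
Qed.

Lemma root2_gt1 j x : 1 < x -> 1 < root2 j x.
Proof.
move=> x1; elim: j => [|j IH] //=.
by rewrite -[ltLHS]sqrtr1 ltr_sqrt // (lt_trans _ IH).
Qed.

Lemma root2X j x : 0 <= x -> root2 j (x ^+ (2 ^ j)) = x.
Proof.
move=> x0; elim: j => [|j IH]; first by rewrite expr1.
rewrite /root2 iterSr -/(root2 j _) expnS mulnC exprM sqrtr_sqr.
by rewrite ger0_norm // exprn_ge0.
Qed.

(* n^-s with s = 1 + 2^-j, so that square roots are the only functions needed *)
Definition wt j n : R := (n%:R * root2 j n%:R)^-1.

Lemma wtM j m n : wt j (m * n) = wt j m * wt j n.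
Proof.
by rewrite /wt natrM root2M ?ler0n // -invfM mulrACA.
Qed.

Lemma wt1 j : wt j 1 = 1.
Proof. by rewrite /wt root2_1 mulr1 invr1. Qed.

Lemma wt_gt0 j n : (0 < n)%N -> 0 < wt j n.
Proof.
by move=> n0; rewrite invr_gt0 mulr_gt0 ?root2_gt0 ?ltr0n.
Qed.

Lemma wt_ge0 j n : 0 <= wt j n.
Proof. by rewrite invr_ge0 mulr_ge0 ?root2_ge0 ?ler0n. Qed.

Lemma wt_anti j m n : (0 < m)%N -> (m <= n)%N -> wt j n <= wt j m.
Proof.
move=> m0 mn; rewrite lef_pV2 ?posrE ?mulr_gt0 ?root2_gt0 ?ltr0n ?(leq_trans m0) //.
by rewrite ler_pM ?ler0n ?root2_ge0 ?ler_root2 ?ler_nat ?ler0n.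
Qed.

Lemma wt_le_inv j n : wt j n <= n%:R^-1.
Proof.
case: n => [|n]; first by rewrite /wt mul0r.
rewrite lef_pV2 ?posrE ?mulr_gt0 ?root2_gt0 ?ltr0n //.
by rewrite ler_peMr ?ler0n // root2_ge1 // ler1n.
Qed.

Lemma wt_le1 j n : wt j n <= 1.
Proof.
case: n => [|n]; first by rewrite /wt mul0r invr0.
by apply: le_trans (wt_le_inv _ _) _; rewrite invf_le1 ?ltr0n // ler1n.
Qed.

Lemma wt_le_half j n : (1 < n)%N -> wt j n <= 2^-1.
Proof.
move=> n1; apply: le_trans (wt_anti j _ n1) _ => //.
exact: wt_le_inv.
Qed.

(** [n ^ 2 * wt j n] is [n ^ (1 - 2 ^ - j)], a power with nonnegative exponent. *)
Lemma wt_sq j m n : (0 < m)%N -> (m <= n)%N ->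
  m%:R ^+ 2 * wt j m <= n%:R ^+ 2 * wt j n.
Proof.
move=> m0 mn; have n0 := leq_trans m0 mn.
have e k : (0 < k)%N -> k%:R ^+ 2 * wt j k = k%:R / root2 j k%:R.
  move=> k0; rewrite /wt; field.
  by rewrite !gt_eqF ?root2_gt0 ?ltr0n.
rewrite !e // ler_pdivrMr ?root2_gt0 ?ltr0n // mulrAC ler_pdivlMr ?root2_gt0 ?ltr0n //.
have key : root2 j n%:R <= root2 j m%:R * (n%:R / m%:R) :> R.
  have {1}-> : n%:R = m%:R * (n%:R / m%:R) :> R by field; rewrite pnatr_eq0 -lt0n.
  rewrite root2M ?ler0n // ler_wpM2l ?root2_ge0 ?ler0n // root2_le //.
  by rewrite ler_pdivlMr ?ltr0n // mul1r ler_nat.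
apply: le_trans (ler_wpM2l (ler0n _ m) key) _.
by rewrite mulrA mulrC mulrA divfK ?pnatr_eq0 -?lt0n // mulrC.
Qed.

(** A mean value estimate without derivatives, uniform in [j]: with [t = m / n], [wt_sq] gives
    [t ^ 2 * wt j m <= wt j n], and [1 - t ^ 2 <= 2 * (1 - t)]. *)
Lemma wt_diff j m n : (0 < m)%N -> (m <= n)%N ->
  wt j m - wt j n <= 2 * (n%:R - m%:R) / (m%:R * n%:R).
Proof.
move=> m0 mn; have n0 := leq_trans m0 mn.
have mp : 0 < m%:R :> R by rewrite ltr0n.
have np : 0 < n%:R :> R by rewrite ltr0n.
have mn' : m%:R <= n%:R :> R by rewrite ler_nat.
have h := wt_sq j m0 mn; have h1 := wt_le_inv j m.
set a := wt j m in h h1 *; set b := wt j n in h *.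
have hb : m%:R ^+ 2 * a / n%:R ^+ 2 <= b.
  by rewrite ler_pdivrMr ?exprn_gt0 // [leRHS]mulrC.
have a0 : 0 <= a := wt_ge0 _ _.
have : a - b <= a * (1 - m%:R ^+ 2 / n%:R ^+ 2).
  by rewrite mulrBr mulr1 mulrCA mulrA; lra.
move=> /le_trans; apply.
have -> : 2 * (n%:R - m%:R) / (m%:R * n%:R) = m%:R^-1 * (2 * (1 - m%:R / n%:R)) :> R.
  by field; rewrite !gt_eqF.
rewrite -expr_div_n; set t := m%:R / n%:R.
have t0 : 0 <= t by rewrite divr_ge0 ?ler0n.
have t1 : t <= 1 by rewrite ler_pdivrMr // mul1r.
apply: ler_pM => //; rewrite expr2; nra.
Qed.

(** As [j] grows, [wt j n] tends to [1 / n]; this says how large [j] must be for a given factor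
    [c]. *)
Lemma wt_near j n (c : R) : 1 <= c -> (0 < n)%N -> n%:R <= c ^+ (2 ^ j) ->
  (c * n%:R)^-1 <= wt j n.
Proof.
move=> c1 n0 h; have c0 : 0 < c by lra.
rewrite lef_pV2 ?posrE ?mulr_gt0 ?root2_gt0 ?ltr0n //.
rewrite mulrC ler_wpM2r ?ler0n //.
by rewrite -[leRHS](@root2X j) ?ler_root2 // ltW.
Qed.

Lemma wtX j m k : wt j (m ^ k) = wt j m ^+ k.
Proof. by elim: k => [|k IH]; rewrite ?wt1 // expnS exprS wtM IH. Qed.

Lemma wt2_lt j : wt j 2 < 2^-1.
Proof.
by rewrite ltf_pV2 ?posrE ?mulr_gt0 ?root2_gt0 ?ltr0n // ltr_pMr ?ltr0n // root2_gt1 // ltr1n.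
Qed.

End Weight.

(** * A sieve in a factorial monoid *)

Section ComplexNorm.
Variable R : rcfType.
Implicit Types (z : R[i]) (x : R).

Lemma normc_ge0 z : 0 <= normc z.
Proof. by case: z => a b; exact: sqrtr_ge0. Qed.

Lemma normc_real x : 0 <= x -> normc x%:C = x.
Proof. by move=> x0; rewrite /normc /= expr0n addr0 sqrtr_sqr ger0_norm. Qed.

Lemma normc_sqr z : normc z ^+ 2 = Re z ^+ 2 + Im z ^+ 2.
Proof. by case: z => a b; rewrite sqr_sqrtr // addr_ge0 ?sqr_ge0. Qed.

Lemma Re_le_normc z : Re z <= normc z.
Proof.
apply: le_trans (ler_norm _) _.
rewrite -(@ler_pXn2r _ 2) ?nnegrE ?normc_ge0 // normc_sqr real_normK ?num_real //.
by rewrite lerDl sqr_ge0.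
Qed.

Lemma normc_sum (I : Type) (r : seq I) (P : pred I) (F : I -> R[i]) :
  normc (\sum_(i <- r | P i) F i) <= \sum_(i <- r | P i) normc (F i).
Proof.
elim/big_ind2: _ => [|x a y b xa yb|//]; first by rewrite normc0.
by apply: le_trans (le_normcD _ _) _; exact: lerD.
Qed.

Lemma normc_prod (I : Type) (r : seq I) (P : pred I) (F : I -> R[i]) :
  normc (\prod_(i <- r | P i) F i) = \prod_(i <- r | P i) normc (F i).
Proof. by elim/big_ind2: _ => [|x a y b <- <-|//]; rewrite ?normc1 ?normcM. Qed.

Lemma normcX z n : normc (z ^+ n) = normc z ^+ n.
Proof. by elim: n => [|n IH]; rewrite ?normc1 // !exprS normcM IH. Qed.

Lemma normcB z t : normc (z - t) <= normc z + normc t.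
Proof. by apply: le_trans (le_normcD _ _) _; rewrite normcN. Qed.

Lemma ReD z (t : R[i]) : Re (z + t) = Re z + Re t.
Proof. by case: z t => a b []. Qed.

Lemma Re_sum (I : Type) (r : seq I) (P : pred I) (F : I -> R[i]) :
  Re (\sum_(i <- r | P i) F i) = \sum_(i <- r | P i) Re (F i).
Proof. by elim/big_ind2: _ => [//|x a y b <- <-|//]; rewrite ReD. Qed.

End ComplexNorm.

Section Sieve.
Variables (R : archiRcfType) (X : eqType).
(** The two instances are the positive integers and the primary Eisenstein integers, monoids whose
    only unit is [one]. Unique factorization enters only through [euclid] and [pdiv], and [tail] is
    absolute convergence for the fixed exponent. [D M] lists the elements of norm at most [M]. *)
Variables (one : X) (mul : X -> X -> X) (dv : X -> X -> bool) (nm : X -> nat).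
Variables (dom pr : pred X) (D : nat -> seq X).
Hypothesis D_uniq : forall M, uniq (D M).
Hypothesis mem_D : forall M x, (x \in D M) = dom x && (nm x <= M)%N.
Hypothesis dom1 : dom one.
Hypothesis nm1 : nm one = 1%N.
Hypothesis nm_gt0 : forall x, dom x -> (0 < nm x)%N.
Hypothesis nm_eq1 : forall x, dom x -> nm x = 1%N -> x = one.
Hypothesis domM : forall x y, dom x -> dom y -> dom (mul x y).
Hypothesis nmM : forall x y, nm (mul x y) = (nm x * nm y)%N.
Hypothesis pr_dom : forall p, pr p -> dom p.
Hypothesis pr_gt1 : forall p, pr p -> (1 < nm p)%N.
Hypothesis dvP : forall p x, pr p -> dom x -> dv p x -> exists2 y, dom y & x = mul p y.
Hypothesis dv_mul : forall p y, pr p -> dom y -> dv p (mul p y).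
Hypothesis mulI : forall p, pr p -> {in dom &, injective (mul p)}.
Hypothesis euclid : forall p p' x, pr p -> pr p' -> p != p' -> dom x ->
  dv p' (mul p x) = dv p' x.
Hypothesis pdiv : forall x, dom x -> (1 < nm x)%N -> exists2 p, pr p & dv p x.

Variable f : X -> R[i].
Hypothesis fM : forall x y, dom x -> dom y -> f (mul x y) = f x * f y.
Hypothesis f1 : f one = 1.
Hypothesis f_le1 : forall x, normc (f x) <= 1.
Variable w : nat -> R.
Hypothesis w_ge0 : forall n, 0 <= w n.
Hypothesis w_le1 : forall n, w n <= 1.
Hypothesis wM : forall m n, w (m * n) = w m * w n.
Hypothesis w1 : w 1 = 1.
Hypothesis tail : forall e : R, 0 < e -> exists M0, forall F : seq X,
  uniq F -> (forall x, x \in F -> dom x /\ (M0 < nm x)%N) ->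
  \sum_(x <- F) w (nm x) <= e.

Let g x := f x * (w (nm x))%:C.
Let cop (T : seq X) x := all (fun p => ~~ dv p x) T.
Let S T M := \sum_(x <- D M | cop T x) g x.

Let g_le x : normc (g x) <= w (nm x).
Proof.
by rewrite /g normcM normc_real // -[leRHS]mul1r ler_wpM2r.
Qed.

(** One step of the sieve of Eratosthenes: the terms divisible by [p] are the [p * y], and by
    [euclid] such a product avoids the primes of [T] exactly when [y] does. *)
Let S_cons p T M : pr p -> all pr T -> p \notin T ->
  S (p :: T) M = S T M - g p * S T (M %/ nm p).
Proof.
move=> prp prT pT; rewrite /S.
have [pd p1] := (pr_dom prp, pr_gt1 prp); have p0 : (0 < nm p)%N := ltnW p1.
apply/eqP; rewrite -subr_eq opprK; apply/eqP.
rewrite [RHS](bigID (fun x => dv p x)) /= addrC; congr (_ + _);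
  first by apply: eq_bigl => x /=; rewrite andbC.
rewrite mulr_sumr.
have -> : \sum_(x <- D M | cop T x && dv p x) g x =
  \sum_(x <- [seq mul p y | y <- D (M %/ nm p) & cop T y]) g x.
  rewrite -big_filter; apply: perm_big; apply: uniq_perm.
  - by rewrite filter_uniq.
  - rewrite map_inj_in_uniq ?filter_uniq // => x y.
    rewrite !mem_filter !mem_D => /and3P[_ xd _] /and3P[_ yd _].
    exact: mulI.
  have copM y : dom y -> cop T (mul p y) = cop T y.
    move=> yd; apply: eq_in_all => q qT.
    have pq : p != q by apply/eqP => pq; rewrite pq qT in pT.
    by rewrite (euclid prp (allP prT _ qT) pq).
  move=> x; rewrite mem_filter mem_D; apply/idP/mapP.
    move=> /and3P[/andP[cx dx] xd xM].
    have [y yd xE] := dvP prp xd dx; exists y => //.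
    rewrite mem_filter mem_D yd /=.
    rewrite -(copM y yd) -xE cx /=.
    by rewrite leq_divRL // mulnC -nmM -xE.
  move=> [y]; rewrite mem_filter mem_D => /and3P[cy yd yM] ->.
  rewrite copM // cy dv_mul // domM //= nmM.
  by rewrite mulnC -leq_divRL.
rewrite big_map big_filter.
rewrite big_seq_cond [LHS]big_seq_cond; apply: eq_bigr => y /andP[].
rewrite mem_D => /andP[yd _] _; rewrite /g fM // nmM wM rmorphM /=; ring.
Qed.

Let S_near M0 (e : R) T M N : (forall F : seq X,
    uniq F -> (forall x, x \in F -> dom x /\ (M0 < nm x)%N) ->
    \sum_(x <- F) w (nm x) <= e) ->
  (M0 <= N)%N -> (N <= M)%N -> normc (S T M - S T N) <= e.
Proof.
move=> hM0 M0N NM.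
have -> : S T N = \sum_(x <- D M | cop T x && (nm x <= N)%N) g x.
  rewrite /S -[LHS]big_filter -[RHS]big_filter; apply: perm_big; apply: uniq_perm.
  - exact: filter_uniq.
  - exact: filter_uniq.
  move=> x; rewrite !mem_filter !mem_D -!andbA; congr (_ && _).
  have [xN|//] := leqP (nm x) N; last by rewrite andbF.
  by rewrite (leq_trans xN NM).
rewrite /S [X in X - _](bigID (fun x => nm x <= N)%N) /= addrAC subrr add0r.
apply: le_trans (normc_sum _ _ _) _.
apply: (@le_trans _ _ (\sum_(x <- D M | cop T x && ~~ (nm x <= N)%N) w (nm x))).
  by apply: ler_sum => x _; exact: g_le.
rewrite -big_filter; apply: hM0; first exact: filter_uniq.
move=> x; rewrite mem_filter mem_D -ltnNge => /and3P[/andP[_ Nx] dx _].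
by split=> //; exact: leq_ltn_trans Nx.
Qed.

(** Iterating [S_cons] would give an exact product if the cutoff [M] did not change to [M %/ nm p];
    this change costs only a piece of the tail of the series, hence the bound [M0] depending on
    [T]. *)
Let S_prod T : uniq T -> all pr T -> forall e : R, 0 < e ->
  exists M0, forall M, (M0 <= M)%N ->
  normc (S T M - \prod_(p <- T) (1 - g p) * S [::] M) <= e.
Proof.
elim: T => [|p T IH] /= uT prT e e0.
  by exists 0%N => M _; rewrite big_nil mul1r subrr normc0 ltW.
move: uT prT => /andP[pT uT] /andP[prp prT].
have e4 : 0 < e / 4 by lra.
have [M1 hM1] := IH uT prT _ e4; have [M2 hM2] := tail e4.
exists (maxn M1 (M2 * nm p)%N) => M; rewrite geq_max => /andP[M1M M2M].
rewrite S_cons // big_cons.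
have -> : S T M - g p * S T (M %/ nm p) -
    (1 - g p) * \prod_(j <- T) (1 - g j) * S [::] M =
  (1 - g p) * (S T M - \prod_(j <- T) (1 - g j) * S [::] M) +
  g p * (S T M - S T (M %/ nm p)) by ring.
have gp1 : normc (g p) <= 1 by apply: le_trans (g_le _) (w_le1 _).
have h1 : normc (1 - g p) <= 2.
  by apply: le_trans (normcB _ _) _; rewrite normc1; lra.
have p0 : (0 < nm p)%N := nm_gt0 (pr_dom prp).
have h2 : normc (S T M - S T (M %/ nm p)) <= e / 4.
  by apply: (S_near _ hM2); rewrite ?leq_divRL // leq_div.
apply: le_trans (le_normcD _ _) _; rewrite [normc ((1 - g p) * _)]normcM [normc (g p * _)]normcM.
apply: (@le_trans _ _ (2 * (e / 4) + 1 * (e / 4))); last by lra.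
by apply: lerD; apply: ler_pM; rewrite ?normc_ge0 ?hM1.
Qed.

(** Truncated form of the identity between the inverse Euler product and the inverse of the series.
    After sifting by all primes of norm at most [Y], the term at [one] is left together with a tail;
    the constants leave 1/4 for this tail and 1/4 for [S_prod]. *)
Lemma sieve : exists X0, forall Y, (X0 <= Y)%N -> exists M0, forall M, (M0 <= M)%N ->
  normc (\prod_(p <- D Y | pr p) (1 - f p * (w (nm p))%:C) *
         \sum_(x <- D M) f x * (w (nm x))%:C - 1) <= 2^-1.
Proof.
have e4 : 0 < 4^-1 :> R by lra.
have [X0 hX0] := tail e4; exists X0 => Y X0Y.
pose T := [seq p <- D Y | pr p].
have uT : uniq T by exact: filter_uniq.
have prT : all pr T by apply/allP => x; rewrite mem_filter => /andP[].
have [M0 hM0] := S_prod uT prT e4; exists (maxn M0 1) => M; rewrite geq_max => /andP[M0M M1].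
have := hM0 M M0M; rewrite /T big_filter -/T => h1.
have -> : \sum_(x <- D M) f x * (w (nm x))%:C = S [::] M by [].
have h2 : normc (S T M - 1) <= 4^-1.
  have oneM : one \in [seq x <- D M | cop T x].
    rewrite mem_filter mem_D dom1 nm1 M1 /= andbT; apply/allP => p /(allP prT) prp.
    apply/negP => /(dvP prp dom1)[y yd /(congr1 nm)].
    rewrite nm1 nmM => /esym/eqP; rewrite muln_eq1 => /andP[/eqP h _].
    by have := pr_gt1 prp; rewrite h.
  rewrite /S -big_filter (big_rem _ oneM) /= {1}/g f1 nm1 w1 mul1r addrAC subrr add0r.
  apply: le_trans (normc_sum _ _ _) _.
  apply: (@le_trans _ _ (\sum_(x <- rem one [seq x <- D M | cop T x]) w (nm x))).
    by apply: ler_sum => x _; exact: g_le.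
  (* A surviving element other than [one] has norm above [X0]: otherwise it has a prime divisor of
     norm at most [X0 <= Y], which belongs to [T]. *)
  apply: hX0; first by rewrite rem_uniq ?filter_uniq.
  move=> x; rewrite (rem_filter _ (filter_uniq _ (D_uniq M))) mem_filter /= => /andP[x1].
  rewrite mem_filter mem_D => /and3P[cx dx xM]; split=> //.
  rewrite ltnNge; apply/negP => xX0.
  have x1' : (1 < nm x)%N.
    rewrite ltn_neqAle nm_gt0 // andbT eq_sym; apply: contraNneq x1 => h.
    by rewrite (nm_eq1 dx h).
  have [p prp dvp] := pdiv dx x1'.
  have [y yd xE] := dvP prp dx dvp.
  have /(allP cx) : p \in T; last by rewrite dvp.
  rewrite mem_filter prp mem_D pr_dom //=.
  apply: leq_trans X0Y; apply: leq_trans xX0.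
  by rewrite xE nmM leq_pmulr // nm_gt0.
suff : normc (\prod_(p <- D Y | pr p) (1 - g p) * S [::] M - 1) <= 2^-1 by [].
move: h1; set A := \prod_(p <- D Y | pr p) _ => h1.
have -> : A * S [::] M - 1 = (S T M - 1) - (S T M - A * S [::] M) by ring.
by apply: le_trans (normcB _ _) _; lra.
Qed.

End Sieve.

(** * Euler factors and dyadic sums *)

Section SixthRoot.
Variable R : archiRcfType.
Implicit Types (k : nat) (x : R).

Definition zeta6 : R[i] := 2^-1 +i* (Num.sqrt 3 / 2).

(* twice the cosine of k pi / 3 *)
Definition cos6 (k : nat) : int := nth 0 [:: 2; 1; -1; -2; -1; 1] (k %% 6).

Lemma zeta6_2 : zeta6 ^+ 2 = (- 2^-1) +i* (Num.sqrt 3 / 2).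
Proof.
have s3 : Num.sqrt 3 ^+ 2 = 3 :> R by rewrite sqr_sqrtr // ler0n.
rewrite expr2; apply/eqP; rewrite eq_complex /=; apply/andP; split; apply/eqP; last by field.
suff -> : 2^-1 * 2^-1 - Num.sqrt 3 / 2 * (Num.sqrt 3 / 2) = 2^-1 * 2^-1 - (Num.sqrt 3 ^+ 2) / 4 :> R.
  by rewrite s3; field.
by field.
Qed.

Lemma zeta6_3 : zeta6 ^+ 3 = -1.
Proof.
have s3 : Num.sqrt 3 ^+ 2 = 3 :> R by rewrite sqr_sqrtr // ler0n.
rewrite exprS zeta6_2; apply/eqP; rewrite eq_complex /=; apply/andP; split; apply/eqP; last by field.
suff -> : 2^-1 * - 2^-1 - Num.sqrt 3 / 2 * (Num.sqrt 3 / 2) = - (2^-1 * 2^-1) - (Num.sqrt 3 ^+ 2) / 4 :> R.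
  by rewrite s3; field.
by field.
Qed.

Lemma zeta6_6 : zeta6 ^+ 6 = 1.
Proof. by rewrite (exprM _ 3 2) zeta6_3 sqrrN expr1n. Qed.

Lemma zeta6_mod k : zeta6 ^+ k = zeta6 ^+ (k %% 6).
Proof. by rewrite {1}(divn_eq k 6) exprD mulnC exprM zeta6_6 expr1n mul1r. Qed.

Lemma zeta6_Re k : Re (zeta6 ^+ k) = (cos6 k)%:~R / 2.
Proof.
rewrite zeta6_mod /cos6; have := ltn_pmod k (isT : 0 < 6)%N.
have h3 : Re (-1 : R[i]) = -1 by [].
have z4 : zeta6 ^+ 4 = - zeta6 by rewrite exprSr zeta6_3 mulN1r.
have z5 : zeta6 ^+ 5 = - zeta6 ^+ 2 by rewrite (exprD _ 3 2) zeta6_3 mulN1r.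
case: (k %% 6)%N => [|[|[|[|[|[|//]]]]]] _; rewrite ?z4 ?z5 ?zeta6_2 ?zeta6_3 /=; by field.
Qed.

Lemma normc_zeta6 : normc zeta6 = 1.
Proof.
apply/eqP; rewrite -(@eqrXn2 _ 6) ?normc_ge0 // expr1n -normcX zeta6_6.
by rewrite normc1.
Qed.

(** Squared absolute values make the Euler factor a polynomial with integer coefficients, in which
    the character enters only through its cosine. *)
Lemma zeta6_factor k x : normc (1 - zeta6 ^+ k * x%:C) ^+ 2 = 1 - (cos6 k)%:~R * x + x ^+ 2.
Proof.
have h : Re (zeta6 ^+ k) ^+ 2 + Im (zeta6 ^+ k) ^+ 2 = 1.
  by rewrite -normc_sqr normcX normc_zeta6 !expr1n.
have hr := zeta6_Re k; rewrite normc_sqr.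
case E: (zeta6 ^+ k) h hr => [a b] /= h hr.
have -> : (cos6 k)%:~R = 2 * a :> R by rewrite hr; field.
have hb : b ^+ 2 = 1 - a ^+ 2 by rewrite -h; ring.
have -> : (1 - (a * x - b * 0)) ^+ 2 + (0 - (a * 0 + b * x)) ^+ 2 =
  1 - 2 * a * x + a ^+ 2 * x ^+ 2 + b ^+ 2 * x ^+ 2 by ring.
by rewrite hb; ring.
Qed.

Lemma cos6_bound k : `|(cos6 k)%:~R| <= 2 :> R.
Proof.
rewrite /cos6; have := ltn_pmod k (isT : 0 < 6)%N.
by case: (k %% 6)%N => [|[|[|[|[|[|//]]]]]] _ /=; rewrite ler_norml; lra.
Qed.

(** To first order a product of Euler factors sees only the sum of the cosines. [K] depends on the
    number of factors alone, so the estimate is uniform over all primes and all [j]. *)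
Lemma prod_factor_bound (n : nat) : exists2 K : R, 0 <= K & forall (s : seq nat) x,
  size s = n -> 0 <= x <= 1 ->
  `|\prod_(k <- s) (1 - (cos6 k)%:~R * x + x ^+ 2) - (1 - (\sum_(k <- s) cos6 k)%:~R * x)|
    <= K * x ^+ 2.
Proof.
have sum_bound (s : seq nat) : `|(\sum_(k <- s) cos6 k)%:~R| <= 2 * (size s)%:R :> R.
  rewrite rmorph_sum /=; apply: le_trans (ler_norm_sum _ _ _) _.
  apply: (@le_trans _ _ (\sum_(k <- s) 2)).
    by apply: ler_sum => k _; exact: cos6_bound.
  by rewrite big_const_seq count_predT iter_addr_0 mulr_natr.
elim: n => [|n [K K0 IH]].
  by exists 0 => // -[|//] x _ _; rewrite !big_nil mul0r subr0 subrr normr0 mul0r.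
(* With [|c| <= 2] and [|t| <= 2 * n], the new coefficient [c * t + 1 - t * x] is at most
   [6 * n + 1], and the new Euler factor, which multiplies the old error, is at most 4. *)
exists (6 * n%:R + 1 + 4 * K) => [|[//|k s] x [sn] x01].
  by rewrite addr_ge0 ?mulr_ge0 ?addr_ge0 ?mulr_ge0 ?ler0n.
have := IH s x sn x01; rewrite !big_cons rmorphD /=.
have := sum_bound s; have := cos6_bound k; rewrite sn.
set c := (cos6 k)%:~R; set t := (\sum_(k <- s) _)%:~R; set P := \prod_(k <- s) _.
set e := P - (1 - t * x) => hc ht he.
have -> : (1 - c * x + x ^+ 2) * P - (1 - (c + t) * x) =
  (c * t + 1 - t * x) * x ^+ 2 + e * (1 - c * x + x ^+ 2) by rewrite /e; ring.
move: x01 => /andP[x0 x1].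
apply: le_trans (ler_normD _ _) _; rewrite normrM [`|e * _|]normrM.
have x20 : 0 <= x ^+ 2 by exact: sqr_ge0.
rewrite (ger0_norm x20).
have h1 : `|c * t + 1 - t * x| <= 6 * n%:R + 1.
  apply: le_trans (ler_normB _ _) _; rewrite normrM (ger0_norm x0).
  have g1 : `|c * t + 1| <= 4 * n%:R + 1.
    apply: le_trans (ler_normD _ _) _; rewrite normrM normr1 lerD2r.
    apply: (@le_trans _ _ (2 * (2 * n%:R))); last by rewrite mulrA; lra.
    by apply: ler_pM.
  have g2 : `|t| * x <= 2 * n%:R.
    by apply: le_trans ht; rewrite ler_piMr.
  lra.
have h2 : `|1 - c * x + x ^+ 2| <= 4.
  have x21 : x ^+ 2 <= 1 by rewrite expr_le1.
  have hcx : `|c * x| <= 2.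
    by rewrite normrM (ger0_norm x0); apply: le_trans hc; rewrite ler_piMr.
  by move: hcx; rewrite !ler_norml => /andP[? ?]; lra.
have h3 : `|e| * `|1 - c * x + x ^+ 2| <= K * x ^+ 2 * 4 by apply: ler_pM.
have h4 := ler_wpM2r x20 h1.
lra.
Qed.

End SixthRoot.

Section Dyadic.
Variable R : archiRcfType.

(** Bernoulli's inequality in the form [q ^ K * (1 + K * (1 - q)) <= 1], combined with the
    Archimedean property. *)
Lemma expr_small (q e : R) : 0 <= q < 1 -> 0 < e -> exists K, q ^+ K <= e.
Proof.
move=> /andP[q0 q1] e0.
have d0 : 0 < 1 - q by lra.
have B K : q ^+ K * (1 + K%:R * (1 - q)) <= 1.
  elim: K => [|K IH]; first by rewrite expr0 mul0r addr0 mulr1.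
  apply: le_trans IH; rewrite exprSr -mulrA ler_wpM2l ?exprn_ge0 //.
  have K0 : 0 <= K%:R * (1 - q) by rewrite mulr_ge0 ?ler0n // ltW.
  rewrite -(natr1 K) mulrDl mul1r; set a := K%:R * _ in K0 *.
  have : 0 <= (1 - q) ^+ 2 by exact: sqr_ge0.
  have : q * a <= a by rewrite ler_piMl // ltW.
  by rewrite expr2; lra.
have := archi_boundP (ltW (_ : 0 < (e * (1 - q))^-1)).
rewrite invr_gt0 mulr_gt0 // => /(_ isT); set K := Num.bound _ => hK.
exists K; have {}hK : 1 <= e * (K%:R * (1 - q)).
  rewrite mulrA -mulrAC -ler_pdivrMl ?mulr_gt0 // mulr1; exact: ltW.
have := B K; have qK : 0 <= q ^+ K by rewrite exprn_ge0.
set t := K%:R * _ in hK * => hB.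
have t0 : 0 < t by rewrite -(pmulr_rgt0 _ e0); lra.
rewrite -(ler_pM2r t0); apply: le_trans hK; rewrite mulrDr mulr1 in hB; lra.
Qed.

Lemma dyadic_sum (X : eqType) (F : seq X) (sh : X -> nat) (g : X -> R) (b q : R) (K : nat) :
  0 <= b -> 0 <= q < 1 ->
  (forall k, (K <= k)%N -> \sum_(x <- F | sh x == k) g x <= b * q ^+ k) ->
  (forall x, x \in F -> (K <= sh x)%N) ->
  \sum_(x <- F) g x <= b * q ^+ K / (1 - q).
Proof.
move=> b0 /andP[q0 q1] hsh hK; have d0 : 0 < 1 - q by lra.
have step n : \sum_(x <- F | (sh x < K + n)%N) g x <= b * q ^+ K * (1 - q ^+ n) / (1 - q).
  elim: n => [|n IH].
    rewrite addn0 expr0 subrr mulr0 mul0r big_seq_cond big_pred0 // => x.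
    by case: (boolP (x \in F)) => //= /hK; rewrite leqNgt => /negbTE.
  rewrite (bigID (fun x => sh x < K + n)%N) /=.
  rewrite (eq_bigl (fun x => sh x < K + n)%N); last by move=> x /=; lia.
  rewrite [X in _ + X](eq_bigl (fun x => sh x == K + n)%N); last by move=> x /=; lia.
  apply: le_trans (lerD IH (hsh _ (leq_addr _ _))) _.
  rewrite exprD exprS le_eqVlt; apply/orP; left; apply/eqP; field; lra.
pose m := (\max_(x <- F) sh x).+1.
have -> : \sum_(x <- F) g x = \sum_(x <- F | (sh x < K + m)%N) g x.
  rewrite big_seq [RHS]big_seq_cond; apply: eq_bigl => x.
  case: (boolP (x \in F)) => //= xF; apply/esym/ltn_addl.
  by rewrite /m ltnS; exact: leq_bigmax_seq.
apply: le_trans (step m) _.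
rewrite ler_wpM2r ?invr_ge0 ?(ltW d0) // ler_piMr ?mulr_ge0 ?exprn_ge0 //.
by rewrite gerBl exprn_ge0.
Qed.

Lemma sum_le_size (X : Type) (F : seq X) (P : pred X) (g : X -> R) (b : R) (n : nat) :
  0 <= b -> (forall x, P x -> g x <= b) -> (count P F <= n)%N ->
  \sum_(x <- F | P x) g x <= n%:R * b.
Proof.
move=> b0 gb cn; apply: (@le_trans _ _ (\sum_(x <- F | P x) b)); first exact: ler_sum.
by rewrite big_const_seq iter_addr_0 -[leLHS]mulr_natl ler_wpM2r // ler_nat.
Qed.

(** [2 * wt R j 2] is [2 ^ (1 - s)], the ratio of the bounds for consecutive dyadic blocks; it is
    below 1 because [s > 1]. *)
Lemma q_bounds j : 0 <= 2 * wt R j 2 < 1.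
Proof.
have := wt2_lt R j; have := wt_ge0 R j 2 => ? ?.
by apply/andP; split; lra.
Qed.

(** The block from [2 ^ k] to [2 ^ k.+1] has [2 ^ k] elements, each of weight at most
    [wt R j 2 ^ k]. *)
Lemma nat_tail j (e : R) : 0 < e -> exists M0, forall F : seq nat,
  uniq F -> (forall x, x \in F -> (0 < x)%N /\ (M0 < x)%N) ->
  \sum_(x <- F) wt R j x <= e.
Proof.
move=> e0; have qb := q_bounds j; set q := 2 * wt R j 2 in qb.
have d0 : 0 < 1 - q by case/andP: qb => ? ?; lra.
have [K hK] := expr_small qb (mulr_gt0 e0 d0).
exists (2 ^ K)%N => F uF hF.
apply: (@le_trans _ _ (1 * q ^+ K / (1 - q))); last first.
  by rewrite mul1r ler_pdivrMr.
apply: (@dyadic_sum _ F (trunc_log 2) _ 1 q K) => //; last first.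
  by move=> x /hF [x0 xK]; rewrite trunc_log_max // ltnW.
move=> k Kk; rewrite mul1r exprMn -wtX -natrX.
rewrite big_seq_cond.
have -> : \sum_(i <- F | (i \in F) && (trunc_log 2 i == k)) wt R j i =
  \sum_(i <- F | [&& i \in F, trunc_log 2 i == k & (2 ^ k <= i)%N]) wt R j i.
  apply: eq_bigl => x; case: (boolP (x \in F)) => //= /hF[x0 _].
  by case: eqP => //= <-; rewrite trunc_logP.
apply: sum_le_size; first exact: wt_ge0.
  by move=> x /and3P[_ _ h]; apply: wt_anti => //; rewrite expn_gt0.
rewrite -size_filter -[leqRHS](size_iota (2 ^ k)).
apply: uniq_leq_size; first exact: filter_uniq.
move=> x; rewrite mem_filter mem_iota => /andP[/and3P[_ /eqP xk kx] /hF[x0 _]].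
by rewrite kx (_ : (2 ^ k + 2 ^ k = 2 ^ k.+1)%N) -?xk ?trunc_log_ltn // expnS; lia.
Qed.

Lemma harmonic_unbounded n : n%:R / 2 <= \sum_(1 <= m < (2 ^ n).+1) m%:R^-1 :> R.
Proof.
elim: n => [|n IH]; first by rewrite mul0r sumr_ge0 // => i _; rewrite invr_ge0 ler0n.
rewrite (@big_cat_nat _ _ _ (2 ^ n).+1) //=; last by rewrite ltnS leq_exp2l.
rewrite -natr1 mulrDl; apply: lerD => //.
apply: (@le_trans _ _ (\sum_((2 ^ n).+1 <= m < (2 ^ n.+1).+1) (2 ^ n.+1)%:R^-1)).
  rewrite sumr_const_nat subSS (_ : (2 ^ n.+1 - 2 ^ n = 2 ^ n)%N); last by rewrite expnS; lia.
  rewrite -[leRHS]mulr_natl expnS natrM invfM mulrCA divff ?mulr1 ?mul1r //.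
  by rewrite pnatr_eq0 expn_eq0.
rewrite !big_nat; apply: ler_sum => m /andP[h1 h2].
by rewrite lef_pV2 ?posrE ?ltr0n ?expn_gt0 // ?ler_nat //; lia.
Qed.

End Dyadic.

(** * Characters modulo 21 *)

(* discrete logarithm to the base 3 modulo 7 *)
Definition dlog7 (n : nat) : nat := nth 0%N [:: 0; 0; 2; 1; 4; 5; 3]%N (n %% 7).

Lemma dlog7M m n : ~~ (7 %| m)%N -> ~~ (7 %| n)%N ->
  dlog7 (m * n) = dlog7 m + dlog7 n %[mod 6].
Proof.
rewrite /dlog7 /dvdn -modnMm; have := ltn_pmod m (isT : 0 < 7)%N; have := ltn_pmod n (isT : 0 < 7)%N.
by move: (m %% 7)%N (n %% 7)%N; do 7?[case=> //]; do 7?[case=> //].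
Qed.

(* zeta6 ^ exp21 i e n runs over the Dirichlet characters modulo 21 *)
Definition exp21 (i e n : nat) : nat := (i * dlog7 n + 3 * (e * (n %% 3 == 2)))%N.

Lemma exp21M i e m n : coprime m 21 -> coprime n 21 ->
  exp21 i e (m * n) = exp21 i e m + exp21 i e n %[mod 6].
Proof.
rewrite (coprimeMr _ 3 7) (coprimeMr n 3 7) ![coprime _ 3]coprime_sym ![coprime _ 7]coprime_sym.
rewrite !prime_coprime // => /andP[m3 m7] /andP[n3 n7].
have h := dlog7M m7 n7.
have h2 : ((m * n %% 3 == 2) = (m %% 3 == 2) (+) (n %% 3 == 2))%N.
  rewrite -modnMm; move: m3 n3; rewrite /dvdn.
  have := ltn_pmod m (isT : 0 < 3)%N; have := ltn_pmod n (isT : 0 < 3)%N.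
  by move: (m %% 3)%N (n %% 3)%N; do 3?[case=> //]; do 3?[case=> //].
have h3 : (3 * (e * (m * n %% 3 == 2)) = 3 * (e * (m %% 3 == 2)) + 3 * (e * (n %% 3 == 2)) %[mod 6])%N.
  rewrite h2; case: (m %% 3 == 2)%N; case: (n %% 3 == 2)%N; rewrite /= ?muln0 ?muln1 ?addn0 //.
  by rewrite (_ : 3 * e + 3 * e = e * 6)%N ?modnMl //; lia.
rewrite /exp21 -modnDm -modnMmr h h3 modnMmr modnDm mulnDr.
by congr (_ %% _)%N; lia.
Qed.

Section CharactersMod21.
Variable R : archiRcfType.

Definition char21 (i e n : nat) : R[i] :=
  if coprime n 21 then zeta6 R ^+ exp21 i e n else 0.

Lemma char21M i e m n : char21 i e (m * n) = char21 i e m * char21 i e n.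
Proof.
rewrite /char21 coprimeMl; case: (boolP (coprime m 21)) => hm; rewrite ?mul0r //=.
case: (boolP (coprime n 21)) => hn; rewrite ?mulr0 //.
by rewrite -exprD zeta6_mod exp21M // -zeta6_mod.
Qed.

Lemma char21_1 i e : char21 i e 1 = 1.
Proof. by rewrite /char21 /exp21 /= !muln0. Qed.

Lemma char21_le1 i e n : normc (char21 i e n) <= 1.
Proof.
rewrite /char21; case: ifP => _; last by rewrite normc0.
by rewrite normcX normc_zeta6 expr1n.
Qed.

Definition cos21 (i e n : nat) : int := if coprime n 21 then cos6 (exp21 i e n) else 0.

Lemma cos21_period i e n : cos21 i e (n + 21) = cos21 i e n.
Proof.
rewrite /cos21 -[coprime (n + 21) _]coprime_modl -[coprime n _]coprime_modl modnDr.
by rewrite /exp21 /dlog7 -(modnDmr n 21 7) addn0 -(modnDmr n 21 3) addn0.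
Qed.

Lemma char21_Re i e n j : Re (char21 i e n * (wt R j n)%:C) = (cos21 i e n)%:~R * wt R j n / 2.
Proof.
have -> (z : R[i]) (x : R) : Re (z * x%:C) = Re z * x.
  by case: z => a b /=; rewrite mulr0 subr0.
rewrite /char21 /cos21; case: ifP => _; last by rewrite !mul0r.
by rewrite zeta6_Re mulrAC.
Qed.

(** Summation by parts. The induction [H] carries the difference from the boundary term
    [(\sum c) * g M], because the bound for this difference telescopes to [b * (g a - g M)]. *)
Lemma abel_bound (c g : nat -> R) (a : nat) (b : R) :
  (forall n, (a <= n)%N -> g n.+1 <= g n) -> (forall n, 0 <= g n) ->
  (forall M, (a <= M)%N -> `|\sum_(a <= n < M) c n| <= b) ->
  forall M, (a <= M)%N -> `|\sum_(a <= n < M) c n * g n| <= b * g a.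
Proof.
move=> gd g0 hb M aM.
have b0 : 0 <= b by apply: le_trans (hb a (leqnn a)); rewrite normr_ge0.
have H : `|\sum_(a <= n < M) c n * g n - (\sum_(a <= n < M) c n) * g M| <= b * (g a - g M).
  elim: M aM => [|M IH].
    by rewrite leqn0 => /eqP->; rewrite !big_geq // mul0r subrr normr0 subrr mulr0.
  rewrite leq_eqVlt => /orP[/eqP<-|]; first by rewrite !big_geq // mul0r subrr normr0 subrr mulr0.
  rewrite ltnS => aM; have {IH} := IH aM.
  have := hb M.+1 (leqW aM); rewrite !big_nat_recr //=.
  set S := \sum_(a <= i < M) c i * _; set P := \sum_(a <= i < M) c i => hP IH.
  have -> : S + c M * g M - (P + c M) * g M.+1 = (S - P * g M) + (P + c M) * (g M - g M.+1) by ring.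
  apply: le_trans (ler_normD _ _) _; rewrite [`|_ * (g M - _)|]normrM.
  have d0 : 0 <= g M - g M.+1 by rewrite subr_ge0 gd.
  rewrite (ger0_norm d0); have := ler_wpM2r d0 hP; lra.
have -> : \sum_(a <= n < M) c n * g n =
  (\sum_(a <= n < M) c n * g n - (\sum_(a <= n < M) c n) * g M) + (\sum_(a <= n < M) c n) * g M.
  by rewrite subrK.
apply: le_trans (ler_normD _ _) _; rewrite [X in _ + X]normrM (ger0_norm (g0 M)).
by have := ler_wpM2r (g0 M) (hb M aM); lra.
Qed.

(** The removed head is [(0, 0)], the principal character. *)
Definition nonprincipal21 : seq (nat * nat) :=
  behead [seq (i, e) | i <- iota 0 6, e <- iota 0 2].

(** The values have period 21 and sum to 0 over a period, so 21 partial sums decide the bound.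
    Starting at 22 amounts to starting at 0, since the value at 21 is also 0. *)
Lemma cos21_partial ie M : ie \in nonprincipal21 ->
  `|\sum_(22 <= n < M) cos21 ie.1 ie.2 n| <= 6 :> int.
Proof.
move=> hie; set c := cos21 _ _.
have chk : all (fun ie => (\sum_(0 <= n < 21) cos21 ie.1 ie.2 n == 0) &&
    all (fun r => `|\sum_(0 <= n < r) cos21 ie.1 ie.2 n| <= 6) (iota 0 21)) nonprincipal21.
  by rewrite unlock; vm_compute.
have /(_ _ hie)/andP[/eqP z0 /allP bd] := allP chk.
have [M22|M22] := leqP M 22; first by rewrite big_geq.
have per n : \sum_(0 <= m < n + 21) c m = \sum_(0 <= m < n) c m.
  elim: n => [|n IH]; first by rewrite add0n z0 big_geq.
  by rewrite addSn !big_nat_recr //= IH /c cos21_period.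
have -> : \sum_(22 <= n < M) c n = \sum_(0 <= n < M) c n.
  rewrite (@big_cat_nat _ _ _ 22 0) //=; last exact: ltnW.
  by rewrite (per 1%N) big_nat1 add0r.
have -> : \sum_(0 <= n < M) c n = \sum_(0 <= n < M %% 21) c n.
  rewrite {1}(divn_eq M 21); elim: (M %/ 21)%N => [//|k IH].
  by rewrite mulSn -addnA addnC per.
by apply: bd; rewrite mem_iota ltn_pmod.
Qed.

(** The real part already suffices. Below 22 the weights are squeezed between [9 / 10 / n] and
    [1 / n]; from 22 on, Abel summation bounds the contribution by [6 / 22]. The remaining
    inequality is linear and holds for each of the eleven characters. *)
Lemma char21_lower ie : ie \in nonprincipal21 -> exists j0, forall j, (j0 <= j)%N ->
  forall M, (22 <= M)%N ->
  10^-1 <= normc (\sum_(n <- iota 1 M) char21 ie.1 ie.2 n * (wt R j n)%:C).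
Proof.
(* [6] gives [(10 / 9) ^ (2 ^ 6) >= 2 ^ 8], which exceeds every [n <= 20], as [wt_near] requires for
   [c = 10 / 9]. *)
move=> hie; exists 6 => j j6 M M22.
apply: le_trans (Re_le_normc _); rewrite Re_sum.
under eq_bigr do rewrite char21_Re.
rewrite -mulr_suml ler_pdivlMr //.
have -> : \sum_(n <- iota 1 M) (cos21 ie.1 ie.2 n)%:~R * wt R j n =
  \sum_(1 <= n < 22) (cos21 ie.1 ie.2 n)%:~R * wt R j n +
  \sum_(22 <= n < M.+1) (cos21 ie.1 ie.2 n)%:~R * wt R j n.
  by rewrite -big_cat_nat //= ?ltnS ?(ltnW M22) // /index_iota subn1.
have tl : `|\sum_(22 <= n < M.+1) (cos21 ie.1 ie.2 n)%:~R * wt R j n| <= 6 * wt R j 22.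
  have gm n : wt R j (maxn n.+1 22) <= wt R j (maxn n 22).
    by apply: wt_anti; lia.
  have bd N : (22 <= N)%N -> `|\sum_(22 <= n < N) (cos21 ie.1 ie.2 n)%:~R : R| <= 6.
    move=> _; rewrite -rmorph_sum /= -intr_norm (_ : 6 = 6%:~R) // ler_int.
    exact: cos21_partial.
  have := @abel_bound (fun n => (cos21 ie.1 ie.2 n)%:~R) (fun n => wt R j (maxn n 22)) 22 6
    (fun n _ => gm n) (fun n => wt_ge0 _ _ _) bd M.+1 (leqW M22).
  rewrite maxnn; apply: le_trans; rewrite le_eqVlt; apply/orP; left; apply/eqP.
  congr `|_|; rewrite !big_nat; apply: eq_bigr => n /andP[h _].
  by rewrite (maxn_idPl h).
have ub n := wt_le_inv R j n.
have lb n : (0 < n)%N -> (n <= 20)%N -> 9 / 10 * n%:R^-1 <= wt R j n.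
  move=> n0 n20; have c1 : 1 <= 10 / 9 :> R by lra.
  have hn : n%:R <= (10 / 9) ^+ (2 ^ j) :> R.
    apply: (@le_trans _ _ ((10 / 9) ^+ (2 ^ 6))); last by apply: ler_weXn2l; rewrite ?leq_exp2l.
    have h2 : 2 <= (10 / 9) ^+ 8 :> R by rewrite !exprS expr0; lra.
    apply: (@le_trans _ _ (2 ^+ 8)).
      by rewrite -natrX ler_nat (leq_trans n20).
    by rewrite (exprM _ 8 8); apply: lerXn2r; rewrite ?nnegrE //; lra.
  by have := wt_near c1 n0 hn; rewrite invfM invf_div.
have {tl} tl : - (6 / 22) <= \sum_(22 <= n < M.+1) (cos21 ie.1 ie.2 n)%:~R * wt R j n.
  by move: tl; rewrite ler_norml => /andP[h _]; have := ub 22%N; lra.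
have u1 := ub 1%N; have u2 := ub 2%N; have u4 := ub 4%N; have u5 := ub 5%N.
have u8 := ub 8%N; have u10 := ub 10%N; have u11 := ub 11%N; have u13 := ub 13%N.
have u16 := ub 16%N; have u17 := ub 17%N; have u19 := ub 19%N; have u20 := ub 20%N.
have l1 := lb 1%N isT isT; have l2 := lb 2%N isT isT; have l4 := lb 4%N isT isT.
have l5 := lb 5%N isT isT; have l8 := lb 8%N isT isT; have l10 := lb 10%N isT isT.
have l11 := lb 11%N isT isT; have l13 := lb 13%N isT isT; have l16 := lb 16%N isT isT.
have l17 := lb 17%N isT isT; have l19 := lb 19%N isT isT; have l20 := lb 20%N isT isT.
move: (\sum_(22 <= n < M.+1) _) tl => tl htl.
have -> : \sum_(1 <= n < 22) (cos21 ie.1 ie.2 n)%:~R * wt R j n =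
  \sum_(n <- [:: 1; 2; 4; 5; 8; 10; 11; 13; 16; 17; 19; 20]%N) (cos21 ie.1 ie.2 n)%:~R * wt R j n.
  rewrite /index_iota /= !big_cons !big_nil /cos21.
  by rewrite /= !mul0r !add0r.
rewrite !big_cons big_nil; clear ub lb; move: (wt R j) u1 u2 u4 u5 u8 u10 u11 u13 u16 u17 u19 u20 l1 l2 l4 l5 l8 l10 l11 l13 l16 l17 l19 l20 => W.
move=> *; move: hie; rewrite /nonprincipal21 /= !inE.
by do 10?[case/orP]; move=> /eqP -> /=; rewrite /cos21 /= /cos6 /exp21 /dlog7 /=; lra.
Qed.

End CharactersMod21.

(** * Primes congruent to 1 modulo 21 *)

Section PrimesMod21.
Variable R : archiRcfType.

Lemma nat_sieve j (f : nat -> R[i]) :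
  (forall x y, f (x * y)%N = f x * f y) -> f 1%N = 1 -> (forall x, normc (f x) <= 1) ->
  exists X0, forall Y, (X0 <= Y)%N -> exists M0, forall M, (M0 <= M)%N ->
  normc (\prod_(p <- iota 1 Y | prime p) (1 - f p * (wt R j p)%:C) *
         \sum_(x <- iota 1 M) f x * (wt R j x)%:C - 1) <= 2^-1.
Proof.
move=> fM f1 fle.
apply: (@sieve R nat 1%N muln dvdn id (fun n => 0 < n)%N prime (iota 1)) => //.
- by move=> M; exact: iota_uniq.
- by move=> M x; rewrite mem_iota add1n ltnS.
- by move=> x y x0 y0; rewrite muln_gt0 x0.
- by move=> p; exact: prime_gt0.
- by move=> p; exact: prime_gt1.
- move=> p x pp x0 /dvdnP[y xE]; exists y; last by rewrite mulnC.
  by move: x0; rewrite xE muln_gt0 => /andP[].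
- by move=> p y _ _; rewrite dvdn_mulr.
- move=> p pp x y _ _ /eqP; rewrite eqn_pmul2l ?prime_gt0 // => /eqP //.
- move=> p p' x pp pp' ne x0; rewrite Euclid_dvdM // dvdn_prime2 //.
  by rewrite eq_sym (negbTE ne).
- by move=> x x0 x1; exists (pdiv x); rewrite ?pdiv_prime ?pdiv_dvd.
- exact: wt_ge0.
- exact: wt_le1.
- exact: wtM.
- exact: wt1.
- exact: nat_tail.
Qed.

(** By the sieve the product times the series has absolute value at most [3 / 2], so a lower bound
    for the series is an upper bound for the inverse Euler product. *)
Lemma nat_prod_le j (f : nat -> R[i]) (c : R) M1 :
  (forall x y, f (x * y)%N = f x * f y) -> f 1%N = 1 -> (forall x, normc (f x) <= 1) ->
  0 < c -> (forall M, (M1 <= M)%N -> c <= normc (\sum_(x <- iota 1 M) f x * (wt R j x)%:C)) ->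
  exists X0, forall Y, (X0 <= Y)%N ->
  normc (\prod_(p <- iota 1 Y | prime p) (1 - f p * (wt R j p)%:C)) <= 3 / 2 / c.
Proof.
move=> fM f1 fle c0 hc; have [X0 hX] := nat_sieve j fM f1 fle.
exists X0 => Y /hX[M0 hM]; set P := \prod_(p <- _ | _) _ in hM *.
have := hM _ (leq_maxl M0 M1); have := hc _ (leq_maxr M0 M1).
set S := \sum_(x <- _) _ => h1 h2.
have h3 : normc (P * S) <= 3 / 2.
  have -> : P * S = (P * S - 1) + 1 by rewrite subrK.
  by apply: le_trans (le_normcD _ _) _; rewrite normc1; lra.
rewrite ler_pdivlMr //; apply: le_trans h3; rewrite normcM.
by rewrite ler_wpM2l ?normc_ge0.
Qed.

(** For [m <= 2 ^ n] and [n <= j] the weight is at least half of [1 / m], so the divergence of the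
    harmonic series carries over. *)
Lemma zeta_large (Z : R) : exists j0 M0, forall j, (j0 <= j)%N -> forall M, (M0 <= M)%N ->
  Z <= normc (\sum_(x <- iota 1 M) 1 * (wt R j x)%:C).
Proof.
have [n hn] : exists n : nat, 4 * Z <= n%:R.
  exists (Num.bound (4 * Z)); apply: ltW; apply: le_lt_trans (ler_norm _) _.
  by have := archi_boundP (normr_ge0 (4 * Z)); rewrite /Num.bound normr_id.
exists n, (2 ^ n)%N => j nj M nM.
apply: le_trans (Re_le_normc _); rewrite Re_sum.
under eq_bigr do rewrite mul1r /=.
apply: (@le_trans _ _ (\sum_(1 <= m < (2 ^ n).+1) (m%:R^-1 / 2 : R))).
  by rewrite -mulr_suml; have := harmonic_unbounded R n; lra.
apply: (@le_trans _ _ (\sum_(1 <= m < (2 ^ n).+1) wt R j m)).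
  rewrite !big_nat; apply: ler_sum => m /andP[m0 mn].
  rewrite -invfM mulrC; apply: wt_near => //; first by lra.
  rewrite -natrX ler_nat; rewrite ltnS in mn; apply: leq_trans mn _; rewrite leq_exp2l //.
  by apply: leq_trans nj _; apply: ltnW; apply: ltn_expl.
have -> : \sum_(i <- iota 1 M) wt R j i = \sum_(1 <= m < M.+1) wt R j m.
  by rewrite /index_iota subn1.
rewrite [leRHS](@big_cat_nat _ _ _ (2 ^ n).+1) //= ?ltnS //.
by rewrite lerDl sumr_ge0 // => i _; exact: wt_ge0.
Qed.

(** The Weierstrass product inequality. *)
Lemma prod_one_sub_ge (I : Type) (s : seq I) (P : pred I) (x : I -> R) :
  (forall i, P i -> 0 <= x i <= 1) ->
  1 - \sum_(i <- s | P i) x i <= \prod_(i <- s | P i) (1 - x i).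
Proof.
move=> x01.
have : 0 <= \prod_(i <- s | P i) (1 - x i) <= 1 /\ 1 - \sum_(i <- s | P i) x i <= \prod_(i <- s | P i) (1 - x i).
  elim: s => [|i s [/andP[IH0 IH1] IH]]; first by rewrite !big_nil; split; lra.
  rewrite !big_cons; case: ifP => Pi; last (by rewrite IH0 IH1); have /andP[x0 x1] := x01 i Pi.
  move: (\prod_(j <- s | P j) _) (\sum_(j <- s | P j) _) IH0 IH1 IH => p t p0 p1 h.
  by split; first (apply/andP; split); nra.
by case.
Qed.

(** Telescoping, from [n ^- 2 <= 1 / (n - 1) - 1 / n]. *)
Lemma sum_inv_sqr P0 Y : (0 < P0)%N ->
  \sum_(P0.+1 <= n < Y) (n%:R ^- 2 : R) <= P0%:R^-1.
Proof.
move=> P00; have [YP|PY] := ltnP Y P0.+1.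
  by rewrite big_geq ?(ltnW YP) // invr_ge0 ler0n.
suff : \sum_(P0.+1 <= n < Y) (n%:R ^- 2 : R) <= P0%:R^-1 - Y.-1%:R^-1.
  by move/le_trans; apply; rewrite gerBl invr_ge0 ler0n.
elim: Y PY => // Y IH; rewrite leq_eqVlt => /orP[/eqP <-|]; first by rewrite big_geq //= subrr.
rewrite ltnS => PY; rewrite big_nat_recr //=.
apply: le_trans (lerD (IH PY) (lexx _)) _.
have Y1 : 1 < Y%:R :> R by rewrite ltr1n (leq_ltn_trans P00).
have -> : Y.-1%:R = Y%:R - 1 :> R by rewrite -subn1 natrB ?(leq_trans P00) // ltnW.
rewrite -lerBrDl -subr_ge0.
have -> : P0%:R^-1 - Y%:R^-1 - (P0%:R^-1 - (Y%:R - 1)^-1) - Y%:R ^- 2 = (Y%:R ^+ 2 * (Y%:R - 1))^-1 :> R.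
  have Y0 : 0 < Y%:R :> R by lra.
  have P0r : 0 < P0%:R :> R by rewrite ltr0n.
  by field; rewrite !gt_eqF ?subr_gt0.
by rewrite invr_ge0 mulr_ge0 ?sqr_ge0 //; lra.
Qed.

Definition exps21 (p : nat) : seq nat := [seq exp21 ie.1 ie.2 p | ie <- (0, 0)%N :: nonprincipal21].

(** Orthogonality of the twelve characters; the value 24 arises because [cos6] is twice a cosine. *)
Lemma exps21_sum p : coprime p 21 ->
  \sum_(k <- exps21 p) cos6 k = if (p %% 21 == 1)%N then 24 else 0.
Proof.
move=> p21.
have chk : all (fun r => coprime r 21 ==>
   (\sum_(k <- exps21 r) cos6 k == if (r == 1)%N then 24 else 0)) (iota 0 21).
  by rewrite unlock; vm_compute.
have -> : exps21 p = exps21 (p %% 21).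
  apply: eq_map => ie; rewrite /exp21 /dlog7.
  by rewrite (modn_dvdm p (isT : 7 %| 21)%N) (modn_dvdm p (isT : 3 %| 21)%N).
have /(allP chk) : (p %% 21 \in iota 0 21)%N by rewrite mem_iota ltn_pmod.
by rewrite coprime_modl p21 /= => /eqP.
Qed.

Lemma exps21_one p : (p %% 21 == 1)%N -> all (fun k => cos6 k == 2) (exps21 p).
Proof.
move=> /eqP p1; rewrite /exps21 all_map; apply/allP => ie _ /=.
rewrite /exp21 /dlog7 -(modn_dvdm p (isT : 7 %| 21)%N) -(modn_dvdm p (isT : 3 %| 21)%N) p1.
by rewrite /= !muln0.
Qed.

(* the Euler factors at p of all the characters modulo 21 *)
Definition H21 j p : R := normc (1 - 1 * (wt R j p)%:C) ^+ 2 *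
  \prod_(ie <- nonprincipal21) normc (1 - char21 R ie.1 ie.2 p * (wt R j p)%:C) ^+ 2.

Lemma H21_coprime j p : coprime p 21 ->
  H21 j p = \prod_(k <- exps21 p) (1 - (cos6 k)%:~R * wt R j p + wt R j p ^+ 2).
Proof.
move=> p21; rewrite /H21 /exps21 big_map big_cons; congr (_ * _).
  by rewrite -(expr0 (zeta6 R)) zeta6_factor /exp21 !mul0n.
by apply: eq_bigr => ie _; rewrite /char21 p21 zeta6_factor.
Qed.

(** The weight of a prime is at most 1/2, so each of the twelve squared factors is at least 1/4.
    This serves for the finitely many small primes. *)
Lemma H21_lower : exists2 q : R, 0 < q <= 1 & forall j p, prime p -> q <= H21 j p.
Proof.
exists (4^-1 * \prod_(ie <- nonprincipal21) 4^-1) => [|j p pp].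
  have q01 : 0 < 4^-1 :> R /\ 4^-1 <= 1 :> R by split; lra.
  have : 0 < \prod_(ie <- nonprincipal21) 4^-1 :> R by apply: prodr_gt0 => ie _; lra.
  have : \prod_(ie <- nonprincipal21) 4^-1 <= 1 :> R.
    by apply: prodr_ile1 => ie _; apply/andP; split; lra.
  by move: (\prod_(ie <- _) _) => m m1 m0; apply/andP; split; nra.
have w2 := wt_le_half R j (prime_gt1 pp); have w0 := wt_ge0 R j p.
have n4 (f : R[i]) : normc f <= 1 -> 4^-1 <= normc (1 - f * (wt R j p)%:C) ^+ 2.
  move=> f1; have : 1 <= normc (1 - f * (wt R j p)%:C) + normc (f * (wt R j p)%:C).
    rewrite -{1}(normc1 R); apply: le_trans (le_normcD _ _); by rewrite subrK.
  rewrite normcM (normc_real w0) => h.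
  have hw : normc f * wt R j p <= 2^-1.
    by apply: le_trans w2; rewrite ler_piMl.
  have h2 : 2^-1 <= normc (1 - f * (wt R j p)%:C) by lra.
  by rewrite expr2; apply: le_trans (ler_pM _ _ h2 h2); lra.
rewrite /H21; apply: ler_pM; rewrite ?invr_ge0 //.
- by apply: prodr_ge0 => ie _; rewrite invr_ge0.
- by apply: n4; rewrite normc1.
by apply: ler_prod => ie _; rewrite invr_ge0 ler0n n4 ?char21_le1.
Qed.

Lemma H21_one j p : prime p -> (p %% 21 == 1)%N -> H21 j p = (1 - wt R j p) ^+ 24.
Proof.
move=> pp p1; have p21 : coprime p 21.
  by rewrite -coprime_modl (eqP p1).
rewrite H21_coprime // (exprM _ 2 12).
have -> : \prod_(k <- exps21 p) (1 - (cos6 k)%:~R * wt R j p + wt R j p ^+ 2) =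
   \prod_(k <- exps21 p) (1 - wt R j p) ^+ 2.
  rewrite big_seq [RHS]big_seq; apply: eq_bigr => k kp.
  by rewrite (eqP (allP (exps21_one p1) k kp)); ring.
by rewrite big_const_seq count_predT /exps21 size_map /= !exprS expr0.
Qed.

Lemma perm_filter_iota a Y :
  perm_eq [seq p <- iota 1 Y | (a < p)%N] (index_iota a.+1 Y.+1).
Proof.
apply: uniq_perm; rewrite ?filter_uniq ?iota_uniq //.
by move=> x; rewrite mem_filter mem_iota mem_index_iota; lia.
Qed.

Lemma eventually_all (T : eqType) (s : seq T) (P : T -> nat -> Prop) :
  (forall t, t \in s -> exists n0, forall n, (n0 <= n)%N -> P t n) ->
  exists n0, forall n, (n0 <= n)%N -> forall t, t \in s -> P t n.
Proof.
elim: s => [|t s IH] h; first by exists 0%N.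
have [n1 h1] := h t (mem_head _ _).
have [|n2 h2] := IH; first by move=> u us; apply: h; rewrite inE us orbT.
exists (maxn n1 n2) => n; rewrite geq_max => /andP[n1n n2n] u.
by rewrite inE => /orP[/eqP->|us]; [exact: h1 | exact: h2].
Qed.

(** The factor of the trivial character is at most [3 / 2 / Z], where [Z] may be arbitrarily large,
    while each of the other eleven is at most [15 = 3 / 2 / 10^-1] by [char21_lower]. *)
Lemma H21_upper : exists2 c : R, 0 < c & forall Z : R, 0 < Z ->
  exists j0, forall j, (j0 <= j)%N -> exists X0, forall Y, (X0 <= Y)%N ->
  \prod_(p <- iota 1 Y | prime p) H21 j p <= c / Z ^+ 2.
Proof.
pose c : R := \prod_(ie <- nonprincipal21) 15 ^+ 2.
have c0 : 0 < c by apply: prodr_gt0 => ie _; rewrite exprn_gt0.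
exists ((3 / 2) ^+ 2 * c) => [|Z Z0]; first by rewrite mulr_gt0 ?exprn_gt0 // divr_gt0.
rewrite mulrAC -expr_div_n; have [j1 [M1 hZ]] := zeta_large Z.
have [j2 hj2] := eventually_all (fun ie => @char21_lower R ie).
exists (maxn j1 j2) => j; rewrite geq_max => /andP[j1j j2j].
have [X1 hX1] : exists X0, forall Y, (X0 <= Y)%N ->
    normc (\prod_(p <- iota 1 Y | prime p) (1 - 1 * (wt R j p)%:C)) <= 3 / 2 / Z.
  apply: (@nat_prod_le j (fun=> 1) Z M1) => //.
  - by move=> *; rewrite mul1r.
  - by move=> *; rewrite normc1.
  - exact: hZ.
have [X2 hX2] := @eventually_all _ nonprincipal21 (fun ie Y =>
    normc (\prod_(p <- iota 1 Y | prime p) (1 - char21 R ie.1 ie.2 p * (wt R j p)%:C)) <= 3 / 2 / 10^-1)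
  (fun ie hie => @nat_prod_le j _ 10^-1 22 (char21M R ie.1 ie.2) (char21_1 R _ _)
     (char21_le1 R _ _) ltac:(by rewrite invr_gt0) (hj2 j j2j ie hie)).
exists (maxn X1 X2) => Y; rewrite geq_max => /andP[X1Y X2Y].
have -> : \prod_(p <- iota 1 Y | prime p) H21 j p =
  normc (\prod_(p <- iota 1 Y | prime p) (1 - 1 * (wt R j p)%:C)) ^+ 2 *
  \prod_(ie <- nonprincipal21)
    normc (\prod_(p <- iota 1 Y | prime p) (1 - char21 R ie.1 ie.2 p * (wt R j p)%:C)) ^+ 2.
  rewrite /H21 big_split exchange_big prodrXl -normc_prod; congr (_ * _).
  by apply: eq_bigr => ie _; rewrite prodrXl -normc_prod.
apply: ler_pM.
- by rewrite exprn_ge0 ?normc_ge0.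
- by apply: prodr_ge0 => ie _; rewrite exprn_ge0 ?normc_ge0.
- by apply: lerXn2r; rewrite ?nnegrE ?normc_ge0 ?hX1 // !divr_ge0 // ltW.
rewrite /c big_seq [leRHS]big_seq; apply: ler_prod => ie hie; apply/andP; split.
  by rewrite exprn_ge0 ?normc_ge0.
apply: lerXn2r; rewrite ?nnegrE ?normc_ge0 //.
by apply: le_trans (hX2 Y X2Y ie hie) _; rewrite invrK; lra.
Qed.

(** By orthogonality [H21] is [(1 - wt) ^ 24] at primes 1 modulo 21 and [1 + O(p ^- 2)] at other
    primes not dividing 21. Hence the product over all primes is, up to a constant factor from
    below, the 24th power of the product in question, and [H21_upper] makes it small. *)
Lemma primes_1_mod_21 (B0 : nat) (e : R) : 0 < e -> exists j0, forall j, (j0 <= j)%N ->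
  exists X0, forall Y, (X0 <= Y)%N ->
  \prod_(p <- iota 1 Y | [&& prime p, (p %% 21 == 1)%N & (B0 < p)%N]) (1 - wt R j p) <= e.
Proof.
move=> e0; have [K K0 hK] := prod_factor_bound R 12.
(* Primes above [P1] are prime to 21, and [2 * K <= P1] makes the sum of the errors [K * p ^- 2]
   over them at most 1/2. *)
pose P1 := maxn (maxn B0 21) (Num.bound (2 * K)).
have KP1 : 2 * K <= P1%:R.
  apply: (@le_trans _ _ (Num.bound (2 * K))%:R); last by rewrite ler_nat leq_maxr.
  by apply: ltW; apply: archi_boundP; rewrite mulr_ge0.
have P10 : (0 < P1)%N by rewrite /P1; lia.
have B0P1 : (B0 <= P1)%N by rewrite /P1; lia.
have P121 : (21 <= P1)%N by rewrite /P1; lia.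
have [q /andP[q0 q1] hq] := H21_lower; have [c2 c20 hc2] := H21_upper.
pose c1 : R := q ^+ P1.
have c10 : 0 < c1 by rewrite exprn_gt0.
have e24 : 0 < e ^+ 24 by rewrite exprn_gt0.
(* Chosen so that [c2 / Z ^ 2 <= c2 / Z <= c1 / 2 * e ^ 24]. *)
pose Z : R := 1 + c2 / (c1 / 2 * e ^+ 24).
have d0 : 0 < c2 / (c1 / 2 * e ^+ 24) by rewrite divr_gt0 // mulr_gt0 // divr_gt0.
have Z1 : 1 <= Z by rewrite /Z lerDl ltW.
have Z0 : 0 < Z by lra.
have [j0 hj] := hc2 Z Z0; exists j0 => j /hj[X0 hX]; exists X0 => Y /hX {hX}.
set T := \prod_(p <- _ | [&& _, _ & _]) _ => up.
pose A := \prod_(p <- iota 1 Y | [&& prime p, (p %% 21 == 1)%N & (P1 < p)%N]) (1 - wt R j p).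
have w01 p : 0 <= 1 - wt R j p <= 1.
  by have := wt_ge0 R j p; have := wt_le1 R j p => ? ?; apply/andP; split; lra.
have TA : T <= A.
  rewrite /T (bigID (fun p => P1 < p)%N) /=.
  rewrite (eq_bigl (fun p => [&& prime p, (p %% 21 == 1)%N & (P1 < p)%N])); last first.
    move=> p; case: (boolP (P1 < p)%N) => h; rewrite ?andbF ?andbT //.
    by rewrite (leq_ltn_trans B0P1 h) andbT.
  rewrite ler_piMr ?prodr_ge0 //; first by move=> p _; case/andP: (w01 p).
  by apply: prodr_ile1 => p _.
have A0 : 0 <= A by apply: prodr_ge0 => p _; case/andP: (w01 p).
have T0 : 0 <= T by apply: prodr_ge0 => p _; case/andP: (w01 p).
suff A24 : A ^+ 24 <= e ^+ 24.
  by apply: le_trans TA _; rewrite -(@ler_pXn2r _ 24) // nnegrE // ltW.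
have low1 : c1 <= \prod_(p <- iota 1 Y | prime p && (p <= P1)%N) H21 j p.
  apply: (@le_trans _ _ (\prod_(p <- iota 1 Y | prime p && (p <= P1)%N) q)); last first.
    by apply: ler_prod => p /andP[pp _]; rewrite (ltW q0) hq.
  rewrite big_const_seq -Monoid.iteropE /c1.
  have -> (x : R) n : iterop n *%R x 1 = x ^+ n by case: n.
  apply: ler_wiXn2l; rewrite ?(ltW q0) //.
  rewrite -size_filter -[leqRHS](size_iota 1); apply: uniq_leq_size.
    by rewrite filter_uniq ?iota_uniq.
  by move=> x; rewrite mem_filter !mem_iota => /andP[/andP[pp h] /andP[x1 _]]; rewrite x1 add1n ltnS.
have low2 : A ^+ 24 * 2^-1 <= \prod_(p <- iota 1 Y | prime p && ~~ (p <= P1)%N) H21 j p.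
  rewrite (bigID (fun p => p %% 21 == 1)%N) /=; apply: ler_pM; rewrite ?exprn_ge0 ?invr_ge0 //.
    rewrite -prodrXl le_eqVlt; apply/orP; left; apply/eqP.
    apply: eq_big => p; last by move=> /and3P[pp p1 _]; rewrite H21_one.
    by rewrite -ltnNge -andbA [X in _ && X]andbC.
  apply: (@le_trans _ _ (\prod_(p <- iota 1 Y | prime p && ~~ (p <= P1)%N && (p %% 21 != 1)%N) (1 - K * p%:R ^- 2))); last first.
    apply: ler_prod => p /andP[/andP[pp Pp] p1]; rewrite -ltnNge in Pp.
    have p0 : 0 < p%:R :> R by rewrite ltr0n prime_gt0.
    have p21 : coprime p 21.
      rewrite (coprimeMr p 3 7) ![coprime p _]coprime_sym !prime_coprime //.
      by rewrite !dvdn_prime2 //; apply/andP; split; apply/eqP => h; move: P121; rewrite leqNgt (ltn_trans Pp) // -h.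
    apply/andP; split.
      rewrite subr_ge0 ler_pdivrMr ?exprn_gt0 // mul1r.
      have : P1%:R + 1 <= p%:R :> R by rewrite natr1 ler_nat.
      have : 1 <= p%:R :> R by rewrite ler1n prime_gt0.
      rewrite expr2 => h1 h2; nra.
    rewrite H21_coprime //.
    have sz : size (exps21 p) = 12%N by [].
    have w01' : 0 <= wt R j p <= 1 by rewrite wt_ge0 wt_le1.
    have := hK _ _ sz w01'; rewrite exps21_sum // (negbTE p1) mul0r subr0 ler_norml => /andP[h _].
    have : wt R j p ^+ 2 <= p%:R ^- 2.
      by rewrite -exprVn; apply: lerXn2r; rewrite ?nnegrE ?wt_ge0 ?invr_ge0 ?ler0n ?wt_le_inv.
    by move=> /(ler_wpM2l K0); lra.
  apply: le_trans (prod_one_sub_ge _ _); last first.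
    move=> p /andP[/andP[pp Pp] _]; rewrite -ltnNge in Pp.
    have p0 : 0 < p%:R :> R by rewrite ltr0n prime_gt0.
    rewrite mulr_ge0 ?invr_ge0 ?exprn_ge0 ?ler0n //= ler_pdivrMr ?exprn_gt0 // mul1r.
    have : P1%:R + 1 <= p%:R :> R by rewrite natr1 ler_nat.
    have : 1 <= p%:R :> R by rewrite ler1n prime_gt0.
    by rewrite expr2 => h1 h2; nra.
  rewrite -mulr_sumr.
  have hs : \sum_(p <- iota 1 Y | prime p && ~~ (p <= P1)%N && (p %% 21 != 1)%N) p%:R ^- 2 <= P1%:R^-1 :> R.
    apply: le_trans (sum_inv_sqr Y.+1 P10).
    have n0 (n : nat) : 0 <= n%:R ^- 2 :> R by rewrite invr_ge0 exprn_ge0 ?ler0n.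
    apply: (@le_trans _ _ (\sum_(p <- iota 1 Y | (P1 < p)%N) p%:R ^- 2)).
      rewrite big_mkcond [leRHS]big_mkcond; apply: ler_sum => p _.
      by rewrite -ltnNge; case: (prime p); case: (P1 < p)%N; case: (_ != 1)%N; rewrite /= ?n0.
    by rewrite -big_filter (perm_big _ (perm_filter_iota P1 Y)).
  have P1r : 0 < P1%:R :> R by rewrite ltr0n.
  have : K / P1%:R <= 2^-1 by rewrite ler_pdivrMr //; lra.
  have := ler_wpM2l K0 hs; lra.
have low : c1 * (A ^+ 24 * 2^-1) <= \prod_(p <- iota 1 Y | prime p) H21 j p.
  rewrite (bigID (fun p => p <= P1)%N) /=; apply: ler_pM => //; first exact: ltW.
  by rewrite mulr_ge0 ?exprn_ge0 ?invr_ge0.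
have h := le_trans low up.
have hz : Z * (c1 / 2 * e ^+ 24) >= c2.
  have -> : Z * (c1 / 2 * e ^+ 24) = c1 / 2 * e ^+ 24 + c2.
    by rewrite /Z mulrDl mul1r divfK // gt_eqF // mulr_gt0 // divr_gt0.
  by rewrite lerDr ltW // mulr_gt0 // divr_gt0.
have h2 : c2 / Z ^+ 2 <= c1 / 2 * e ^+ 24.
  rewrite ler_pdivrMr ?exprn_gt0 //; apply: le_trans hz _.
  rewrite mulrC ler_wpM2l //; first by rewrite ltW // mulr_gt0 // divr_gt0.
  by rewrite expr2; nra.
have : c1 / 2 * A ^+ 24 <= c1 / 2 * e ^+ 24.
  by apply: le_trans h2; apply: le_trans h; lra.
by rewrite ler_pM2l // divr_gt0.
Qed.

End PrimesMod21.

(** * Eisenstein integers *)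

(* Eis a b stands for a + b w, where w is a primitive cube root of unity *)
Record eis := Eis { ea : int; eb : int }.

Definition eis_pair (x : eis) := (ea x, eb x).
Definition pair_eis (p : int * int) := Eis p.1 p.2.
Lemma eis_pairK : cancel eis_pair pair_eis. Proof. by case. Qed.
HB.instance Definition _ := Choice.copy eis (can_type eis_pairK).

Definition addE (x y : eis) := Eis (ea x + ea y) (eb x + eb y).
Definition oppE (x : eis) := Eis (- ea x) (- eb x).
Definition mulE (x y : eis) :=
  Eis (ea x * ea y - eb x * eb y) (ea x * eb y + eb x * ea y - eb x * eb y).

Lemma addEA : associative addE.
Proof. by move=> [a b] [c d] [e f]; congr Eis => /=; ring. Qed.
Lemma addEC : commutative addE.
Proof. by move=> [a b] [c d]; congr Eis => /=; ring. Qed.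
Lemma add0E : left_id (Eis 0 0) addE.
Proof. by move=> [a b]; congr Eis => /=; ring. Qed.
Lemma addNE : left_inverse (Eis 0 0) oppE addE.
Proof. by move=> [a b]; congr Eis => /=; ring. Qed.
HB.instance Definition _ := GRing.isZmodule.Build eis addEA addEC add0E addNE.

Lemma mulEA : associative mulE.
Proof. by move=> [a b] [c d] [e f]; congr Eis => /=; ring. Qed.
Lemma mulEC : commutative mulE.
Proof. by move=> [a b] [c d]; congr Eis => /=; ring. Qed.
Lemma mul1E : left_id (Eis 1 0) mulE.
Proof. by move=> [a b]; congr Eis => /=; ring. Qed.
Lemma mulEDl : left_distributive mulE addE.
Proof. by move=> [a b] [c d] [e f]; congr Eis => /=; ring. Qed.
Lemma oneE_neq0 : Eis 1 0 != 0. Proof. by []. Qed.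
HB.instance Definition _ :=
  GRing.Zmodule_isComNzRing.Build eis mulEA mulEC mul1E mulEDl oneE_neq0.

Section EisensteinIntegers.
Implicit Types x y z d : eis.

Lemma mulEE x y : x * y =
  Eis (ea x * ea y - eb x * eb y) (ea x * eb y + eb x * ea y - eb x * eb y).
Proof. by []. Qed.
Lemma addEE x y : x + y = Eis (ea x + ea y) (eb x + eb y). Proof. by []. Qed.
Lemma oppEE x : - x = Eis (- ea x) (- eb x). Proof. by []. Qed.
Lemma eisP x y : ea x = ea y -> eb x = eb y -> x = y.
Proof. by case: x y => a b [c d] /= -> ->. Qed.
Lemma natEE n : n%:R = Eis n%:Z 0.
Proof.
elim: n => [//|n IH]; rewrite -natr1 IH addEE /=.
by apply: eisP; rewrite /= ?addr0 // -addn1 PoszD.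
Qed.

Definition normE x : int := ea x ^+ 2 - ea x * eb x + eb x ^+ 2.
Definition nmE x : nat := `|normE x|%N.
Definition conjE x := Eis (ea x - eb x) (- eb x).
Definition omega := Eis 0 1.

Lemma normE_ge0 x : 0 <= normE x.
Proof. by case: x => a b; rewrite /normE /=; nia. Qed.

Lemma nmEE x : (nmE x)%:Z = normE x.
Proof. by rewrite /nmE gez0_abs // normE_ge0. Qed.

Lemma normEM x y : normE (x * y) = normE x * normE y.
Proof. by case: x y => a b [c d]; rewrite mulEE /normE /=; ring. Qed.

Lemma nmEM x y : nmE (x * y) = (nmE x * nmE y)%N.
Proof. by rewrite /nmE normEM abszM. Qed.

Lemma nmE_eq0 x : (nmE x == 0%N) = (x == 0).
Proof.
apply/eqP/eqP => [h|->//]; have {}h : normE x = 0 by rewrite -nmEE h.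
case: x h => a b; rewrite /normE /= => h.
have hb : b = 0 by nia.
have ha : a = 0 by subst b; nia.
by rewrite ha hb.
Qed.

Lemma nmE_gt0 x : (0 < nmE x)%N = (x != 0).
Proof. by rewrite lt0n nmE_eq0. Qed.

Lemma nmE1 : nmE 1 = 1%N. Proof. by []. Qed.

Lemma mulE_eq0 (x y : eis) : x * y = 0 -> x = 0 \/ y = 0.
Proof.
move/eqP; rewrite -nmE_eq0 nmEM muln_eq0 !nmE_eq0.
by case/orP => /eqP; [left | right].
Qed.

Lemma mulEI (x y z : eis) : x != 0 -> x * y = x * z -> y = z.
Proof.
move=> x0 /eqP; rewrite -subr_eq0 -mulrBr => /eqP/mulE_eq0[xz|/eqP].
  by rewrite xz eqxx in x0.
by rewrite subr_eq0 => /eqP.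
Qed.

Lemma conjEM x y : conjE (x * y) = conjE x * conjE y.
Proof. by case: x y => a b [c d]; rewrite !mulEE /conjE /=; congr Eis; ring. Qed.

Lemma conjEK x : conjE (conjE x) = x.
Proof. by case: x => a b; rewrite /conjE /=; congr Eis; ring. Qed.

Lemma nmE_conj x : nmE (conjE x) = nmE x.
Proof. by rewrite /nmE; congr absz; case: x => a b; rewrite /normE /conjE /=; ring. Qed.

Lemma mulE_conj x : x * conjE x = Eis (normE x) 0.
Proof. by case: x => a b; rewrite mulEE /normE /conjE /=; congr Eis; ring. Qed.

(** Four times the norm is [(2 * b - a) ^ 2 + 3 * a ^ 2]. *)
Lemma nmE_bound_a x : (`|ea x| ^ 2 <= 4 * nmE x)%N.
Proof. by rewrite -lez_nat PoszM nmEE; case: x => a b; rewrite /normE /=; nia. Qed.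

Lemma nmE_bound_b x : (`|eb x| ^ 2 <= 4 * nmE x)%N.
Proof. by rewrite -lez_nat PoszM nmEE; case: x => a b; rewrite /normE /=; nia. Qed.

(* divisibility, decided by multiplying with the conjugate (for nonzero divisors) *)
Definition dvdE d x := (normE d %| ea (x * conjE d))%Z && (normE d %| eb (x * conjE d))%Z.

Lemma dvdEP d x : d != 0 -> reflect (exists y, x = d * y) (dvdE d x).
Proof.
move=> d0; have n0 : normE d != 0 by rewrite -nmEE eqz_nat nmE_eq0.
apply: (iffP andP) => [[/dvdzP[s hs] /dvdzP[t ht]]|[y ->]].
  exists (Eis s t); apply: (@mulEI (conjE d)).
    by rewrite -nmE_eq0 nmE_conj nmE_eq0.
  rewrite mulrC [RHS]mulrA [conjE d * d]mulrC mulE_conj [RHS]mulEE.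
  by apply: eisP; rewrite ?hs ?ht /=; ring.
rewrite mulrAC mulE_conj mulEE /= !mul0r subr0 addr0 subr0.
by rewrite !dvdz_mulr.
Qed.

Lemma dvdE_mulr d x : d != 0 -> dvdE d (d * x).
Proof. by move=> d0; apply/dvdEP => //; exists x. Qed.

Lemma nearest_int (A N : int) : 0 < N -> exists m : int, `|2 * (A - m * N)| <= N.
Proof.
move=> N0; exists ((2 * A + N) %/ (2 * N))%Z.
have := divz_eq (2 * A + N) (2 * N); have := ltz_pmod (2 * A + N) (_ : 0 < 2 * N).
have := modz_ge0 (2 * A + N) (_ : 2 * N != 0).
set q := (_ %/ _)%Z; set r := (_ %% _)%Z => h1 h2 h3.
have {}h1 : 0 <= r by apply: h1; lia.
have {}h2 : r < 2 * N by apply: h2; lia.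
by rewrite ler_norml; apply/andP; split; nia.
Qed.

(** Both coordinates of [x / d] are rounded to nearest integers; the error has coordinates at most
    1/2 in absolute value, hence norm at most 3/4. *)
Lemma euclid_div x d : d != 0 -> exists q : eis, (nmE (x - q * d)%R < nmE d)%N.
Proof.
move=> d0; have n0 : 0 < normE d by rewrite -nmEE ltz_nat nmE_gt0.
have [m hm] := nearest_int (ea (x * conjE d)) n0.
have [n hn] := nearest_int (eb (x * conjE d)) n0.
exists (Eis m n); set r := x - _.
have hr : r * conjE d = Eis (ea (x * conjE d) - m * normE d) (eb (x * conjE d) - n * normE d).
  rewrite /r mulrBl -mulrA mulE_conj [Eis m n * _]mulEE /= [LHS]addEE /=.
  by congr Eis; ring.
have h : normE r * normE d < normE d * normE d.
  have -> : normE r * normE d = normE (r * conjE d).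
    by rewrite normEM -(nmEE (conjE d)) nmE_conj nmEE.
  rewrite hr /normE /= -/(normE d).
  move: hm hn; move: (_ - m * _) (_ - n * _) => s t.
  rewrite !ler_norml => /andP[s1 s2] /andP[t1 t2].
  move: n0 s1 s2 t1 t2; move: (normE d) => N N0 s1 s2 t1 t2.
  nia.
by rewrite -ltz_nat !nmEE; rewrite ltr_pM2r in h.
Qed.

Lemma bezout x y : x != 0 -> exists g u v,
  [/\ g = u * x + v * y, g != 0, (exists s, x = g * s) & (exists t, y = g * t)].
Proof.
elim: {x}(nmE x).+1 {-2}x y (ltnSn (nmE x)) => // n IH x y xn x0.
have [q hq] := euclid_div y x0.
have [r0|r0] := eqVneq (y - q * x) 0.
  exists x, 1, 0; rewrite mul1r mul0r addr0; split=> //; first by exists 1; rewrite mulr1.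
  by exists q; rewrite mulrC; apply/eqP; rewrite -subr_eq0 r0.
have [|g [u [v [gE g0 [s sE] [t tE]]]]] := IH (y - q * x) x _ r0.
  by apply: leq_trans hq _; rewrite -ltnS.
exists g, (v - u * q), u; split=> //; first by rewrite gE; ring.
  by exists t.
exists (s + q * t); rewrite mulrDr -sE [in RHS]mulrCA -tE; ring.
Qed.

(** Congruence to 1 modulo 3. It selects one of the six associates of each element prime to 3, and
    the selection is compatible with products. *)
Definition primary x := (3 %| ea x - 1)%Z && (3 %| eb x)%Z.

Lemma primaryM x y : primary x -> primary y -> primary (x * y).
Proof.
case: x y => a b [c d] /andP[/= /dvdzP[k hk] /dvdzP[l hl]] /andP[/= /dvdzP[k' hk'] /dvdzP[l' hl']].
rewrite /primary mulEE /=; apply/andP; split; apply/dvdzP.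
  have -> : a = k * 3 + 1 by lia.
  have -> : c = k' * 3 + 1 by lia.
  by exists (k * (k' * 3 + 1) + k' - l * d); rewrite hl; ring.
by exists (a * l' + l * c - l * d); rewrite hl hl'; ring.
Qed.

Lemma primary_cofactor x y : primary x -> primary (x * y) -> primary y.
Proof.
case: x y => a b [c d] /andP[/= /dvdzP[k hk] /dvdzP[l hl]].
rewrite /primary mulEE /= => /andP[/= /dvdzP[k' hk'] /dvdzP[l' hl']].
have ha : a = k * 3 + 1 by lia.
have hd : d = (l' - k * d - l * c + l * d) * 3.
  have : a * d + b * c - b * d = l' * 3 by [].
  by rewrite ha hl => h; rewrite mulrDl !mulrBl -h; ring.
have hc : c - 1 = (k' - k * c + l * d) * 3.
  have : a * c - b * d - 1 = k' * 3 by [].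
  by rewrite ha hl => h; rewrite mulrDl mulrBl -h; ring.
by apply/andP; split; apply/dvdzP; [exists (k' - k * c + l * d) | exists (l' - k * d - l * c + l * d)].
Qed.

Lemma primary_norm x : primary x -> (3 %| normE x - 1)%Z.
Proof.
case: x => a b /andP[/= /dvdzP[k hk] /dvdzP[l hl]]; apply/dvdzP.
exists (3 * k ^+ 2 + 2 * k - (k * 3 + 1) * l + 3 * l ^+ 2).
have ha : a = k * 3 + 1 by lia.
by rewrite /normE /= ha hl; ring.
Qed.

Lemma primary_neq0 x : primary x -> x != 0.
Proof. by move=> /primary_norm h; apply: contraTneq h => ->. Qed.

Lemma primary_nm x : primary x -> nmE x = 1 %[mod 3].
Proof. by move=> /primary_norm; rewrite -nmEE => /dvdzP[k hk]; lia. Qed.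

Lemma nmE_eq1 x : nmE x = 1%N ->
  x \in [:: 1; -1; omega; - omega; 1 + omega; - 1 - omega].
Proof.
move=> h; have ba := nmE_bound_a x; have bb := nmE_bound_b x.
have hn := nmEE x; rewrite h in ba bb hn.
case: x h ba bb hn => a b _ /= ba bb; rewrite /normE /=.
have {ba} ha : (`|a| <= 2)%N by rewrite -(@leq_exp2r _ _ 2).
have {bb} hb : (`|b| <= 2)%N by rewrite -(@leq_exp2r _ _ 2).
have : a \in [:: -2; -1; 0; 1; 2] by rewrite !inE; lia.
have : b \in [:: -2; -1; 0; 1; 2] by rewrite !inE; lia.
by rewrite !inE; do 4?[case/orP]; move=> /eqP-> ; do 4?[case/orP]; move=> /eqP->.
Qed.

Lemma primary_nm1 x : primary x -> nmE x = 1%N -> x = 1.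
Proof.
move=> px /nmE_eq1; rewrite !inE.
by do 5?[case/orP]; move=> /eqP xE; move: px; rewrite xE.
Qed.

Lemma primary_mod x k l : ea x = k * 3 + 1 -> eb x = l * 3 -> primary x.
Proof.
by move=> ha hb; apply/andP; split; apply/dvdzP; [exists k; rewrite ha addrK | exists l].
Qed.

(** Of the nine classes modulo 3, three have norm divisible by 3, and the six units represent the
    other six. *)
Lemma primary_assoc x : ~~ (3 %| nmE x)%N ->
  exists2 u, nmE u = 1%N & primary (u * x).
Proof.
move=> h; have : ~~ (3 %| normE x)%Z by rewrite -nmEE.
case: x {h} => a b.
have ha := divz_eq a 3; have hb := divz_eq b 3.
have : (a %% 3)%Z \in [:: 0; 1; 2].
  by rewrite !inE; lia.
have : (b %% 3)%Z \in [:: 0; 1; 2].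
  by rewrite !inE; lia.
move: (a %/ 3)%Z (b %/ 3)%Z (a %% 3)%Z (b %% 3)%Z ha hb => k l r s -> ->.
have bad (z : int) : normE (Eis (k * 3 + r) (l * 3 + s)) = z * 3 ->
    ~~ (3 %| normE (Eis (k * 3 + r) (l * 3 + s)))%Z -> exists2 u, nmE u = 1%N & primary (u * Eis (k * 3 + r) (l * 3 + s)).
  by move=> ->; rewrite dvdz_mull.
rewrite !inE; do 2?[case/orP]; move=> /eqP hs; do 2?[case/orP]; move=> /eqP hr; subst r s.
- by apply: (bad (3 * k ^+ 2 - 3 * k * l + 3 * l ^+ 2)); rewrite /normE /=; ring.
- by move=> _; exists 1 => //; apply: (@primary_mod _ k l); rewrite mulEE /=; ring.
- by move=> _; exists (-1) => //; apply: (@primary_mod _ (-k-1) (-l)); rewrite mulEE /=; ring.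
- move=> _; exists (- 1 - omega) => //.
  by apply: (@primary_mod _ (l - k) (- k)); rewrite mulEE /=; ring.
- move=> _; exists (- omega) => //.
  by apply: (@primary_mod _ l (l - k)); rewrite mulEE /=; ring.
- by apply: (bad (3 * k ^+ 2 + 4 * k - 3 * k * l - 2 * l - k + 3 * l ^+ 2 + 2 * l + 1)); rewrite /normE /=; ring.
- move=> _; exists (1 + omega) => //.
  by apply: (@primary_mod _ (k - l - 1) k); rewrite mulEE /=; ring.
- by apply: (bad (3 * k ^+ 2 + 2 * k - 3 * k * l - 2 * k - l + 3 * l ^+ 2 + 4 * l + 1)); rewrite /normE /=; ring.
- move=> _; exists omega => //.
  by apply: (@primary_mod _ (- l - 1) (k - l)); rewrite mulEE /=; ring.
Qed.

End EisensteinIntegers.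

(** * Primary primes of Z[w] and factorization of primary elements *)

Section EisensteinPrimes.
Implicit Types x y z d : eis.

(** Half-open, so that a box whose half side is a multiple of 84 is tiled exactly by translates of
    one cell. *)
Definition range_int (L : nat) : seq int := [seq i%:Z - L%:Z | i <- iota 0 (2 * L)].

Lemma mem_range_int L (a : int) : (a \in range_int L) = (- L%:Z <= a < L%:Z).
Proof.
apply/mapP/idP => [[k]|h]; first by rewrite mem_iota => h ->; lia.
by exists (absz (a + L%:Z)); rewrite ?mem_iota; lia.
Qed.

Lemma range_int_uniq L : uniq (range_int L).
Proof. by rewrite map_inj_uniq ?iota_uniq // => i j; lia. Qed.

Definition boxE (L : nat) : seq eis := [seq Eis a b | a <- range_int L, b <- range_int L].

Lemma mem_boxE L x : (x \in boxE L) = (- L%:Z <= ea x < L%:Z) && (- L%:Z <= eb x < L%:Z).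
Proof.
rewrite -!mem_range_int; apply/allpairsP/andP => [[[a b] [/= ha hb ->]]//|[ha hb]].
by exists (ea x, eb x); split=> //; case: x {ha hb}.
Qed.

Lemma boxE_uniq L : uniq (boxE L).
Proof.
by apply: allpairs_uniq; rewrite ?range_int_uniq // => -[a b] [c d] _ _ [-> ->].
Qed.

Definition ballE (M : nat) : seq eis := [seq x <- boxE (M + 2) | primary x && (nmE x <= M)%N].

(** A coordinate has square at most [4 * M], which is less than [(M + 2) ^ 2]. *)
Lemma nmE_le_box x M : (nmE x <= M)%N -> x \in boxE (M + 2).
Proof.
move=> h; have ha := nmE_bound_a x; have hb := nmE_bound_b x.
have sq (n : nat) : (n ^ 2 <= 4 * nmE x)%N -> (n < M + 2)%N.
  by move=> hn; rewrite ltnNge; apply/negP => hM; move: hn hM h; rewrite -mulnn; nia.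
by rewrite mem_boxE; have := sq _ ha; have := sq _ hb; lia.
Qed.

Lemma mem_ballE M x : (x \in ballE M) = primary x && (nmE x <= M)%N.
Proof.
rewrite mem_filter; apply: andb_idr => /andP[_ h]; exact: nmE_le_box.
Qed.

Lemma ballE_uniq M : uniq (ballE M).
Proof. by rewrite filter_uniq // boxE_uniq. Qed.

(* a prime is irreducible among the primary elements, which represent the associates
   of the elements prime to 3 *)
Definition prE d : bool := [&& primary d, (1 < nmE d)%N &
  all (fun x => dvdE x d ==> (x == 1) || (x == d)) (ballE (nmE d))].

Lemma prE_primary d : prE d -> primary d. Proof. by case/and3P. Qed.
Lemma prE_gt1 d : prE d -> (1 < nmE d)%N. Proof. by case/and3P. Qed.
Lemma prE_neq0 d : prE d -> d != 0. Proof. by move/prE_primary/primary_neq0. Qed.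

Lemma dvdE_leq d x : d != 0 -> x != 0 -> dvdE d x -> (nmE d <= nmE x)%N.
Proof.
move=> d0 x0 /(dvdEP _ d0)[y xE]; rewrite xE nmEM leq_pmulr // nmE_gt0.
by apply: contraNneq x0 => y0; rewrite xE y0 mulr0.
Qed.

Lemma prE_div d x : prE d -> primary x -> dvdE x d -> x = 1 \/ x = d.
Proof.
move=> /and3P[pd d1 /allP h] px xd; have x0 := primary_neq0 px; have d0 := primary_neq0 pd.
have /h : x \in ballE (nmE d) by rewrite mem_ballE px dvdE_leq.
by rewrite xd /= => /orP[]/eqP; [left|right].
Qed.

Lemma unit_inv u : nmE u = 1%N -> exists v, v * u = 1.
Proof.
move=> h; exists (conjE u); rewrite mulrC mulE_conj.
by rewrite -nmEE h.
Qed.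

(** A greatest common divisor [g] of [d] and [x] has norm prime to 3, so it has a primary associate,
    which is 1 or [d]. In the first case a Bezout relation multiplied by [y] shows that [d] divides
    [y]; in the second [d] divides [x]. *)
Lemma prE_prime d x y : prE d -> dvdE d (x * y) -> dvdE d x || dvdE d y.
Proof.
move=> prd hxy; have d0 := prE_neq0 prd.
have [g [u [v [gE g0 [s sE] [t tE]]]]] := bezout x d0.
have g3 : ~~ (3 %| nmE g)%N.
  have : nmE d = 1 %[mod 3] by apply: primary_nm; exact: prE_primary.
  rewrite sE nmEM => h; apply/negP => g3.
  by have := dvdn_mulr (nmE s) g3; rewrite /dvdn h.
have [e e1 pe] := primary_assoc g3; have [e' e'e] := unit_inv e1.
have gd : dvdE (e * g) d.
  apply/dvdEP; first exact: primary_neq0.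
  exists (e' * s); rewrite {1}sE -{1}[g]mul1r -e'e; ring.
case: (prE_div prd pe gd) => h.
  have hy : y = e * u * y * d + e * v * (x * y).
    by rewrite -{1}[y]mul1r -h gE; ring.
  apply/orP; right; move: hxy => /(dvdEP _ d0)[z hz].
  by apply/(dvdEP _ d0); exists (e * u * y + e * v * z); rewrite {1}hy hz; ring.
apply/orP; left; apply/(dvdEP _ d0); exists (e' * t).
by rewrite -h {1}tE -{1}[g]mul1r -e'e; ring.
Qed.

Lemma prE_euclid d d' x : prE d -> prE d' -> d != d' -> primary x ->
  dvdE d' (d * x) = dvdE d' x.
Proof.
move=> pd pd' dd' px; have d0 := prE_neq0 pd'; apply/idP/idP => [h|/(dvdEP _ d0)[y ->]].
  case/orP: (prE_prime pd' h) => // h'.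
  case: (prE_div pd (prE_primary pd') h') => hd.
    by have := prE_gt1 pd'; rewrite hd nmE1.
  by rewrite hd eqxx in dd'.
by apply/(dvdEP _ d0); exists (d * y); rewrite mulrCA.
Qed.

Lemma dvdE_primary d x : primary d -> primary x -> dvdE d x -> exists2 y, primary y & x = d * y.
Proof.
move=> pd px /(dvdEP _ (primary_neq0 pd))[y xE]; exists y => //.
by apply: (@primary_cofactor d) => //; rewrite -xE.
Qed.

Lemma prE_exists x : primary x -> (1 < nmE x)%N -> exists2 d, prE d & dvdE d x.
Proof.
elim: {x}(nmE x).+1 {-2}x (ltnSn (nmE x)) => // n IH x xn px x1.
have x0 := primary_neq0 px.
have [prx|nprx] := boolP (prE x).
  by exists x => //; apply/dvdEP => //; exists 1; rewrite mulr1.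
move: nprx; rewrite /prE px x1 /= => /allPn[d].
rewrite mem_ballE => /andP[pd dn]; rewrite negb_imply negb_or => /and3P[dx d1 dnx].
have [y py xE] := dvdE_primary pd px dx.
have d0 := primary_neq0 pd.
have y1 : (1 < nmE y)%N.
  rewrite ltn_neqAle eq_sym nmE_gt0 primary_neq0 // andbT.
  by apply: contraNneq dnx => h; rewrite xE (primary_nm1 py h) mulr1.
have d1' : (1 < nmE d)%N.
  rewrite ltn_neqAle eq_sym nmE_gt0 d0 andbT.
  by apply: contraNneq d1 => h; rewrite (primary_nm1 pd h).
have dlt : (nmE d < n)%N.
  by move: xn; rewrite xE nmEM ltnS; nia.
have [c prc /(dvdEP _ (prE_neq0 prc))[z dz]] := IH d dlt pd d1'.
exists c => //; apply/(dvdEP _ (prE_neq0 prc)); exists (z * y).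
by rewrite xE dz mulrA.
Qed.

End EisensteinPrimes.

(** * Sums over the Eisenstein integers *)

Definition maxE (x : eis) : nat := maxn (absz (ea x)) (absz (eb x)).
Definition shellE (x : eis) : nat := trunc_log 2 (maxE x).

Lemma maxE_gt0 x : x != 0 -> (0 < maxE x)%N.
Proof.
by apply: contraNT; rewrite /maxE => h; apply/eqP/eisP => /=; lia.
Qed.

Lemma shellE_bounds x : x != 0 -> (2 ^ shellE x <= maxE x < 2 ^ (shellE x).+1)%N.
Proof. by move/maxE_gt0 => h; rewrite trunc_logP // trunc_log_ltn. Qed.

Lemma count_shellE (F : seq eis) (k : nat) : uniq F ->
  (count (fun x : eis => (x != 0%R) && (shellE x == k)) F <= 16 * 4 ^ k)%N.
Proof.
move=> uF; rewrite -size_filter.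
have -> : (16 * 4 ^ k = size (boxE (2 ^ k.+1)))%N.
  by rewrite size_allpairs size_map size_iota expnS -[4%N]/(2 ^ 2)%N expnAC -mulnn; lia.
apply: uniq_leq_size; first exact: filter_uniq.
move=> x; rewrite mem_filter => /andP[/andP[x0 /eqP xk] _].
by have := shellE_bounds x0; rewrite xk mem_boxE /maxE; move: (2 ^ k.+1)%N; lia.
Qed.

Section EisSums.
Variable R : archiRcfType.

(** The norm is at least a quarter of [maxE x ^ 2]; the quarter accounts for the denominator. *)
Lemma wt_shell j (x : eis) : x != 0 ->
  wt R j (nmE x) <= (wt R j 2 ^+ 2) ^+ shellE x / wt R j 2 ^+ 2.
Proof.
move=> x0; have /andP[h _] := shellE_bounds x0.
have w2 : 0 < wt R j 2 ^+ 2 by rewrite exprn_gt0 // wt_gt0.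
rewrite ler_pdivlMr // mulrC -exprM mulnC exprM -!wtX -wtM.
apply: wt_anti; first by rewrite !expn_gt0.
have -> : (2 ^ 2 * nmE x = 4 * nmE x)%N by [].
apply: (@leq_trans (maxE x ^ 2)); first by rewrite leq_exp2r.
by rewrite /maxE /maxn; case: ifP => _; [exact: nmE_bound_b | exact: nmE_bound_a].
Qed.

(** A shell has at most [16 * 4 ^ k] points, of weight at most a constant times
    [wt R j 2 ^ (2 * k)], so the ratio is the square of the one for the integers. *)
Lemma eis_tail j (e : R) : 0 < e -> exists M0, forall F : seq eis,
  uniq F -> (forall x, x \in F -> primary x /\ (M0 < nmE x)%N) ->
  \sum_(x <- F) wt R j (nmE x) <= e.
Proof.
move=> e0; have /andP[q0 q1] := q_bounds R j.
set q := (2 * wt R j 2) ^+ 2.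
have qb : 0 <= q < 1 by rewrite /q exprn_ge0 //= expr_lt1.
have w2 : 0 < wt R j 2 ^+ 2 by rewrite exprn_gt0 // wt_gt0.
pose b := 16 / wt R j 2 ^+ 2.
have b0 : 0 < b by rewrite divr_gt0.
have d0 : 0 < 1 - q by case/andP: qb => _ ?; rewrite subr_gt0.
have [K hK] := expr_small qb (mulr_gt0 (divr_gt0 e0 b0) d0).
(* The norm is at most [3 * maxE x ^ 2], so a norm beyond this bound forces the shell index to be at
   least [K]. *)
exists (3 * (2 ^ K) ^ 2)%N => F uF hF.
have F0 x : x \in F -> x != 0 by move/hF => [/primary_neq0].
apply: (@le_trans _ _ (b * q ^+ K / (1 - q))); last first.
  by rewrite ler_pdivrMr // mulrC -ler_pdivlMr // mulrAC.
apply: (@dyadic_sum _ _ F shellE _ b q K) => //; first exact: ltW.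
- move=> k Kk; rewrite big_seq_cond.
  rewrite (eq_bigl (fun x => (x \in F) && ((x != 0) && (shellE x == k)))); last first.
    by move=> x; case: (boolP (x \in F)) => //= /F0 ->.
  rewrite -big_seq_cond.
  apply: le_trans (@sum_le_size _ _ _ _ _ ((wt R j 2 ^+ 2) ^+ k / wt R j 2 ^+ 2) _ _ _ (count_shellE k uF)) _.
  - by rewrite divr_ge0 ?exprn_ge0 ?ltW // wt_gt0.
  - by move=> x /andP[x0 /eqP <-]; exact: wt_shell.
  rewrite /b /q exprMn exprMn natrM natrX le_eqVlt; apply/orP; left; apply/eqP.
  have E4 : 4 ^+ k = 2 ^+ k * 2 ^+ k :> R by rewrite -exprMn -natrM.
  by rewrite !exprMn E4; ring.
move=> x xF; have [_ h] := hF x xF; have x0 := F0 x xF.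
have /andP[_ h2] := shellE_bounds x0.
rewrite leqNgt; apply/negP => hk.
have h3 : (maxE x < 2 ^ K)%N by apply: leq_trans h2 _; rewrite leq_exp2l.
have h4 : (nmE x <= 3 * maxE x ^ 2)%N.
  rewrite -lez_nat nmEE PoszM; case: x {hF xF h x0 h2 hk h3} => a b'; rewrite /normE /maxE /=.
  by rewrite /maxn; case: ifP; nia.
move: h; rewrite ltnNge (leq_trans h4) // leq_pmul2l // leq_exp2r //; exact: ltnW.
Qed.

End EisSums.

(* 84 = 3 * 28: being primary is a condition modulo 3, and the characters that are used
   are defined modulo 28 *)
Definition cellE : seq eis := [seq Eis r s | r <- map Posz (iota 0 84), s <- map Posz (iota 0 84)].

Definition shiftE (c x : eis) : eis := Eis (84 * ea c + ea x) (84 * eb c + eb x).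

Arguments shiftE : simpl never.

Lemma mem_cellE x : (x \in cellE) = (0 <= ea x < 84) && (0 <= eb x < 84).
Proof.
have h (a : int) : (a \in map Posz (iota 0 84)) = (0 <= a < 84).
  apply/mapP/idP => [[k]|ha]; first by rewrite mem_iota => hi ->; lia.
  by exists (absz a); rewrite ?mem_iota; lia.
rewrite -!h; apply/allpairsP/andP => [[[a b] [/= ha hb ->]] //|[ha hb]].
by exists (ea x, eb x); split=> //; case: x {ha hb}.
Qed.

Lemma cellE_uniq : uniq cellE.
Proof.
apply: allpairs_uniq; rewrite ?map_inj_uniq ?iota_uniq //; try by move=> i j [].
by move=> [a b] [c d] _ _ [-> ->].
Qed.

Lemma shiftE_inj c x c' x' : x \in cellE -> x' \in cellE ->
  shiftE c x = shiftE c' x' -> c = c' /\ x = x'.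
Proof.
rewrite !mem_cellE => hx hx' h; have ha := congr1 ea h; have hb := congr1 eb h.
move: ha hb hx hx'; clear h; rewrite /shiftE.
case: c x c' x' => a b [r s] [a' b'] [r' s'].
rewrite [ea _]/(84 * a + r) [ea (Eis (_ * ea (Eis a' _) + _) _)]/(84 * a' + r').
rewrite [eb _]/(84 * b + s) [eb (Eis _ (_ * eb (Eis _ b') + _))]/(84 * b' + s') /=.
move=> ha hb /andP[hr hs] /andP[hr' hs'].
have ea' : a = a' by lia.
have eb' : b = b' by lia.
by subst a' b'; split=> //; congr Eis; lia.
Qed.

Lemma boxE_cells L :
  perm_eq (boxE (84 * L)) [seq shiftE c x | c <- boxE L, x <- cellE].
Proof.
apply: uniq_perm; first exact: boxE_uniq.
  apply: allpairs_uniq; rewrite ?boxE_uniq ?cellE_uniq //.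
  move=> [c r] [c' r'] h h' e.
  have hr : r \in cellE by case/allpairsP: h => [[? y] [_ hy [_ ->]]]; exact: hy.
  have hr' : r' \in cellE by case/allpairsP: h' => [[? y] [_ hy [_ ->]]]; exact: hy.
  by have [-> ->] := shiftE_inj hr hr' e.
move=> x; rewrite mem_boxE; apply/idP/allpairsP => [h|[[c r] [/=]]]; last first.
  by rewrite mem_boxE mem_cellE => hc hr ->; rewrite /shiftE /=; lia.
exists (Eis (ea x %/ 84)%Z (eb x %/ 84)%Z, Eis (ea x %% 84)%Z (eb x %% 84)%Z).
rewrite /= mem_boxE mem_cellE /=; split; [lia | lia |].
by apply: eisP => /=; lia.
Qed.

(* the norm varies by O(m) over a cell at distance m from the origin *)
Lemma norm_cell_diff (a b r s m : int) :
  2 <= m -> `|a| <= m -> `|b| <= m -> (`|a| = m \/ `|b| = m) -> 0 <= r < 84 -> 0 <= s < 84 ->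
  let X := normE (Eis (84 * a + r) (84 * b + s)) in let Y := normE (Eis (84 * a) (84 * b)) in
  [/\ 0 < X, 0 < Y & 2 * `|X - Y| * m ^+ 3 <= X * Y].
Proof.
move=> m2 am bm abm hr hs X Y.
have qa (u v : int) : u ^+ 2 <= 4 * (u ^+ 2 - u * v + v ^+ 2).
  rewrite -subr_ge0 (_ : _ - _ = (2 * v - u) ^+ 2 + 2 * u ^+ 2); last by ring.
  by rewrite addr_ge0 ?sqr_ge0 // mulr_ge0 ?sqr_ge0.
have qb (u v : int) : v ^+ 2 <= 4 * (u ^+ 2 - u * v + v ^+ 2).
  rewrite -subr_ge0 (_ : _ - _ = (2 * u - v) ^+ 2 + 2 * v ^+ 2); last by ring.
  by rewrite addr_ge0 ?sqr_ge0 // mulr_ge0 ?sqr_ge0.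
have hY : 84 ^+ 2 * m ^+ 2 <= 4 * Y.
  have -> : 4 * Y = 84 ^+ 2 * (4 * (a ^+ 2 - a * b + b ^+ 2)) by rewrite /Y /normE /=; ring.
  rewrite ler_pM2l ?exprn_gt0 //; have [<-|<-] := abm; rewrite real_normK ?num_real //.
have hX : 84 ^+ 2 * (m - 1) ^+ 2 <= 4 * X.
  have sq (u : int) : 84 * (m - 1) <= `|u| -> 84 ^+ 2 * (m - 1) ^+ 2 <= u ^+ 2.
    by move=> hu; rewrite -[u ^+ 2]real_normK ?num_real //; nia.
  have [h|h] := abm.
    have h1 : 84 * (m - 1) <= `|84 * a + r| by lia.
    exact: le_trans (sq _ h1) (qa _ _).
  have h1 : 84 * (m - 1) <= `|84 * b + s| by lia.
  exact: le_trans (sq _ h1) (qb _ _).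
have hD : `|X - Y| <= 84 ^+ 2 * (9 * m).
  have -> : X - Y = 84 * (a * (2 * r - s) + b * (2 * s - r)) + (r ^+ 2 - r * s + s ^+ 2).
    by rewrite /X /Y /normE /=; ring.
  have h1 : `|a * (2 * r - s)| <= m * 168 by rewrite normrM; apply: ler_pM => //; lia.
  have h2 : `|b * (2 * s - r)| <= m * 168 by rewrite normrM; apply: ler_pM => //; lia.
  have h3 : `|r ^+ 2 - r * s + s ^+ 2| <= 84 ^+ 2 * 2.
    have r2 : r ^+ 2 <= 84 ^+ 2 by nia.
    have s2 : s ^+ 2 <= 84 ^+ 2 by nia.
    have rs : 0 <= r * s by apply: mulr_ge0; lia.
    have := qa r s; have := sqr_ge0 r; rewrite ler_norml => h3 h4; lia.
  lia.
have m0 : 0 < m by lia.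
(* 1152 is [18 * 64]: 18 comes from the bound for [2 * |X - Y|], and 64 is 16 from the two quarters
   in [hX] and [hY] times 4 from replacing [m - 1] by [m / 2]. *)
have c1 : 1152 <= 84 ^+ 2 :> int by [].
move: (84 ^+ 2) c1 hY hX hD => c c1 hY hX hD.
have V0 : 0 < m ^+ 2 by rewrite exprn_gt0.
have U0 : 0 < (m - 1) ^+ 2 by rewrite exprn_gt0 //; lia.
have c0 : 0 < c by lia.
have X0 : 0 < X by rewrite -(pmulr_rgt0 _ (_ : 0 < 4)) //; apply: lt_le_trans hX; rewrite mulr_gt0.
have Y0 : 0 < Y by rewrite -(pmulr_rgt0 _ (_ : 0 < 4)) //; apply: lt_le_trans hY; rewrite mulr_gt0.
split=> //.
have hm4 : m ^+ 2 * m ^+ 2 <= 4 * ((m - 1) ^+ 2 * m ^+ 2).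
  rewrite mulrA ler_pM2r // (_ : 4 * _ = (2 * (m - 1)) ^+ 2); last by ring.
  by apply: lerXn2r; rewrite ?nnegrE; lia.
have h16 : c * (m - 1) ^+ 2 * (c * m ^+ 2) <= 4 * X * (4 * Y).
  by apply: ler_pM => //; rewrite mulr_ge0 // ltW.
have h5 : 2 * `|X - Y| * m ^+ 3 <= 2 * (c * (9 * m)) * m ^+ 3.
  by rewrite ler_pM2r ?exprn_gt0 // ler_pM2l.
apply: le_trans h5 _.
have -> : 2 * (c * (9 * m)) * m ^+ 3 = 18 * (c * (m ^+ 2 * m ^+ 2)) by ring.
have {}h16 : c * (c * ((m - 1) ^+ 2 * m ^+ 2)) <= 16 * (X * Y).
  by apply: le_trans (_ : _ <= 4 * X * (4 * Y)) _; [apply: le_trans h16; rewrite le_eqVlt; apply/orP; left; apply/eqP; ring | rewrite le_eqVlt; apply/orP; left; apply/eqP; ring].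
have h6 : c * (c * (m ^+ 2 * m ^+ 2)) <= c * (c * (4 * ((m - 1) ^+ 2 * m ^+ 2))).
  by rewrite !ler_pM2l.
have h7 : 1152 * (c * (m ^+ 2 * m ^+ 2)) <= c * (c * (m ^+ 2 * m ^+ 2)).
  by rewrite ler_pM2r // !mulr_gt0.
have h8 : c * (c * (4 * ((m - 1) ^+ 2 * m ^+ 2))) = 4 * (c * (c * ((m - 1) ^+ 2 * m ^+ 2))) by ring.
rewrite h8 in h6.
move: (c * (m ^+ 2 * m ^+ 2)) (c * (c * ((m - 1) ^+ 2 * m ^+ 2))) (c * (c * _)) (X * Y) h16 h6 h7 => p q t u h16 h6 h7.
lia.
Qed.

(** * Uniform bounds for character sums over boxes *)

Section BoxBound.
Variable R : archiRcfType.

Lemma wt_dist j m n : (0 < m)%N -> (0 < n)%N ->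
  `|wt R j m - wt R j n| <= 2 * `|m%:R - n%:R| / (m%:R * n%:R).
Proof.
move=> m0 n0; wlog mn : m n m0 n0 / (m <= n)%N.
  move=> W; have [mn|/ltnW nm] := leqP m n; first exact: W.
  by rewrite distrC [`|m%:R - _|]distrC [m%:R * _]mulrC; exact: W.
rewrite ger0_norm ?subr_ge0 ?wt_anti // [`|m%:R - _|]distrC.
by rewrite [`|n%:R - _|]ger0_norm ?subr_ge0 ?ler_nat // wt_diff.
Qed.

Lemma wt_cell_diff j (c x : eis) : (2 <= maxE c)%N -> x \in cellE ->
  `|wt R j (nmE (shiftE c x)) - wt R j (nmE (shiftE c 0))| <= (maxE c)%:R ^- 3.
Proof.
move=> m2; rewrite mem_cellE => /andP[hr hs].
have e0 : Eis (84 * ea c) (84 * eb c) = shiftE c 0 by apply: eisP; rewrite /shiftE /= addr0.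
have := @norm_cell_diff (ea c) (eb c) (ea x) (eb x) (maxE c)%:Z.
move=> /(_ ltac:(lia) ltac:(rewrite /maxE; lia) ltac:(rewrite /maxE; lia) ltac:(rewrite /maxE; lia) hr hs).
rewrite e0 -/(shiftE c x) /= -!nmEE.
set X := nmE _; set Y := nmE _; set m := maxE c => -[X0 Y0 h].
have [{}X0 {}Y0] : (0 < X)%N /\ (0 < Y)%N by split.
apply: le_trans (wt_dist _ X0 Y0) _.
have m0 : 0 < m%:R ^+ 3 :> R by rewrite exprn_gt0 // ltr0n ltnW.
rewrite ler_pdivrMr ?mulr_gt0 ?ltr0n // -[leRHS]mulrC ler_pdivlMr //.
have hm : (m%:Z ^+ 3)%:~R = m%:R ^+ 3 :> R by rewrite rmorphXn.
move: h; move: (m%:Z ^+ 3) hm => t hm.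
by rewrite -(ler_int R) !intrM hm intr_norm intrB.
Qed.

(** Since [f] sums to 0 over a cell, each weight may be replaced by its difference from the weight
    at the corner, which is [O(m ^ -3)] at distance [m]. A dyadic shell has [O(4 ^ k)] cells, so its
    contribution is [O(2 ^ - k)], uniformly in [j]; the cell at the origin is bounded trivially. *)
Lemma box_upper (f : eis -> R[i]) : (forall x, normc (f x) <= 1) ->
  (forall c x, f (shiftE c x) = f x) -> \sum_(x <- cellE) f x = 0 ->
  exists2 K : R, 0 <= K & forall j L,
  normc (\sum_(x <- boxE (84 * L)) f x * (wt R j (nmE x))%:C) <= K.
Proof.
move=> f1 fper f0; pose T : R := (size cellE)%:R.
have T0 : 0 <= T by rewrite ler0n.
pose b := 16 * (T * 64); have b0 : 0 <= b by rewrite !mulr_ge0.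
exists (b * 2 + T) => [|j L]; first by rewrite addr_ge0 // mulr_ge0.
pose inner c := \sum_(x <- cellE) f x * (wt R j (nmE (shiftE c x)))%:C.
have -> : \sum_(x <- boxE (84 * L)) f x * (wt R j (nmE x))%:C = \sum_(c <- boxE L) inner c.
  rewrite (perm_big _ (boxE_cells L)) big_allpairs_dep; apply: eq_bigr => c _.
  by apply: eq_bigr => x _; rewrite fper.
have crude c : normc (inner c) <= T.
  apply: le_trans (normc_sum _ _ _) _; rewrite /T -sum1_size natr_sum; apply: ler_sum => x _.
  rewrite normcM normc_real ?wt_ge0 //.
  by rewrite mulr_ile1 ?normc_ge0 ?wt_ge0 ?wt_le1.
have fine c : c != 0 -> normc (inner c) <= T * 64 * (8^-1) ^+ shellE c.
  move=> c0; have /andP[h1 h2] := shellE_bounds c0.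
  have [m2|m1] := leqP 2 (maxE c); last first.
    have -> : shellE c = 0%N by apply/eqP; rewrite -leqn0 -ltnS -(ltn_exp2l _ _ (isT : 1 < 2)%N); exact: leq_ltn_trans h1 m1.
    by rewrite expr0 mulr1; apply: le_trans (crude c) _; rewrite ler_peMr // ler1n.
  have -> : inner c = \sum_(x <- cellE) f x * (wt R j (nmE (shiftE c x)) - wt R j (nmE (shiftE c 0)))%:C.
    under [RHS]eq_bigr do rewrite rmorphB /= mulrBr.
    by rewrite sumrB -mulr_suml f0 mul0r subr0.
  apply: le_trans (normc_sum _ _ _) _.
  apply: (@le_trans _ _ (\sum_(x <- cellE) 8^-1 ^+ shellE c)).
    rewrite big_seq [leRHS]big_seq; apply: ler_sum => x xc.
    rewrite normcM.
    have -> (y : R) : normc y%:C = `|y| by rewrite /normc /= expr0n addr0 sqrtr_sqr.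
    apply: (@le_trans _ _ (1 * (maxE c)%:R ^- 3)).
      by apply: ler_pM; rewrite ?normc_ge0 ?normr_ge0 ?wt_cell_diff.
    rewrite mul1r -!exprVn (_ : 8^-1 = 2^-1 ^+ 3 :> R); last by rewrite exprVn -natrX.
    rewrite -exprM mulnC exprM; apply: lerXn2r; rewrite ?nnegrE ?invr_ge0 ?exprn_ge0 ?ler0n ?invr_ge0 //.
    by rewrite exprVn lef_pV2 ?posrE ?exprn_gt0 ?ltr0n ?maxE_gt0 // -natrX ler_nat.
  have h8 : 0 <= 8^-1 ^+ shellE c :> R by rewrite exprn_ge0 // invr_ge0.
  rewrite big_const_seq count_predT iter_addr_0 -[leLHS]mulr_natl -/T -mulrA ler_wpM2l //.
  by rewrite ler_peMl // ler1n.
rewrite (bigID (fun c => c != 0)) /=; apply: le_trans (le_normcD _ _) _; apply: lerD.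
  apply: le_trans (normc_sum _ _ _) _; rewrite -big_filter.
  apply: (@le_trans _ _ (b * 2^-1 ^+ 0 / (1 - 2^-1))); last by rewrite expr0 mulr1 le_eqVlt; apply/orP; left; apply/eqP; field.
  apply: (@dyadic_sum _ _ _ shellE _ b 2^-1 0) => //.
    by apply/andP; split; lra.
  move=> k _; rewrite big_filter_cond.
  apply: le_trans (@sum_le_size _ _ _ _ _ (T * 64 * 8^-1 ^+ k) _ _ _ (count_shellE k (boxE_uniq L))) _.
  - by rewrite !mulr_ge0 ?exprn_ge0 ?invr_ge0.
  - by move=> x /andP[x0 /eqP <-]; exact: fine.
  rewrite /b natrM natrX (_ : 8^-1 = 4^-1 * 2^-1 :> R); last by rewrite -invfM -natrM.
  have h4 : 4 ^+ k * 4^-1 ^+ k = 1 :> R by rewrite -exprMn divff ?expr1n ?pnatr_eq0.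
  rewrite exprMn le_eqVlt; apply/orP; left; apply/eqP.
  rewrite -[RHS]mulr1; move: (4 ^+ k) (4^-1 ^+ k) h4 => u v <-; ring.
rewrite -big_filter.
have : size [seq c <- boxE L | ~~ (c != 0)] = count_mem (0 : eis) (boxE L).
  by rewrite size_filter; apply: eq_count => x /=; rewrite negbK.
rewrite (count_uniq_mem _ (boxE_uniq L)).
case: [seq c <- boxE L | ~~ (c != 0)] => [_|c [_|c' s]]; rewrite ?big_nil ?big_seq1 //.
  by rewrite normc0.
by case: (_ \in _).
Qed.

End BoxBound.

(** * Characters of the Eisenstein integers modulo 28 *)

Section Residues.
Implicit Types x y : eis.

(* for t = 2 and t = 4, the image of x in F_7 under w |-> t *)
Definition resE (t : nat) x : nat := absz ((ea x + t%:Z * eb x) %% 7)%Z.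

Lemma resE_eq t x : exists k : int, ea x + t%:Z * eb x = k * 7 + (resE t x)%:Z.
Proof.
exists ((ea x + t%:Z * eb x) %/ 7)%Z; rewrite /resE gez0_abs ?modz_ge0 //.
exact: divz_eq.
Qed.

Lemma resE_unique t x (k : int) (r : nat) : ea x + t%:Z * eb x = k * 7 + r%:Z ->
  resE t x = r %[mod 7].
Proof. by have [l ->] := resE_eq t x; lia. Qed.

Lemma resEM t x y : t \in [:: 2; 4]%N -> resE t (x * y) = resE t x * resE t y %[mod 7].
Proof.
move=> ht; have [k hk] := resE_eq t x; have [l hl] := resE_eq t y.
have [q hq] : exists q : int, 1 + t%:Z + t%:Z ^+ 2 = q * 7.
  by move: ht; rewrite !inE => /orP[]/eqP->; [exists 1 | exists 3].
apply: (@resE_unique _ _ (k * l * 7 + k * (resE t y)%:Z + l * (resE t x)%:Z - eb x * eb y * q)).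
rewrite PoszM mulEE /=.
have -> : ea x * ea y - eb x * eb y + t%:Z * (ea x * eb y + eb x * ea y - eb x * eb y) =
  (ea x + t%:Z * eb x) * (ea y + t%:Z * eb y) - eb x * eb y * (1 + t%:Z + t%:Z ^+ 2) by ring.
by rewrite hk hl hq; ring.
Qed.

(** Modulo 7, [2 + 4 = -1] and [2 * 4 = 1], so the two residues are those of [x] and of its
    conjugate under one reduction. *)
Lemma resE_norm x : nmE x = resE 2 x * resE 4 x %[mod 7].
Proof.
have [k hk] := resE_eq 2 x; have [l hl] := resE_eq 4 x.
have h : normE x = (ea x + 2%:Z * eb x) * (ea x + 4%:Z * eb x) - 7 * (ea x * eb x + eb x ^+ 2).
  by rewrite /normE; ring.
rewrite hk hl -nmEE in h.
have : (nmE x)%:Z = (resE 2 x * resE 4 x)%N%:Z +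
   7 * (k * l * 7 + k * (resE 4 x)%:Z + l * (resE 2 x)%:Z - (ea x * eb x + eb x ^+ 2)).
  by rewrite h PoszM; ring.
by lia.
Qed.

(* x = w ^ k2E x modulo 2 *)
Definition k2E x : nat := if (2 %| eb x)%Z then 0 else if (2 %| ea x)%Z then 1 else 2.
(** The exponent of the quadratic character modulo 4 of the norm. The value 1 puts the norm of a
    primary element in the class 7 modulo 12. *)
Definition e4E x : nat := (nmE x %% 4 == 3)%N.
Definition unit14 x : bool := coprime (nmE x) 14.

Lemma unit14M x y : unit14 (x * y) = unit14 x && unit14 y.
Proof. by rewrite /unit14 nmEM coprimeMl. Qed.

Lemma unit14E x : unit14 x = odd (nmE x) && ~~ (7 %| nmE x)%N.
Proof.
by rewrite /unit14 (coprimeMr _ 2 7) coprimen2 [coprime _ 7]coprime_sym prime_coprime.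
Qed.

Lemma unit14_res x : unit14 x -> ~~ (7 %| resE 2 x)%N /\ ~~ (7 %| resE 4 x)%N.
Proof.
rewrite unit14E => /andP[_]; rewrite /dvdn resE_norm -/(dvdn _ _) Euclid_dvdM // negb_or.
by case/andP.
Qed.

Lemma e4EM x y : unit14 x -> unit14 y -> (3 * e4E (x * y)%R = 3 * e4E x + 3 * e4E y %[mod 6])%N.
Proof.
rewrite !unit14E => /andP[ox _] /andP[oy _]; rewrite /e4E nmEM.
have hx : (nmE x = 4 * (nmE x %/ 4) + nmE x %% 4)%N by rewrite mulnC -divn_eq.
have hy : (nmE y = 4 * (nmE y %/ 4) + nmE y %% 4)%N by rewrite mulnC -divn_eq.
have {ox} : (nmE x %% 4 = 1 \/ nmE x %% 4 = 3)%N by lia.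
have {oy} : (nmE y %% 4 = 1 \/ nmE y %% 4 = 3)%N by lia.
by rewrite -[(nmE x * nmE y %% 4)%N]modnMm; move=> [->|->] [->|->].
Qed.

Definition oddz (a : int) : bool := odd `|a|%N.

Lemma oddzM a b : oddz (a * b) = oddz a && oddz b.
Proof. by rewrite /oddz abszM oddM. Qed.

Lemma oddzD a b : oddz (a + b) = oddz a (+) oddz b.
Proof. by rewrite /oddz; lia. Qed.

Lemma oddzN a : oddz (- a) = oddz a.
Proof. by rewrite /oddz abszN. Qed.

Lemma dvd2_oddz a : (2 %| a)%Z = ~~ oddz a.
Proof. by rewrite /oddz dvdzE dvdn2. Qed.

Lemma odd_nmE x : odd (nmE x) = oddz (ea x) || oddz (eb x).
Proof.
rewrite -[odd _]/(oddz (normE x)) /normE !expr2 !(oddzD, oddzN, oddzM).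
by case: (oddz _); case: (oddz _).
Qed.

Lemma k2EM x y : odd (nmE x) -> odd (nmE y) -> k2E (x * y) = k2E x + k2E y %[mod 3].
Proof.
rewrite !odd_nmE /k2E mulEE /= !dvd2_oddz !(oddzD, oddzN, oddzM).
by case: (oddz (ea x)); case: (oddz (eb x)); case: (oddz (ea y)); case: (oddz (eb y)).
Qed.

(* the quadruple (i1, i2, j, e) indexes a character of the residues modulo 28 *)
Definition expE (t : nat * nat * nat * nat) (d1 d2 k e : nat) : nat :=
  (t.1.1.1 * d1 + t.1.1.2 * d2 + 2 * (t.1.2 * k) + 3 * (t.2 * e))%N.

Definition expEE t x := expE t (dlog7 (resE 4 x)) (dlog7 (resE 2 x)) (k2E x) (e4E x).

Lemma dlog7_mod m n : m = n %[mod 7] -> dlog7 m = dlog7 n.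
Proof. by rewrite /dlog7 => ->. Qed.

Lemma expEEM t x y : unit14 x -> unit14 y -> expEE t (x * y) = expEE t x + expEE t y %[mod 6].
Proof.
move=> ux uy; have [x2 x4] := unit14_res ux; have [y2 y4] := unit14_res uy.
have h4 := dlog7M x4 y4; have h2 := dlog7M x2 y2.
rewrite -(dlog7_mod (resEM x y (isT : 4 \in [:: 2; 4])%N)) in h4.
rewrite -(dlog7_mod (resEM x y (isT : 2 \in [:: 2; 4])%N)) in h2.
have h3 := e4EM ux uy.
move: (ux) (uy); rewrite !unit14E => /andP[ox _] /andP[oy _].
have hk := k2EM ox oy.
case: t => [[[i1 i2] j] e]; rewrite /expEE /expE /=.
set a := dlog7 (resE 4 (x * y)) in h4 *; set b := dlog7 (resE 2 (x * y)) in h2 *.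
set k := k2E (x * y) in hk *; set q := e4E (x * y) in h3 *.
have hk6 : (2 * k = 2 * k2E x + 2 * k2E y %[mod 6])%N by lia.
have lin (u v w z : nat) : (u = v + w %[mod 6] -> z * u = z * v + z * w %[mod 6])%N.
  by move=> h; rewrite -modnMmr h modnMmr mulnDr.
have l4 := lin _ _ _ i1 h4; have l2 := lin _ _ _ i2 h2.
have lk := lin _ _ _ j hk6; have lq := lin _ _ _ e h3.
rewrite ![(2 * (j * _))%N]mulnCA ![(3 * (e * _))%N]mulnCA.
move: (i1 * a)%N (i1 * _)%N (i1 * _)%N (i2 * b)%N (i2 * _)%N (i2 * _)%N l4 l2 => ? ? ? ? ? ? l4 l2.
move: (j * (2 * k))%N (j * _)%N (j * _)%N (e * (3 * q))%N (e * _)%N (e * _)%N lk lq => ? ? ? ? ? ?.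
by lia.
Qed.

End Residues.

Lemma nmE_shift (c x : eis) : nmE (shiftE c x) = nmE x %[mod 84].
Proof.
have h := nmEE (shiftE c x); have h' := nmEE x.
have e : normE (shiftE c x) = normE x + 84 * (84 * normE c + ea c * (2 * ea x - eb x) + eb c * (2 * eb x - ea x)).
  by rewrite /normE /shiftE; cbn [ea eb]; ring.
by rewrite e -h' in h; lia.
Qed.

Lemma resE_shift t (c x : eis) : resE t (shiftE c x) = resE t x %[mod 7].
Proof.
have [k hk] := resE_eq t x.
apply: (@resE_unique _ _ (k + 12 * (ea c + t%:Z * eb c))).
rewrite /shiftE; cbn [ea eb].
have -> : 84 * ea c + ea x + t%:Z * (84 * eb c + eb x) = ea x + t%:Z * eb x + 84 * (ea c + t%:Z * eb c) by ring.
by rewrite hk; ring.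
Qed.

Lemma unit14_shift (c x : eis) : unit14 (shiftE c x) = unit14 x.
Proof.
rewrite /unit14 -coprime_modl -[RHS]coprime_modl.
by rewrite -(modn_dvdm _ (isT : 14 %| 84)%N) nmE_shift modn_dvdm.
Qed.

Lemma expEE_shift t (c x : eis) : expEE t (shiftE c x) = expEE t x.
Proof.
rewrite /expEE (dlog7_mod (resE_shift 4 c x)) (dlog7_mod (resE_shift 2 c x)).
have -> : e4E (shiftE c x) = e4E x.
  by rewrite /e4E -(modn_dvdm _ (isT : 4 %| 84)%N) nmE_shift modn_dvdm.
congr expE; rewrite /k2E !dvd2_oddz /shiftE; cbn [ea eb].
have h (a b : int) : oddz (84 * a + b) = oddz b by rewrite oddzD oddzM.
by rewrite !h.
Qed.

Lemma primary_shift (c x : eis) : primary (shiftE c x) = primary x.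
Proof. by rewrite /primary /shiftE; cbn [ea eb]; lia. Qed.

(* the characters that are nontrivial on the residues of norm 1 modulo 7: these have d1 = - d2
   modulo 6, so that i is the exponent there and t runs over the extensions *)
Definition charsE : seq (nat * nat * nat * nat) :=
  [seq ((t + i.1.1) %% 6, t, i.1.2, i.2)%N |
     i <- behead [seq (ij, e) | ij <- [seq (i, j) | i <- iota 0 6, j <- iota 0 3], e <- iota 0 2], t <- iota 0 6].

Definition classE (x : eis) := (dlog7 (resE 4 x), dlog7 (resE 2 x), k2E x, e4E x).
Definition expC t (c : nat * nat * nat * nat) := expE t c.1.1.1 c.1.1.2 c.1.2 c.2.

Definition classesE (s : seq eis) := [seq classE x | x <- s & primary x && unit14 x].

(* the values of the character cancel, because zeta6 ^ 2 = zeta6 - 1 *)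
Definition balanced (t : nat * nat * nat * nat) (s : seq (nat * nat * nat * nat)) :=
  let m := [seq expC t d %% 6 | d <- s]%N in
  let n k := count_mem k m in
  (n 0 + n 5 == n 3 + n 2)%N && (n 1 + n 2 == n 4 + n 5)%N.

(* the let makes the virtual machine evaluate the classes only once *)
Lemma charsE_balanced_let :
  let cl := classesE cellE in all (fun t => balanced t cl) charsE.
Proof. by vm_compute. Qed.

Lemma charsE_balanced t : t \in charsE -> balanced t (classesE cellE).
Proof.
have := charsE_balanced_let; move: (classesE cellE) => cl h ht.
exact: (allP h t ht).
Qed.

Section EisChar.
Variable R : archiRcfType.
Implicit Types x y : eis.

Definition charE t x : R[i] := if unit14 x then zeta6 R ^+ expEE t x else 0.

Lemma charEM t x y : charE t (x * y) = charE t x * charE t y.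
Proof.
rewrite /charE unit14M; case: (boolP (unit14 x)) => ux; rewrite ?mul0r //=.
case: (boolP (unit14 y)) => uy; rewrite ?mulr0 //.
by rewrite -exprD zeta6_mod expEEM // -zeta6_mod.
Qed.

Lemma charE1 t : charE t 1 = 1.
Proof.
have e : expEE t 1 = expE t 0 0 0 0 by [].
by rewrite /charE /unit14 nmE1 e /expE !muln0.
Qed.

Lemma charE_le1 t x : normc (charE t x) <= 1.
Proof.
rewrite /charE; case: ifP => _; last by rewrite normc0.
by rewrite normcX normc_zeta6 expr1n.
Qed.

Lemma sum_zeta6 (s : seq nat) : (all (fun k => k < 6) s)%N ->
  (count_mem 0 s + count_mem 5 s = count_mem 3 s + count_mem 2 s)%N ->
  (count_mem 1 s + count_mem 2 s = count_mem 4 s + count_mem 5 s)%N ->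
  \sum_(k <- s) zeta6 R ^+ k = 0.
Proof.
move=> s6 h1 h2.
have -> : \sum_(k <- s) zeta6 R ^+ k = \sum_(0 <= k < 6) (count_mem k s)%:R * zeta6 R ^+ k.
  elim: s s6 {h1 h2} => [_|k s IH /= /andP[k6 s6]].
    by rewrite big_nil big1_seq // => k _; rewrite mul0r.
  rewrite big_cons IH //.
  under [RHS]eq_bigr do rewrite natrD mulrDl.
  rewrite big_split; congr (_ + _).
  rewrite (bigD1_seq k) ?mem_index_iota ?iota_uniq //= eqxx mul1r big1 ?addr0 // => i ik.
  by rewrite eq_sym (negbTE ik) mul0r.
rewrite unlock /= expr0 expr1.
have z2 : zeta6 R ^+ 2 = zeta6 R - 1.
  by rewrite zeta6_2; apply/eqP; rewrite eq_complex /= subr0; apply/andP; split; apply/eqP => //; field.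
have z4 : zeta6 R ^+ 4 = - zeta6 R by rewrite exprSr zeta6_3 mulN1r.
have z5 : zeta6 R ^+ 5 = - zeta6 R ^+ 2 by rewrite (exprD _ 3 2) zeta6_3 mulN1r.
rewrite z5 z4 zeta6_3 z2.
move: h1 h2 => /(congr1 (fun n => n%:R : R[i])) + /(congr1 (fun n => n%:R : R[i])).
rewrite !natrD.
move: (count_mem 0 s)%:R (count_mem 1 s)%:R (count_mem 2 s)%:R (count_mem 3 s)%:R (count_mem 4 s)%:R (count_mem 5 s)%:R => a0 a1 a2 a3 a4 a5 h1 h2.
have -> : a0 * 1 + (a1 * zeta6 R + (a2 * (zeta6 R - 1) + (a3 * -1 + (a4 * - zeta6 R + (a5 * - (zeta6 R - 1) + 0))))) =
  (a0 + a5 - (a3 + a2)) + (a1 + a2 - (a4 + a5)) * zeta6 R by ring.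
by rewrite h1 h2 !subrr mul0r addr0.
Qed.

Lemma charE_sum_classes t (s : seq eis) :
  \sum_(x <- s) (if primary x then charE t x else 0) =
  \sum_(k <- [seq expC t d %% 6 | d <- classesE s]%N) zeta6 R ^+ k.
Proof.
rewrite !big_map big_filter [RHS]big_mkcond; apply: eq_bigr => x _.
by rewrite /charE; case: (primary x); case: (unit14 x) => //=; rewrite -zeta6_mod.
Qed.

Lemma balanced_sum0 t (s : seq eis) :
  balanced t (classesE s) ->
  \sum_(x <- s) (if primary x then charE t x else 0) = 0.
Proof.
move=> /andP[/eqP h1 /eqP h2]; rewrite charE_sum_classes; apply: sum_zeta6 h1 h2.
by rewrite all_map; apply/allP => d _; exact: ltn_pmod.
Qed.

Lemma charE_sum0 t : t \in charsE ->
  \sum_(x <- cellE) (if primary x then charE t x else 0) = 0.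
Proof. by move=> ht; exact: balanced_sum0 (charsE_balanced ht). Qed.

Lemma eis_sieve j t : exists X0, forall Y, (X0 <= Y)%N -> exists M0, forall M, (M0 <= M)%N ->
  normc (\prod_(p <- ballE Y | prE p) (1 - charE t p * (wt R j (nmE p))%:C) *
         \sum_(x <- ballE M) charE t x * (wt R j (nmE x))%:C - 1) <= 2^-1.
Proof.
apply: (@sieve R eis 1 *%R dvdE nmE primary prE ballE) => //.
- exact: ballE_uniq.
- exact: mem_ballE.
- by move=> x /primary_neq0; rewrite nmE_gt0.
- exact: primary_nm1.
- exact: primaryM.
- exact: nmEM.
- exact: prE_primary.
- exact: prE_gt1.
- by move=> p x /prE_primary; exact: dvdE_primary.
- by move=> p y /prE_neq0 p0 _; exact: dvdE_mulr.
- by move=> p /prE_neq0 p0 x y _ _; exact: mulEI.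
- exact: prE_euclid.
- exact: prE_exists.
- by move=> x y _ _; exact: charEM.
- exact: charE1.
- exact: charE_le1.
- exact: wt_ge0.
- exact: wt_le1.
- exact: wtM.
- exact: wt1.
- exact: eis_tail.
Qed.

(** Cancellation is available over boxes, whereas the sieve uses balls. The part of the box outside
    the ball has norms above [M], hence total weight at most 1 once [M] is large. *)
Lemma eis_sum_upper t : t \in charsE -> exists2 K : R, 0 <= K & forall j, exists M0,
  forall M, (M0 <= M)%N -> normc (\sum_(x <- ballE M) charE t x * (wt R j (nmE x))%:C) <= K.
Proof.
move=> ht; have [|c x||K K0 hK] := @box_upper R (fun x => if primary x then charE t x else 0).
- by move=> x; case: ifP => _; rewrite ?charE_le1 // normc0.
- by rewrite primary_shift /charE unit14_shift expEE_shift.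
- exact: charE_sum0.
exists (K + 1) => [|j]; first by rewrite addr_ge0.
have [M0 hM] := eis_tail j (ltr01 : 0 < (1 : R)); exists M0 => M M0M.
pose f x := charE t x * (wt R j (nmE x))%:C.
have e : \sum_(x <- boxE (84 * (M + 2))) (if primary x then charE t x else 0) * (wt R j (nmE x))%:C =
   \sum_(x <- ballE M) f x + \sum_(x <- boxE (84 * (M + 2)) | primary x && (M < nmE x)%N) f x.
  rewrite (eq_bigr (fun x => if primary x then f x else 0)); last by move=> x _; case: ifP; rewrite ?mul0r.
  rewrite -big_mkcond (bigID (fun x => nmE x <= M)%N) /=; congr (_ + _); last first.
    by apply: eq_bigl => x; rewrite ltnNge.
  rewrite -big_filter; apply: perm_big; apply: uniq_perm; rewrite ?filter_uniq ?boxE_uniq ?ballE_uniq //.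
  move=> x; rewrite mem_ballE mem_filter; apply: andb_idr => /andP[_ /nmE_le_box].
  by rewrite !mem_boxE; lia.
have -> : \sum_(x <- ballE M) f x = \sum_(x <- boxE (84 * (M + 2))) (if primary x then charE t x else 0) * (wt R j (nmE x))%:C -
   \sum_(x <- boxE (84 * (M + 2)) | primary x && (M < nmE x)%N) f x by rewrite e addrK.
apply: le_trans (normcB _ _) _; apply: lerD; first exact: hK.
apply: le_trans (normc_sum _ _ _) _.
apply: (@le_trans _ _ (\sum_(x <- boxE (84 * (M + 2)) | primary x && (M < nmE x)%N) wt R j (nmE x))).
  apply: ler_sum => x _; rewrite normcM normc_real ?wt_ge0 //.
  by rewrite ler_piMl ?wt_ge0 ?charE_le1.
rewrite -big_filter; apply: hM; first by rewrite filter_uniq ?boxE_uniq.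
by move=> x; rewrite mem_filter => /andP[/andP[px Mx] _]; split=> //; exact: leq_ltn_trans Mx.
Qed.

(** The counterpart of [nat_prod_le]: the product times the series has absolute value at least 1/2
    by the sieve, so an upper bound for the series gives a lower bound for the product, and it does
    not depend on [j]. *)
Lemma eis_prod_lower t : t \in charsE -> exists2 k : R, 0 < k & forall j, exists X0,
  forall Y, (X0 <= Y)%N ->
  k <= normc (\prod_(p <- ballE Y | prE p) (1 - charE t p * (wt R j (nmE p))%:C)).
Proof.
move=> /eis_sum_upper[K K0 hK]; exists (2 * (K + 1))^-1 => [|j].
  by rewrite invr_gt0 mulr_gt0 // ltr_wpDl.
have [X0 hX] := eis_sieve j t; exists X0 => Y /hX[M1 h1].
have [M2 h2] := hK j; have {h1} := h1 _ (leq_maxl M1 M2); have {h2} := h2 _ (leq_maxr M1 M2).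
set P := \prod_(p <- _ | _) _; set S := \sum_(x <- _) _ => h2 h1.
have h3 : 2^-1 <= normc P * normc S.
  rewrite -normcM.
  have : normc (1 : R[i]) <= normc (P * S) + normc (P * S - 1).
    have {1}-> : 1 = P * S - (P * S - 1) by ring.
    exact: normcB.
  by rewrite normc1; lra.
have K1 : 0 < K + 1 by rewrite ltr_wpDl.
rewrite invfM ler_pdivrMr //; apply: le_trans h3 _.
by rewrite ler_wpM2l ?normc_ge0 //; lra.
Qed.

End EisChar.

(** * Split primes *)

Lemma Fp_exp p (x : 'F_p) : prime p -> x != 0 -> x ^+ p.-1 = 1.
Proof.
move=> pp x0; apply: (mulfI x0); rewrite -exprS mulr1 prednK ?prime_gt0 //.
by have := expf_card x; rewrite card_Fp.
Qed.

Lemma Fp_generator p : prime p -> exists g : 'F_p, (p.-1).-primitive_root g.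
Proof.
move=> pp; have p1 := prime_gt1 pp.
have h : has (p.-1).-primitive_root [seq x <- enum 'F_p | x != 0].
  apply: has_prim_root.
  - by lia.
  - by apply/allP => x; rewrite mem_filter => /andP[x0 _]; rewrite unity_rootE Fp_exp.
  - by rewrite filter_uniq ?enum_uniq.
  rewrite -rem_filter ?enum_uniq // size_rem ?mem_enum // -cardE card_Fp //.
by case/hasP: h => g _ hg; exists g.
Qed.

Lemma cube_root_unity p : prime p -> (p %% 3 = 1)%N -> exists x : nat, (p %| x ^ 2 + x + 1)%N.
Proof.
move=> pp p3; have [g hg] := Fp_generator pp.
have d3 : (3 %| p.-1)%N by have := prime_gt1 pp; lia.
have hz := dvdn_prim_root hg d3; set z := g ^+ _ in hz.
exists (z : nat); rewrite (dvdn_pcharf (pchar_Fp pp)) !natrD natrX natr_Zp.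
have z3 := prim_expr_order hz.
have z1 : z - 1 != 0.
  rewrite subr_eq0; apply/eqP => z1.
  by have := prim_order_dvd hz 1; rewrite z1 expr1n eqxx.
have e : (z - 1) * (z ^+ 2 + z + 1) = z ^+ 3 - 1 by ring.
by apply/eqP/(mulfI z1); rewrite mulr0 e z3 subrr.
Qed.

(** If [x ^ 2 + x + 1] is a multiple of [p], then [p] divides [(x - w) * (x + 1 + w)] but neither
    factor, whose coordinates on [w] are -1 and 1. Hence a primary prime divisor of [p] cannot have
    norm [p ^ 2], for it would then equal [p]. *)
Lemma prE_above p : prime p -> (p %% 3 = 1)%N -> exists2 d, prE d & nmE d = p.
Proof.
move=> pp p3; have p1 := prime_gt1 pp; pose P := Eis p%:Z 0.
have nP : nmE P = (p * p)%N.
  by apply/eqP; rewrite -eqz_nat nmEE /normE /P PoszM /=; apply/eqP; ring.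
have pP : primary P by rewrite /primary /P /=; lia.
have [||d prd dP] := @prE_exists P; rewrite ?nP //; first by rewrite (leq_trans p1) // leq_pmulr // ltnW.
exists d => //; have [y py Py] := dvdE_primary (prE_primary prd) pP dP.
have dd : (nmE d %| p ^ 2)%N by rewrite -mulnn -nP Py nmEM dvdn_mulr.
case/(dvdn_pfactor _ _ pp): dd => -[|[|[|//]]] _ hd.
- by have := prE_gt1 prd; rewrite hd.
- by rewrite hd expn1.
have y1 : y = 1.
  apply: (primary_nm1 py); apply/eqP; rewrite -(eqn_pmul2l (_ : 0 < p ^ 2)%N) ?expn_gt0 ?prime_gt0 // muln1.
  by rewrite -[in X in (X * _)%N]hd -nmEM -Py nP mulnn.
rewrite y1 mulr1 in Py; have [x hx] := cube_root_unity pp p3.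
have d0 := prE_neq0 prd.
have hdv : dvdE d (Eis x%:Z (-1) * Eis (x%:Z + 1) 1).
  apply/(dvdEP _ d0); have [k hk] := dvdnP hx; exists (Eis k%:Z 0).
  have hk' : x%:Z * x%:Z + x%:Z + 1 = k%:Z * p%:Z.
    by have := congr1 Posz hk; rewrite -mulnn !PoszD !PoszM.
  rewrite -Py !mulEE /P /=; apply: eisP => /=; last by ring.
  by rewrite mul0r subr0 [p%:Z * _]mulrC -hk'; ring.
have bad (a b : int) : `|b| = 1 -> ~ dvdE d (Eis a b).
  move=> b1 /(dvdEP _ d0)[z]; rewrite -Py mulEE /P => /(congr1 eb) /=.
  rewrite !mul0r addr0 subr0 => h; have : (p%:Z %| b)%Z by rewrite h dvdz_mulr.
  have b1' : absz b = 1%N by lia.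
  by rewrite dvdzE b1' /= dvdn1 => /eqP hp; rewrite hp in p1.
by case/orP: (prE_prime prd hdv) => /bad h; case: h.
Qed.

(** * Eisenstein primes in the target classes *)

Definition quad : Type := (nat * nat * nat * nat)%type.

Definition pow3 (d : nat) : nat := nth 0 [:: 1; 3; 2; 6; 4; 5]%N (d %% 6).

(* With u = 3 ^ d1, v = 3 ^ d2 and c = 2 ^ k in F_7, the condition
   u (1 + 3 c - c ^ 2) + 2 u v = 0 *)
Definition good_class (c : quad) : bool :=
  (c.2 == 1)%N && (7 %| pow3 c.1.1.1 * nth 0 [:: 3; 3; 4] c.1.2 + 2 * pow3 (c.1.1.1 + c.1.1.2))%N.

Definition conj_class (c : quad) : quad := (c.1.1.2, c.1.1.1, (3 - c.1.2) %% 3, c.2)%N.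

Definition norm1_class (c : quad) : bool := ((c.1.1.1 + c.1.1.2) %% 6 == 0)%N.

Definition target_class (c : quad) : bool :=
  norm1_class c && (good_class c || good_class (conj_class c)).

Definition all_classes : seq quad :=
  [seq (d, ke.1, ke.2) | d <- [seq (d1, d2) | d1 <- iota 0 6, d2 <- iota 0 6],
                         ke <- [seq (k, e) | k <- iota 0 3, e <- iota 0 2]].

(* unlike the locked bigops, this computes *)
Definition sumz (s : seq int) : int := foldr +%R 0 s.

Lemma sumzE s : sumz s = \sum_(a <- s) a.
Proof. by elim: s => [|a s IH]; rewrite ?big_nil ?big_cons //= IH. Qed.

(** The division by 2 undoes the doubling in [cos6]; [absz] only changes the type, since S(psi) is
    less than 5 for the characters of [charsE]. *)
Definition multE (E : seq quad) (t : quad) : nat :=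
  absz (5 - divz (sumz [seq cos6 (expC t c) | c <- E]) 2).

(* each nontrivial character psi is taken 5 - S(psi) times, where S(psi) is the sum
   of psi over the target classes: by orthogonality, the sum of all these characters
   is then nonnegative outside of the target *)
Definition charsM : seq quad :=
  let E := [seq c <- all_classes | target_class c] in flatten [seq nseq (multE E t) t | t <- charsE].

Lemma charsM_let : let M := charsM in all (fun c => target_class c ||
  (let H := sumz [seq cos6 (expC t c) | t <- M] in
   (0 <= H) && (norm1_class c ==> (2 <= H)))) all_classes.
Proof. by vm_compute. Qed.

Lemma charsM_class c : c \in all_classes -> ~~ target_class c ->
  0 <= \sum_(t <- charsM) cos6 (expC t c) /\
  (norm1_class c -> 2 <= \sum_(t <- charsM) cos6 (expC t c)).
Proof.
have := charsM_let; move: charsM => M /allP h /h; rewrite sumzE big_map => /orP[->//|].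
by move=> /andP[-> /implyP].
Qed.

Lemma charsM_sub t : t \in charsM -> t \in charsE.
Proof.
rewrite /charsM; move: charsE [seq c <- _ | _] => s E /flattenP[u /mapP[t' ht' ->]].
by rewrite mem_nseq => /andP[_ /eqP ->].
Qed.

Lemma dlog7_lt n : (dlog7 n < 6)%N.
Proof.
by rewrite /dlog7; have := ltn_pmod n (isT : 0 < 7)%N; move: (n %% 7)%N; do 7?[case=> //].
Qed.

Lemma classE_all (x : eis) : classE x \in all_classes.
Proof.
rewrite /classE /all_classes; apply/allpairsP.
exists ((dlog7 (resE 4 x), dlog7 (resE 2 x)), (k2E x, e4E x)); split; last by [].
  by apply: (allpairs_f (fun a b => (a, b))); rewrite mem_iota /= dlog7_lt.
apply: (allpairs_f (fun a b => (a, b))); rewrite mem_iota /=.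
  by rewrite /k2E; case: ifP => // _; case: ifP.
by rewrite /e4E; case: eqP.
Qed.

Lemma norm1_mod7 (x : eis) : (nmE x %% 7 = 1)%N -> norm1_class (classE x).
Proof.
move=> h; have h2 : (resE 2 x * resE 4 x = 1 %[mod 7])%N by rewrite -resE_norm h.
have : ~~ (7 %| resE 2 x * resE 4 x)%N by rewrite /dvdn h2.
rewrite Euclid_dvdM // negb_or => /andP[h3 h4].
rewrite /norm1_class /= addnC; apply/eqP; rewrite -(dlog7M h3 h4).
by rewrite (dlog7_mod h2).
Qed.

Section Target.
Variable R : archiRcfType.

(* the Euler factor at x of the product of the characters in charsM *)
Definition Q j x : R := \prod_(t <- charsM) normc (1 - charE R t x * (wt R j (nmE x))%:C) ^+ 2.

Lemma normc_factor_le j t x : normc (1 - charE R t x * (wt R j (nmE x))%:C) ^+ 2 <= 4.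
Proof.
have h : normc (1 - charE R t x * (wt R j (nmE x))%:C) <= 2.
  apply: le_trans (normcB _ _) _; rewrite normc1 normcM normc_real ?wt_ge0 //.
  have := mulr_ile1 (normc_ge0 _) (wt_ge0 R j (nmE x)) (charE_le1 R t x) (wt_le1 R j (nmE x)).
  lra.
by have := normc_ge0 (1 - charE R t x * (wt R j (nmE x))%:C); rewrite expr2; nra.
Qed.

Lemma Q_ge0 j x : 0 <= Q j x.
Proof. by apply: prodr_ge0 => t _; rewrite exprn_ge0 ?normc_ge0. Qed.

Lemma Q_le j x : Q j x <= 4 ^+ size charsM.
Proof.
rewrite /Q; elim: charsM => [|t M IH]; first by rewrite big_nil expr0.
rewrite big_cons (_ : 4 ^+ size (t :: M) = 4 * 4 ^+ size M); last exact: exprS.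
apply: ler_pM; rewrite ?exprn_ge0 ?normc_ge0 ?normc_factor_le //.
by apply: prodr_ge0 => s _; rewrite exprn_ge0 ?normc_ge0.
Qed.

(** [Q] is [1 - H * w + O(w ^ 2)], where [H] is the sum of doubled cosines bounded in
    [charsM_class]. At elements that are not units modulo 14 every character vanishes and [Q] is
    1. *)
Lemma Q_upper : exists2 K : R, 0 <= K & forall j x, ~~ (unit14 x && target_class (classE x)) ->
  Q j x <= 1 + K * wt R j (nmE x) ^+ 2 /\
  (unit14 x -> norm1_class (classE x) -> Q j x <= 1 - 2 * wt R j (nmE x) + K * wt R j (nmE x) ^+ 2).
Proof.
have [K K0 hK] := prod_factor_bound R (size charsM); exists K => // j x hx.
have w01 : 0 <= wt R j (nmE x) <= 1 by rewrite wt_ge0 wt_le1.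
have [ux|nux] := boolP (unit14 x); last first.
  split=> //; have -> : Q j x = 1.
    rewrite /Q big1 // => t _.
    by rewrite /charE (negbTE nux) mul0r subr0 normc1 expr1n.
  by rewrite lerDl mulr_ge0 ?exprn_ge0 ?wt_ge0.
have nt : ~~ target_class (classE x) by move: hx; rewrite ux.
have [H0 H2] := charsM_class (classE_all x) nt.
have QE : Q j x = \prod_(k <- [seq expC t (classE x) | t <- charsM])
     (1 - (cos6 k)%:~R * wt R j (nmE x) + wt R j (nmE x) ^+ 2).
  rewrite big_map; apply: eq_bigr => t _.
  by rewrite /charE ux zeta6_factor.
have := hK [seq expC t (classE x) | t <- charsM] _ (size_map _ _) w01.
rewrite -QE big_map ler_norml => /andP[_ h].
move: H0 H2 h; set H := \sum_(t <- charsM) _ => H0 H2 h; case/andP: w01 => w0 w1.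
split=> [|_ n1].
  have : 0 <= H%:~R * wt R j (nmE x) by rewrite mulr_ge0 ?ler0z.
  lra.
have : 2 * wt R j (nmE x) <= H%:~R * wt R j (nmE x).
  by rewrite ler_wpM2r // (_ : 2 = 2%:~R) // ler_int H2.
lra.
Qed.

Lemma prod_subset_le (T : eqType) (F G : seq T) (g : T -> R) :
  uniq F -> uniq G -> {subset G <= F} -> (forall x, 0 <= g x <= 1) ->
  \prod_(x <- F) g x <= \prod_(x <- G) g x.
Proof.
move=> uF uG sGF g01.
have -> : \prod_(x <- G) g x = \prod_(x <- F | x \in G) g x.
  rewrite -[RHS]big_filter; apply: perm_big; apply: uniq_perm; rewrite ?filter_uniq //.
  by move=> x; rewrite mem_filter; apply/idP/andP => [h|[]//]; split=> //; exact: sGF.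
rewrite (bigID (mem G)) /= ler_piMr ?prodr_ge0 //; first by move=> x _; case/andP: (g01 x).
by apply: prodr_ile1.
Qed.

(** Since [(1 + x) * (1 - x) <= 1], the claim follows from the Weierstrass inequality for the
    factors [1 - x]. *)
Lemma prod_one_add_le (I : Type) (s : seq I) (P : pred I) (x : I -> R) :
  (forall i, P i -> 0 <= x i <= 1) -> \sum_(i <- s | P i) x i <= 2^-1 ->
  \prod_(i <- s | P i) (1 + x i) <= 2.
Proof.
move=> x01 hs; have h := prod_one_sub_ge s x01.
have h2 : \prod_(i <- s | P i) (1 + x i) * \prod_(i <- s | P i) (1 - x i) <= 1.
  rewrite -big_split /=; apply: prodr_ile1 => i Pi; have /andP[x0 x1] := x01 i Pi.
  by apply/andP; split; nra.
have p0 : 0 <= \prod_(i <- s | P i) (1 + x i).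
  by apply: prodr_ge0 => i /x01 /andP[x0 _]; lra.
by move: h h2 p0 hs; move: (\prod_(i <- s | P i) _) (\prod_(i <- s | P i) _) (\sum_(i <- s | P i) _) => a b c; nra.
Qed.

Lemma eis_prod_lower_unif : exists2 k : R, 0 < k & forall j, exists X0, forall Y, (X0 <= Y)%N ->
  forall t, t \in charsE ->
  k <= normc (\prod_(p <- ballE Y | prE p) (1 - charE R t p * (wt R j (nmE p))%:C)).
Proof.
have : exists2 k : R, 0 < k & forall t, t \in charsE -> forall j, exists X0,
  forall Y, (X0 <= Y)%N ->
  k <= normc (\prod_(p <- ballE Y | prE p) (1 - charE R t p * (wt R j (nmE p))%:C)).
  elim: charsE (@eis_prod_lower R) => [|t s IH] h; first by exists 1.
  have [k1 k10 h1] := h t (mem_head _ _).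
  have [|k2 k20 h2] := IH; first by move=> u us; apply: h; rewrite inE us orbT.
  exists (Num.min k1 k2) => [|u]; first by rewrite lt_min k10.
  rewrite inE => /orP[/eqP->|us] j.
    by have [X0 hX] := h1 j; exists X0 => Y /hX; rewrite ge_min => ->.
  by have [X0 hX] := h2 u us j; exists X0 => Y /hX; rewrite ge_min orbC => ->.
move=> [k k0 h]; exists k => // j.
have [X0 hX] := eventually_all (fun t ht => h t ht j).
by exists X0.
Qed.

Lemma Q_lower : exists2 k : R, 0 < k & forall j, exists X0, forall Y, (X0 <= Y)%N ->
  k <= \prod_(p <- ballE Y | prE p) Q j p.
Proof.
have [k k0 h] := eis_prod_lower_unif; exists (\prod_(t <- charsM) k ^+ 2).
  by apply: prodr_gt0 => t _; rewrite exprn_gt0.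
move=> j; have [X0 hX] := h j; exists X0 => Y /hX {}hX.
rewrite /Q exchange_big big_seq [leRHS]big_seq; apply: ler_prod => t /charsM_sub ht.
rewrite exprn_ge0 ?(ltW k0) // prodrXl -normc_prod.
by apply: lerXn2r; rewrite ?nnegrE ?normc_ge0 ?(ltW k0) ?hX.
Qed.

Lemma wt0E n : wt R 0 n = n%:R ^- 2.
Proof. by rewrite /wt /root2 /= expr2. Qed.

(** For [j = 0] the exponent is 2. The quadratic errors for every [j] are thus dominated by one
    convergent series. *)
Lemma wt_sqr_le j n : wt R j n ^+ 2 <= wt R 0 n.
Proof.
rewrite wt0E -exprVn; apply: lerXn2r; rewrite ?nnegrE ?wt_ge0 ?invr_ge0 ?ler0n //.
exact: wt_le_inv.
Qed.

Lemma prod_const_le (T : Type) (s : seq T) (P : pred T) (f : T -> R) (c : R) n :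
  1 <= c -> (forall x, P x -> 0 <= f x <= c) -> (count P s <= n)%N ->
  \prod_(x <- s | P x) f x <= c ^+ n.
Proof.
move=> c1 fc hn; apply: (@le_trans _ _ (\prod_(x <- s | P x) c)).
  by apply: ler_prod.
rewrite big_const_seq -Monoid.iteropE.
have -> (x : R) k : iterop k *%R x 1 = x ^+ k by case: k.
exact: ler_weXn2l.
Qed.

(** If there is no such prime, the product of [Q] over primes of norm up to [Y] splits into small
    norms, at most [C], large norms outside the classes of norm 1, at most 2, and large norms inside
    them, at most [k / (4 * C)]. The total [k / 2] contradicts the lower bound [k]. *)
Lemma exists_target_prime (B0 : nat) :
  exists d, [/\ prE d, (B0 < nmE d)%N, unit14 d & target_class (classE d)].
Proof.
have [K K0 hQ] := Q_upper; have [k k0 hlow] := Q_lower.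
have e0 : 0 < (2 * (K + 1))^-1 by rewrite invr_gt0 mulr_gt0 // ltr_wpDl.
have [M0 hM0] := eis_tail (R := R) 0 e0.
(* Beyond [B], [K <= B] gives [K * w ^ 2 <= w], so that [1 - 2 * w + K * w ^ 2 <= 1 - w]; [M0] makes
   the sum of the [K * w ^ 2] at most 1/2; and 14 keeps the prime 2 out. *)
pose B := maxn (maxn B0 14) (maxn M0 (Num.bound K)).
have B0B : (B0 <= B)%N by rewrite /B; lia.
have B14 : (14 <= B)%N by rewrite /B; lia.
have M0B : (M0 <= B)%N by rewrite /B; lia.
have KB : K <= B%:R.
  apply: le_trans (ltW (archi_boundP K0)) _; rewrite ler_nat /B; lia.
clearbody B; pose n := size (ballE B).
pose C : R := (4 ^+ size charsM) ^+ n.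
have c1 : 1 <= 4 ^+ size charsM :> R by rewrite exprn_ege1 // ler1n.
have C0 : 0 < C by rewrite exprn_gt0 // (lt_le_trans _ c1).
have e1 : 0 < k / (4 * C) by rewrite divr_gt0 // mulr_gt0.
have [j0 hj] := primes_1_mod_21 B e1.
have [X1 h1] := hj j0 (leqnn _); have [X2 h2] := hlow j0.
pose Y := maxn X1 X2; have {h1} h1 := h1 Y (leq_maxl _ _); have {h2} h2 := h2 Y (leq_maxr _ _).
clearbody Y; clear hj hlow X1 X2.
have [/hasP[d dY /and4P[d1 d2 d3 d4]]|/hasPn none] :=
  boolP (has (fun d => [&& prE d, (B0 < nmE d)%N, unit14 d & target_class (classE d)]) (ballE Y)).
  by exists d.
exfalso; pose w x := wt R j0 (nmE x).
have w01 x : 0 <= w x <= 1 by rewrite wt_ge0 wt_le1.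
have wB x : (B < nmE x)%N -> 0 <= K * w x ^+ 2 <= w x.
  move=> hx; have n0 : 0 < (nmE x)%:R :> R by rewrite ltr0n (leq_ltn_trans _ hx).
  have h3 : K * w x <= 1.
    have := wt_le_inv R j0 (nmE x); rewrite -/(w x) => h3.
    have := ler_wpM2l K0 h3 => /le_trans; apply; rewrite ler_pdivrMr // mul1r.
    by apply: le_trans KB _; rewrite ler_nat ltnW.
  have /andP[w0 _] := w01 x; apply/andP; split; first by rewrite mulr_ge0 ?exprn_ge0.
  by rewrite expr2 mulrA ler_piMl.
have small : \prod_(p <- ballE Y | prE p && (nmE p <= B)%N) Q j0 p <= C.
  apply: prod_const_le => // [x _|]; first by rewrite Q_ge0 Q_le.
  rewrite -size_filter; apply: uniq_leq_size; first by rewrite filter_uniq ?ballE_uniq.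
  by move=> x; rewrite mem_filter !mem_ballE => /andP[/andP[_ ->]] /andP[-> _].
pose N1 x := unit14 x && norm1_class (classE x).
have notin x : x \in ballE Y -> prE x -> (B < nmE x)%N -> ~~ (unit14 x && target_class (classE x)).
  move=> xY px Bx; have := none x xY; rewrite px (leq_ltn_trans B0B Bx) /=.
  by [].
have med : \prod_(p <- ballE Y | prE p && ~~ (nmE p <= B)%N && ~~ N1 p) Q j0 p <= 2.
  apply: (@le_trans _ _ (\prod_(p <- ballE Y | prE p && ~~ (nmE p <= B)%N && ~~ N1 p) (1 + K * w p ^+ 2))).
    rewrite big_seq_cond [leRHS]big_seq_cond; apply: ler_prod => x.
    rewrite -ltnNge => /and3P[xY /andP[px Bx] _]; rewrite Q_ge0 /=.
    by have [] := hQ j0 x (notin x xY px Bx).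
  apply: prod_one_add_le.
    move=> x; rewrite -ltnNge => /andP[/andP[_ Bx] _].
    by have /andP[-> h3] := wB x Bx; have /andP[_ h4] := w01 x; rewrite (le_trans h3).
  rewrite -mulr_sumr.
  have : \sum_(p <- ballE Y | prE p && ~~ (nmE p <= B)%N && ~~ N1 p) w p ^+ 2 <= (2 * (K + 1))^-1.
    apply: (@le_trans _ _ (\sum_(p <- ballE Y | prE p && ~~ (nmE p <= B)%N && ~~ N1 p) wt R 0 (nmE p))).
      by apply: ler_sum => x _; exact: wt_sqr_le.
    rewrite -big_filter; apply: hM0; first by rewrite filter_uniq ?ballE_uniq.
    move=> x; rewrite mem_filter mem_ballE -ltnNge => /andP[/andP[/andP[_ Bx] _] /andP[px _]].
    by split=> //; exact: leq_ltn_trans Bx.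
  move=> /(ler_wpM2l K0) /le_trans; apply.
  rewrite invfM mulrCA ler_piMr ?invr_ge0 // ler_pdivrMr ?ltr_wpDl // mul1r lerDl.
  exact: ler01.
have large : \prod_(p <- ballE Y | prE p && ~~ (nmE p <= B)%N && N1 p) Q j0 p <= k / (4 * C).
  apply: le_trans h1.
  apply: (@le_trans _ _ (\prod_(p <- ballE Y | prE p && ~~ (nmE p <= B)%N && N1 p) (1 - w p))).
    rewrite big_seq_cond [leRHS]big_seq_cond; apply: ler_prod => x.
    rewrite -ltnNge => /and3P[xY /andP[px Bx] /andP[ux nx]]; rewrite Q_ge0 /=.
    have [_ /(_ ux nx)] := hQ j0 x (notin x xY px Bx).
    by have /andP[_ h4] := wB x Bx; rewrite -/(w x); lra.
  (* For each rational prime [p = 1] modulo 21 one primary prime [phi p] of norm [p] is kept; [phi]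
     is injective because [p] is recovered as the norm. The factors that are dropped lie between 0
     and 1, so the product can only grow. *)
  pose P1 := [seq p <- iota 1 Y | [&& prime p, (p %% 21 == 1)%N & (B < p)%N]].
  have ex p : p \in P1 -> has (fun d => prE d && (nmE d == p)) (ballE Y).
    rewrite mem_filter mem_iota => /andP[/and3P[pp /eqP p21 Bp] /andP[_ pY]].
    have p3 : (p %% 3 = 1)%N by rewrite -(modn_dvdm p (isT : 3 %| 21)%N) p21.
    have [d prd dp] := prE_above pp p3; apply/hasP; exists d; last by rewrite prd dp eqxx.
    by rewrite mem_ballE prE_primary // dp -ltnS -add1n.
  pose phi p := nth 0 (ballE Y) (find (fun d => prE d && (nmE d == p)) (ballE Y)).
  have phiP p : p \in P1 -> [/\ phi p \in ballE Y, prE (phi p) & nmE (phi p) = p].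
    move=> /ex hp; have /andP[h3 /eqP h4] := nth_find 0 hp.
    by split=> //; rewrite mem_nth // -has_find.
  have -> : \prod_(p <- iota 1 Y | [&& prime p, (p %% 21 == 1)%N & (B < p)%N]) (1 - wt R j0 p) =
      \prod_(x <- [seq phi p | p <- P1]) (1 - w x).
    rewrite big_map -big_filter -/P1 [LHS]big_seq [RHS]big_seq; apply: eq_bigr => p hp.
    by have [_ _ h3] := phiP p hp; rewrite /w h3.
  rewrite -big_filter; apply: prod_subset_le.
  - by rewrite filter_uniq ?ballE_uniq.
  - rewrite map_inj_in_uniq ?filter_uniq ?iota_uniq // => p q /phiP[_ _ hp] /phiP[_ _ hq] h3.
    by rewrite -hp -hq h3.
  - move=> x /mapP[p hp ->]; have [h3 h4 h5] := phiP p hp.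
    move: hp; rewrite mem_filter => /andP[/and3P[pp /eqP p21 Bp] _].
    rewrite mem_filter h3 h4 h5 andbT -ltnNge Bp /= /N1 unit14E h5.
    have p7 : (p %% 7 = 1)%N by rewrite -(modn_dvdm p (isT : 7 %| 21)%N) p21.
    rewrite /dvdn p7 norm1_mod7 ?h5 // andbT /= andbT.
    case: (even_prime pp) => [p2|//].
    by have := leq_trans B14 (ltnW Bp); rewrite p2.
  by move=> x; have /andP[h3 h4] := w01 x; apply/andP; split; lra.
have Q0 (P : pred eis) : 0 <= \prod_(p <- ballE Y | P p) Q j0 p.
  by apply: prodr_ge0 => x _; exact: Q_ge0.
move: h2; rewrite (bigID (fun p => nmE p <= B)%N) /=.
rewrite [X in _ * X](bigID N1) /=.
move: small med large (Q0 (fun p => prE p && (nmE p <= B)%N))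
  (Q0 (fun p => prE p && ~~ (nmE p <= B)%N && ~~ N1 p))
  (Q0 (fun p => prE p && ~~ (nmE p <= B)%N && N1 p)).
set a := \prod_(p <- ballE Y | prE p && (nmE p <= B)%N) _.
set b := \prod_(p <- ballE Y | prE p && ~~ (nmE p <= B)%N && ~~ N1 p) _.
set c := \prod_(p <- ballE Y | prE p && ~~ (nmE p <= B)%N && N1 p) _.
move=> ha hb hc a0 b0 c0.
apply/negP; rewrite -ltNge.
have h3 : c * b <= k / (4 * C) * 2 by apply: ler_pM.
have h4 : a * (c * b) <= C * (k / (4 * C) * 2) by apply: ler_pM; rewrite ?mulr_ge0.
apply: le_lt_trans h4 _.
have -> : C * (k / (4 * C) * 2) = k / 2 by field; rewrite gt_eqF.
lra.
Qed.

End Target.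

(** * Jacobi sums *)

Section Characters.
Variables (p : nat) (g : 'F_p).
Hypothesis pp : prime p.
Hypothesis p2 : (2 < p)%N.
Hypothesis hg : (p.-1).-primitive_root g.

Definition dlogp (x : 'F_p) : nat := index x [seq g ^+ i | i <- iota 0 p.-1].

Lemma g_neq0 : g != 0.
Proof. by rewrite (prim_root_eq0 hg); lia. Qed.

Lemma dlogpP x : x != 0 -> (dlogp x < p.-1)%N /\ g ^+ dlogp x = x.
Proof.
move=> x0; have [i xE] := prim_rootP hg (Fp_exp pp x0).
have mx : x \in [seq g ^+ i | i <- iota 0 p.-1].
  by apply/mapP; exists (i : nat); rewrite ?mem_iota ?ltn_ord.
have lt : (dlogp x < p.-1)%N by rewrite -index_mem size_map size_iota in mx.
by split=> //; have := nth_index 0 mx; rewrite (nth_map 0%N) ?size_iota // nth_iota.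
Qed.

Lemma dlogpX i : dlogp (g ^+ i) = i %[mod p.-1].
Proof.
have gi : g ^+ i != 0 by rewrite expf_neq0 // g_neq0.
have [_ /eqP] := dlogpP gi.
by rewrite (eq_prim_root_expr hg) => /eqP.
Qed.

Section Ring.
Variable A : comNzRingType.
Implicit Types (t : A) (x y : 'F_p).

(** The values lie in an arbitrary commutative ring because F_7 and Z[w] both occur and are related
    by ring morphisms. For [t = 1] this is the principal character, still 0 at 0. *)
Definition chi t x : A := if x == 0 then 0 else t ^+ dlogp x.

Definition rootA t := t ^+ p.-1 = 1.

Lemma chi0 t : chi t 0 = 0. Proof. by rewrite /chi eqxx. Qed.

Lemma expA_mod t i j : rootA t -> i = j %[mod p.-1] -> t ^+ i = t ^+ j.
Proof.
move=> ht h; rewrite (divn_eq i p.-1) (divn_eq j p.-1) h !exprD !(mulnC _ p.-1) !exprM ht.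
by rewrite !expr1n.
Qed.

Lemma chiX t i : rootA t -> chi t (g ^+ i) = t ^+ i.
Proof.
move=> ht; rewrite /chi expf_eq0 (negbTE g_neq0) andbF.
by apply: expA_mod => //; exact: dlogpX.
Qed.

Lemma chi_g t : rootA t -> chi t g = t.
Proof. by move=> ht; rewrite -{1}(expr1 g) chiX. Qed.

Lemma chi1 t : rootA t -> chi t 1 = 1.
Proof. by move=> ht; rewrite -(expr0 g) chiX. Qed.

Lemma chiM t x y : rootA t -> chi t (x * y) = chi t x * chi t y.
Proof.
move=> ht; have [->|x0] := eqVneq x 0; first by rewrite mul0r chi0 mul0r.
have [->|y0] := eqVneq y 0; first by rewrite mulr0 chi0 mulr0.
have [_ <-] := dlogpP x0; have [_ <-] := dlogpP y0.
by rewrite -exprD !chiX // exprD.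
Qed.

Lemma chi_mul s t x : chi (s * t) x = chi s x * chi t x.
Proof. by rewrite /chi; case: eqP => _; rewrite ?mul0r // exprMn. Qed.

Lemma chi_exp t k x : (0 < k)%N -> chi (t ^+ k) x = chi t x ^+ k.
Proof.
by move=> k0; rewrite /chi; case: eqP => _; rewrite ?expr0n ?gtn_eqF // exprAC.
Qed.

Lemma chi_one x : chi 1 x = (x != 0)%:R.
Proof. by rewrite /chi; case: eqP => //= _; rewrite expr1n. Qed.

Lemma rootAX t k : rootA t -> rootA (t ^+ k).
Proof. by rewrite /rootA exprAC => ->; rewrite expr1n. Qed.

(** Nontriviality of the character over a general ring: [t - 1] is not a zero divisor. *)
Definition regA t := forall y : A, (t - 1) * y = 0 -> y = 0.

Lemma chi_sum0 t : rootA t -> regA t -> \sum_x chi t x = 0.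
Proof.
move=> ht; apply; rewrite mulrBl mul1r -[X in X * _](chi_g ht).
rewrite [X in _ - X](reindex_inj (mulfI g_neq0)) /= mulr_sumr.
by apply/eqP; rewrite subr_eq0; apply/eqP; apply: eq_bigr => x _; rewrite chiM.
Qed.

Definition J s t : A := \sum_x chi s x * chi t (1 - x).

Lemma JC s t : J s t = J t s.
Proof.
rewrite /J (reindex_inj (inv_inj (_ : involutive (fun x : 'F_p => 1 - x)))) /=.
  by apply: eq_bigr => x _; rewrite subKr mulrC.
by move=> x; rewrite subKr.
Qed.

(* substitute x = y / (y - 1) *)
Lemma J_swap s t u : rootA s -> rootA t -> rootA u -> s * t * u = 1 ->
  J s t = chi s (-1) * J s u.
Proof.
move=> hs ht hu stu; rewrite /J (bigD1 1) //= subrr chi0 mulr0 add0r.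
rewrite [in RHS](bigD1 1) //= subrr chi0 mulr0 add0r mulr_sumr.
pose h (y : 'F_p) := y / (y - 1).
have hne y : y != 1 -> y - 1 != 0 by rewrite subr_eq0.
have h1 y : y != 1 -> h y - 1 = (y - 1)^-1.
  by move=> /hne y1; rewrite /h -{2}(mulfV y1) -mulrBl subKr mul1r.
have hh y : y != 1 -> h y != 1.
  by move=> y1; rewrite -subr_eq0 h1 // invr_eq0 hne.
have hK y : y != 1 -> h (h y) = y.
  by move=> y1; rewrite {1}/h h1 // invrK /h divfK // hne.
rewrite (reindex_onto h h) /=; last by move=> y y1; exact: hK.
rewrite (eq_bigl (fun y => y != 1)); last first.
  move=> y; apply/andP/idP => [[hy /eqP yE]|y1]; last by rewrite hh // hK.
  by rewrite -yE hh.
apply: eq_bigr => y y1.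
have c1 : chi s (1 - y) * chi t (1 - y) * chi u (1 - y) = 1.
  by rewrite -!chi_mul stu chi_one subr_eq0 eq_sym y1.
have yy : h y * (1 - y) = - y.
  by rewrite /h -(opprB y 1) mulrN divfK // hne.
have e1 : chi s (h y) * chi s (1 - y) = chi s (-1) * chi s y.
  by rewrite -!chiM // yy mulN1r.
have e2 : chi t (1 - h y) * chi t (1 - y) = 1.
  rewrite -chiM // -opprB h1 // -[1 - y]opprB mulrNN mulVf ?chi1 //; exact: hne.
rewrite -[LHS]mulr1 -c1.
have -> : chi s (h y) * chi t (1 - h y) * (chi s (1 - y) * chi t (1 - y) * chi u (1 - y)) =
  (chi s (h y) * chi s (1 - y)) * (chi t (1 - h y) * chi t (1 - y)) * chi u (1 - y) by ring.
by rewrite e1 e2 mulr1 mulrA.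
Qed.

(** [J_swap] makes the second character principal, and the resulting sum omits only the value 1 at
    [x = 1] from a sum that vanishes. *)
Lemma J_inv s t : rootA s -> rootA t -> regA s -> s * t = 1 -> J s t = - chi s (-1).
Proof.
move=> hs ht rs st; rewrite (@J_swap s t 1) //; first last.
- by rewrite mulr1.
- by rewrite /rootA expr1n.
rewrite /J -[RHS]mulrN1; congr (_ * _).
under eq_bigr do rewrite chi_one.
rewrite (bigD1 1) //= subrr eqxx mulr0 add0r.
have := chi_sum0 hs rs; rewrite (bigD1 1) //= chi1 // => /eqP.
rewrite addrC addr_eq0 => /eqP <-; apply: eq_bigr => x x1.
by rewrite subr_eq0 eq_sym x1 mulr1.
Qed.

Lemma two_neq0 : 2 != 0 :> 'F_p.
Proof.
rewrite -[2]/(2%:R) -(dvdn_pcharf (pchar_Fp pp)); apply/negP => h.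
by have := dvdn_leq (ltn0Sn 1) h; rewrite leqNgt p2.
Qed.

(** [chi (-1)] is the Legendre symbol. *)
Lemma card_sqrt x : #|[pred w : 'F_p | w ^+ 2 == x]|%:R = 1 + chi (-1) x.
Proof.
have [->|x0] := eqVneq x 0.
  rewrite chi0 addr0 (eq_card (B := pred1 (0 : 'F_p))) ?card1 // => w.
  by rewrite !inE sqrf_eq0.
have [lt xE] := dlogpP x0; rewrite /chi (negbTE x0) -signr_odd.
have pm : ~~ odd p.-1.
  by case: (even_prime pp) => [h|]; [move: p2; rewrite h | rewrite -{1}(prednK (prime_gt0 pp))].
case: (boolP (odd (dlogp x))) => od.
  rewrite expr1 subrr (eq_card0 (A := [pred w : 'F_p | w ^+ 2 == x])) // => w.
  rewrite !inE; apply/negP => /eqP wx.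
  have w0 : w != 0 by apply: contraNneq x0 => w0; rewrite -wx w0 expr0n.
  have [_ wE] := dlogpP w0; move: wx; rewrite -xE -{1}wE -exprM => /eqP.
  rewrite (eq_prim_root_expr hg) => /eqP h.
  move: (congr1 odd (divn_eq (dlogp x) p.-1)) (congr1 odd (divn_eq (dlogp w * 2) p.-1)).
  by rewrite !oddD !oddM (negbTE pm) !andbF od h /= => <-.
rewrite expr0; set w0 := g ^+ (dlogp x)./2.
have w2 : w0 ^+ 2 = x.
  by rewrite -exprM muln2 -[RHS]xE -{2}(odd_double_half (dlogp x)) (negbTE od).
have wn : w0 != 0 by rewrite expf_neq0 // g_neq0.
have ne : w0 != - w0.
  by rewrite -subr_eq0 opprK -mulr2n -mulr_natr mulf_neq0 // two_neq0.
rewrite (eq_card (B := pred2 w0 (- w0))); last by move=> w; rewrite !inE -w2 eqf_sqr.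
by rewrite card2 ne.
Qed.

Lemma sum_sqr (F : 'F_p -> A) : \sum_w F (w ^+ 2) = \sum_x (1 + chi (-1) x) * F x.
Proof.
rewrite (partition_big (fun w => w ^+ 2) xpredT) //=; apply: eq_bigr => x _.
rewrite (eq_bigr (fun _ => F x)); last by move=> w /eqP ->.
by rewrite sumr_const -mulr_natl -card_sqrt.
Qed.

(* complete the square in 4 x (1 - x) *)
Lemma J_square t : rootA t -> regA t -> J t t * chi t 4 = J t (-1).
Proof.
move=> ht rt; rewrite /J mulr_suml.
have two := two_neq0.
have bij : injective (fun x : 'F_p => 1 - 2 * x).
  by move=> x y /addrI /oppr_inj /(mulfI two).
rewrite (eq_bigr (fun x => chi t (1 - (1 - 2 * x) ^+ 2))); last first.
  by move=> x _; rewrite -!chiM //; congr chi; ring.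
rewrite -(reindex_inj bij (F := fun w => chi t (1 - w ^+ 2)) (P := xpredT)) /=.
rewrite (sum_sqr (fun x => chi t (1 - x))) /=.
under eq_bigr do rewrite mulrDl mul1r.
rewrite big_split /= (_ : \sum_x chi t (1 - x) = 0) ?add0r; last first.
  rewrite -[RHS](chi_sum0 ht rt) [RHS](reindex_inj (inv_inj (_ : involutive (fun x : 'F_p => 1 - x)))) //=.
  by move=> x; rewrite subKr.
exact: JC.
Qed.

Lemma sum_chi_away t x0 : rootA t -> regA t -> x0 != 1 ->
  \sum_(y | (y != x0) && (y != 1)) chi t y = - (chi t x0 + 1).
Proof.
move=> ht rt x01; have := chi_sum0 ht rt.
rewrite (bigD1 x0) //= (bigD1 1) //=; last by rewrite eq_sym.
rewrite chi1 // addrA => /eqP; rewrite addrC addr_eq0 => /eqP <-.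
by [].
Qed.

(** A double sum is used in place of Gauss sums, which would bring in [p]-th roots of unity.
    Multiplying [J t t] by the term of [J s s] at [w] and rescaling [x] by [w] leaves
    [chi t x * chi t ((1 - w * x) / (1 - w))]. The terms with [x = 1] give [p - 2]. For other [x]
    the Moebius map in [w] sends the complement of 0 and 1 bijectively to the complement of [x] and
    1, and the sums of [chi] and of its square add the missing 2. *)
Lemma J_norm s t : rootA s -> rootA t -> s * t = 1 -> regA t -> regA (t ^+ 2) ->
  J t t * J s s = p%:R.
Proof.
move=> hs ht st rt rt2.
have inv x : x != 0 -> chi t x * chi s x = 1.
  by move=> x0; rewrite -chi_mul mulrC st chi_one x0.
have s0 x : x != 0 -> chi s x = chi t x^-1.
  move=> x0; rewrite -[LHS]mulr1 -(chi1 ht) -(mulfV x0) chiM // mulrA [chi s x * _]mulrC inv //.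
  by rewrite mul1r.
have step w : w != 0 -> w != 1 -> J t t * (chi s w * chi s (1 - w)) =
    \sum_x chi t x * chi t ((1 - w * x) / (1 - w)).
  move=> w0 w1; have w1' : 1 - w != 0 by rewrite subr_eq0 eq_sym.
  rewrite /J (reindex_inj (mulfI w0)) /= mulr_suml; apply: eq_bigr => x _.
  rewrite !chiM // (s0 (1 - w)) //.
  transitivity (chi t w * chi s w * (chi t x * (chi t (1 - w * x) * chi t (1 - w)^-1))); first by ring.
  by rewrite inv // mul1r.
rewrite {2}/J mulr_sumr (bigID (fun w => (w != 0) && (w != 1))) /= addrC big1 ?add0r; last first.
  by move=> w; rewrite negb_and !negbK => /orP[]/eqP->; rewrite ?subrr chi0 ?(mul0r, mulr0).
rewrite (eq_bigr (fun w => \sum_x chi t x * chi t ((1 - w * x) / (1 - w)))); last first.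
  by move=> w /andP[w0 w1]; exact: step.
rewrite exchange_big (bigD1 1) //=.
have e1 : \sum_(w | (w != 0) && (w != 1)) chi t 1 * chi t ((1 - w * 1) / (1 - w)) = p%:R - 2.
  rewrite (eq_bigr (fun _ => 1 : A)); last first.
    by move=> w /andP[_ w1]; rewrite mulr1 divff ?chi1 ?mulr1 // subr_eq0 eq_sym.
  have : \sum_(w : 'F_p) (1 : A) = p%:R by rewrite sumr_const card_Fp.
  rewrite (bigD1 0) //= (bigD1 1) ?oner_neq0 //= => <-.
  by rewrite addrA [1 + 1](_ : _ = 2) // addrC addrK.
rewrite e1 (eq_bigr (fun x => - (chi t x * (chi t x + 1)))); last first.
  move=> x x1; rewrite -mulr_sumr -mulrN -(sum_chi_away ht rt x1).
  have x1' : 1 - x != 0 by rewrite subr_eq0 eq_sym.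
  pose h (w : 'F_p) := x + (1 - x) / (1 - w); pose k (y : 'F_p) := 1 - (1 - x) / (y - x).
  have hE w : w != 1 -> (1 - w * x) / (1 - w) = h w.
    move=> w1; have w1' : 1 - w != 0 by rewrite subr_eq0 eq_sym.
    by rewrite /h; field.
  congr (_ * _); rewrite [RHS](reindex_onto h k) /=.
    apply: eq_big => [w|w /andP[_ w1]]; last by rewrite hE.
    rewrite /h /k; apply/andP/andP => [[w0 w1]|[/andP[hx h1] /eqP wE]].
      have w1' : 1 - w != 0 by rewrite subr_eq0 eq_sym.
      have hx : x + (1 - x) / (1 - w) - x = (1 - x) / (1 - w) by rewrite addrC addKr.
      split; last by rewrite hx invf_div mulrCA divff // mulr1 subKr.
      apply/andP; split; first by rewrite -subr_eq0 hx mulf_neq0 ?invr_eq0.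
      rewrite -subr_eq0 (_ : _ - 1 = (1 - x) * w / (1 - w)); last by field.
      by rewrite !mulf_neq0 ?invr_eq0.
    have w1 : w != 1 by apply: contraNneq hx => ->; rewrite subrr invr0 mulr0 addr0.
    split=> //; apply: contraNneq h1 => ->; rewrite subr0 divr1; apply/eqP; ring.
  move=> y /andP[yx y1]; rewrite /h /k.
  have yx' : y - x != 0 by rewrite subr_eq0.
  by rewrite subKr invf_div mulrCA divff // mulr1 addrC subrK.
have e2 : \sum_(x | x != 1) chi t x = -1.
  have := chi_sum0 ht rt; rewrite (bigD1 1) //= chi1 // => /eqP.
  by rewrite addrC addr_eq0 => /eqP.
have e3 : \sum_(x | x != 1) chi t x ^+ 2 = -1.
  have := chi_sum0 (rootAX 2 ht) rt2; rewrite (bigD1 1) //= (chi1 (rootAX 2 ht)) // => /eqP.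
  rewrite addrC addr_eq0 => /eqP <-; apply: eq_bigr => x _.
  by rewrite chi_exp.
rewrite sumrN; under eq_bigr do rewrite mulrDr mulr1 -expr2.
rewrite big_split /= e2 e3; ring.
Qed.

(* pair x with 1 - x *)
Lemma J_mod2 t : rootA t -> exists q, J t t = chi t 4^-1 + 2 * q.
Proof.
move=> ht; have two := two_neq0.
pose F x := chi t x * chi t (1 - x).
have Fs x : F (1 - x) = F x by rewrite /F subKr mulrC.
have half : 1 - 2^-1 = 2^-1 :> 'F_p by field.
have [lo loE] : exists lo : pred 'F_p, forall x, lo x = (val x < val (1 - x)%R)%N by exists (fun x => val x < val (1 - x)%R)%N.
exists (\sum_(x : 'F_p | lo x) F x).
have inv1 : involutive (fun x : 'F_p => 1 - x) by move=> x; rewrite subKr.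
have half4 : 2^-1 * 2^-1 = 4^-1 :> 'F_p by rewrite -invfM -natrM.
rewrite /J (bigD1 2^-1) //= half -chiM // half4; congr (_ + _).
have dbl (y : A) : 2 * y = y + y by ring.
rewrite (bigID lo) /= dbl; congr (_ + _).
  apply: eq_bigl => x; apply: andb_idl; rewrite loE => h; apply/eqP => xE.
  by move: h; rewrite xE half ltnn.
rewrite (reindex_inj (inv_inj inv1)) /=.
apply: eq_big => [x|x _]; last exact: Fs.
rewrite !loE subKr -leqNgt ltn_neqAle; congr (_ && _).
rewrite -{1}half (inj_eq (inv_inj inv1)) (inj_eq val_inj).
congr (~~ _); apply/eqP/eqP => h; first by rewrite h half.
apply: (mulfI two); rewrite mulfV //.
have dblx : 2 * x = x + x by ring.
by rewrite dblx {2}h addrC subrK.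
Qed.

End Ring.
End Characters.

Lemma F7_ind (P : 'F_7 -> Prop) : (forall n, (n < 7)%N -> P n%:R) -> forall x, P x.
Proof. by move=> h x; rewrite -(natr_Zp x); apply: h; exact: (ltn_ord x). Qed.

(* (s - 1) ^ 6 = 1 + s + ... + s ^ 6 in characteristic 7, with s = x + y *)
Lemma F7_indicator (x y : 'F_7) : (x + y == 1)%:R =
  - (x ^+ 6 + y ^+ 6 + (x + x ^+ 2 + x ^+ 3 + x ^+ 4 + x ^+ 5) + (y + y ^+ 2 + y ^+ 3 + y ^+ 4 + y ^+ 5) +
   (2 * (x * y) + 3 * (x * y ^+ 2) + 3 * (x ^+ 2 * y) + 4 * (x * y ^+ 3) + 6 * (x ^+ 2 * y ^+ 2)
    + 4 * (x ^+ 3 * y) + 5 * (x * y ^+ 4) + 10 * (x ^+ 2 * y ^+ 3) + 10 * (x ^+ 3 * y ^+ 2) + 5 * (x ^+ 4 * y)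
    + 6 * (x * y ^+ 5) + 15 * (x ^+ 2 * y ^+ 4) + 20 * (x ^+ 3 * y ^+ 3) + 15 * (x ^+ 4 * y ^+ 2)
    + 6 * (x ^+ 5 * y))) :> 'F_7.
Proof.
apply/eqP; move: x y; apply: F7_ind => m hm; apply: F7_ind => n hn.
by move: m n hm hn; do 7?[case=> //]; do 7?[case=> //].
Qed.

(** * The number of solutions modulo 7 in terms of one Jacobi sum *)

Section Count.
Variables (p : nat) (g : 'F_p).
Hypothesis pp : prime p.
Hypothesis p12 : (p %% 12 = 7)%N.
Hypothesis hg : (p.-1).-primitive_root g.
Let p2 : (2 < p)%N.
Proof. by move: p12; lia. Qed.

Lemma minus_one_exp : -1 = g ^+ (p.-1 %/ 2).
Proof.
have h : (g ^+ (p.-1 %/ 2)) ^+ 2 = 1 ^+ 2.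
  by rewrite -exprM divnK ?expr1n ?(prim_expr_order hg) //; lia.
have /eqP := h; rewrite eqf_sqr => /orP[|/eqP->//].
rewrite -(prim_order_dvd hg) => /dvdn_leq.
by move=> H; have := H ltac:(lia); lia.
Qed.

(** The two primitive roots modulo 7, inverse to each other. *)
Variable th : 'F_7.
Hypothesis hth : (th == 3) || (th == 5).

Let th6 : th ^+ 6 = 1.
Proof. by case/orP: hth => /eqP->; apply/eqP. Qed.

Let th3 : th ^+ 3 = -1.
Proof. by case/orP: hth => /eqP->; apply/eqP. Qed.

Lemma root_th k : rootA p (th ^+ k).
Proof.
rewrite /rootA -exprM mulnC exprM (_ : p.-1 = 6 * (p.-1 %/ 6))%N; last by lia.
by rewrite exprM th6 !expr1n.
Qed.

Lemma reg_th k : (0 < k < 6)%N -> regA (th ^+ k).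
Proof.
move=> hk y /eqP; rewrite mulf_eq0 subr_eq0 => /orP[h|/eqP//]; exfalso; move: h; apply/negP.
have chk : all (fun k => ((3 : 'F_7) ^+ k != 1) && ((5 : 'F_7) ^+ k != 1)) (iota 1 5) by vm_compute.
have /(allP chk)/andP[h3 h5] : k \in iota 1 5 by rewrite mem_iota.
by case/orP: hth => /eqP->.
Qed.

Lemma chi_th_neg1 k : chi g (th ^+ k) (-1) = (-1) ^+ k.
Proof.
rewrite minus_one_exp (chiX pp p2 hg _ (root_th k)) exprAC; congr (_ ^+ k).
have -> : (p.-1 %/ 2 = 3 * (2 * (p.-1 %/ 12) + 1))%N by lia.
by rewrite exprM th3 addn1 exprS exprM sqrrN !expr1n mulr1.
Qed.

Local Notation X := (chi g th).
Local Notation JJ i j := (J g (th ^+ i) (th ^+ j)).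

Lemma J_pow i j : (0 < i)%N -> (0 < j)%N -> \sum_z X z ^+ i * X (1 - z) ^+ j = JJ i j.
Proof. by move=> i0 j0; apply: eq_bigr => z _; rewrite !chi_exp. Qed.

Lemma sum_pow i : (0 < i < 6)%N -> \sum_z X z ^+ i = 0.
Proof.
move=> hi; rewrite -[RHS](chi_sum0 pp p2 hg (root_th i) (reg_th hi)).
by apply: eq_bigr => z _; rewrite chi_exp //; case/andP: hi.
Qed.

Lemma sum_pow' i : \sum_z X (1 - z) ^+ i = \sum_z X z ^+ i.
Proof.
rewrite [RHS](reindex_inj (inv_inj (_ : involutive (fun x : 'F_p => 1 - x)))) //.
by move=> x; rewrite subKr.
Qed.

Lemma sum_pow6 : \sum_z X z ^+ 6 = p%:R - 1.
Proof.
rewrite (bigD1 0) //= chi0 expr0n add0r.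
rewrite (eq_bigr (fun=> 1)); last first.
  by move=> z z0; rewrite -chi_exp // th6 chi_one z0.
have : \sum_(w : 'F_p) (1 : 'F_7) = p%:R by rewrite sumr_const card_Fp.
by rewrite (bigD1 0) //= => <-; rewrite addrC addrK.
Qed.

Definition solutions : {set 'F_p} := [set z | X z + X (1 - z) == 1].

Lemma seven0 : 7 = 0 :> 'F_7. Proof. by apply/eqP. Qed.

Let root_th1 : rootA p th.
Proof. by rewrite -(expr1 th); exact: root_th. Qed.

Lemma quarterK : X 4 * X 4^-1 = 1.
Proof.
rewrite -(chiM pp p2 hg _ _ root_th1) mulfV ?(chi1 pp p2 hg root_th1) //.
by rewrite (_ : 4 = 2 * 2) ?mulf_neq0 ?(two_neq0 pp p2) //; ring.
Qed.

(** [chi] has order 6 and 4 is a square. *)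
Lemma quarter3 : X 4^-1 ^+ 3 = 1.
Proof.
have e4 : 4^-1 = 2^-1 * 2^-1 :> 'F_p by rewrite -invfM -natrM.
rewrite e4 (chiM pp p2 hg _ _ root_th1) -expr2 -exprM -chi_exp // th6 chi_one.
by rewrite invr_eq0 (two_neq0 pp p2).
Qed.

(** [J_swap] with [chi (-1) = -1] relates the sums whose three exponents add up to 0 modulo 6;
    [J_square], with the quadratic character [th ^ 3 = -1], brings in [c = chi 4^-1]. This yields
    [JJ 1 2 = c * JJ 2 2] and [JJ 1 1 = - c ^ 2 * JJ 2 2]. The sums with [i + j = 6] are signs; they
    contribute 2 before the outer sign, and the two sums of sixth powers contribute [2 * (p - 1)],
    hence [- 2 * p] in total. *)
Lemma count_J : #|solutions|%:R =
  JJ 2 2 * (1 + 3 * X 4^-1 - X 4^-1 ^+ 2) - 2 * p%:R.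
Proof.
have -> : #|solutions|%:R = \sum_z ((X z + X (1 - z) == 1)%:R : 'F_7).
  rewrite -sum1_card natr_sum [RHS](bigID (fun z => z \in solutions)) /= [X in _ + X]big1 ?addr0.
    by apply: eq_bigr => z; rewrite inE => ->.
  by move=> z; rewrite inE => /negbTE ->.
pose M i j := \sum_z X z ^+ i * X (1 - z) ^+ j.
have -> : \sum_z ((X z + X (1 - z) == 1)%:R : 'F_7) =
  - (\sum_z X z ^+ 6 + \sum_z X (1 - z) ^+ 6 +
     (\sum_z X z + \sum_z X z ^+ 2 + \sum_z X z ^+ 3 + \sum_z X z ^+ 4 + \sum_z X z ^+ 5) +
     (\sum_z X (1 - z) + \sum_z X (1 - z) ^+ 2 + \sum_z X (1 - z) ^+ 3 + \sum_z X (1 - z) ^+ 4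
       + \sum_z X (1 - z) ^+ 5) +
     (2 * M 1%N 1%N + 3 * M 1%N 2%N + 3 * M 2%N 1%N + 4 * M 1%N 3%N + 6 * M 2%N 2%N + 4 * M 3%N 1%N + 5 * M 1%N 4%N + 10 * M 2%N 3%N
       + 10 * M 3%N 2%N + 5 * M 4%N 1%N + 6 * M 1%N 5%N + 15 * M 2%N 4%N + 20 * M 3%N 3%N + 15 * M 4%N 2%N + 6 * M 5%N 1%N)).
  rewrite /M !mulr_sumr -!big_split -sumrN /=; apply: eq_bigr => z _.
  by rewrite F7_indicator !expr1.
rewrite !sum_pow' sum_pow6 !sum_pow // /M !J_pow //.
have s1 : \sum_z X z = 0 by have := sum_pow (isT : (0 < 1 < 6)%N); under eq_bigr do rewrite expr1.
have s2 : \sum_z X (1 - z) = 0.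
  by rewrite -[RHS]s1; have := sum_pow' 1; under eq_bigr do rewrite expr1; under [RHS]eq_bigr do rewrite expr1.
rewrite s1 s2.
have sw i j k : ((i + j + k) %% 6 = 0)%N -> JJ i j = (-1) ^+ i * JJ i k.
  move=> h; rewrite -chi_th_neg1; apply: (J_swap pp p2 hg); try exact: root_th.
  by rewrite -!exprD (divn_eq (i + j + k) 6) h addn0 mulnC exprM th6 expr1n.
have iv i j : (i + j = 6)%N -> (0 < i < 6)%N -> JJ i j = - (-1) ^+ i.
  move=> h hi; rewrite -chi_th_neg1; apply: (J_inv pp p2 hg); try exact: root_th; first exact: reg_th.
  by rewrite -exprD h.
rewrite (iv 1 5)%N // (iv 2 4)%N // (iv 3 3)%N // (iv 4 2)%N // (iv 5 1)%N //.
have c4 := quarterK; have c3 := quarter3.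
have hd i : (0 < i < 6)%N -> JJ i i = JJ i 3 * X 4^-1 ^+ i.
  move=> hi; rewrite th3 -(J_square pp p2 hg (root_th i) (reg_th hi)).
  rewrite chi_exp; last by case/andP: hi.
  by rewrite -mulrA -exprMn c4 expr1n mulr1.
have j14 := sw 1%N 4%N 1%N erefl; have j13 := sw 1%N 3%N 2%N erefl.
have j23 := sw 2%N 3%N 1%N erefl; have h1 := hd 1%N isT; have h2 := hd 2%N isT.
have c21 : JJ 2 1 = JJ 1 2 by rewrite JC.
rewrite (JC g (th ^+ 2) (th ^+ 1)) (JC g (th ^+ 3) (th ^+ 1)) (JC g (th ^+ 3) (th ^+ 2)) (JC g (th ^+ 4) (th ^+ 1)).
move: c3 j14 j13 j23 h1 h2 c21; clear; move: (X 4^-1) (JJ 1 1) (JJ 1 2) (JJ 2 1) (JJ 1 3) (JJ 1 4) (JJ 2 2) (JJ 2 3).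
move=> c a11 a12 a21 a13 a14 a22 a23 c3; rewrite !expr1 sqrrN expr1n => j14 j13 j23 h1 h2 c21.
have e12 : a12 = c * a22 by rewrite h2 j23 c21 mul1r mulrCA -exprS c3 mulr1.
have e11 : a11 = - c ^+ 2 * a22 by rewrite h1 j13 e12; ring.
(* The last summand collects the multiples of 7, so that the rest is an identity over any
   commutative ring. *)
transitivity (a22 * (1 + 3 * c - c ^+ 2) - 2 * p%:R + 7 * (a11 - 3 * a12 - a22)); last first.
  by rewrite seven0 mul0r addr0.
by rewrite j14 j23 c21 j13 e11 e12; ring.
Qed.

End Count.

(** * Cubic Jacobi sums and their reductions modulo 7 *)

Section RMorphismJ.
Variables (A B : comNzRingType) (f : {rmorphism A -> B}) (p : nat) (g : 'F_p).

Lemma rmorph_chi t (x : 'F_p) : f (chi g t x) = chi g (f t) x.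
Proof. by rewrite /chi; case: eqP => _; rewrite ?rmorph0 ?rmorphXn. Qed.

Lemma rmorph_J s t : f (J g s t) = J g (f s) (f t).
Proof. by rewrite /J rmorph_sum; apply: eq_bigr => x _; rewrite rmorphM !rmorph_chi. Qed.

End RMorphismJ.

Lemma conjE_additive : additive conjE.
Proof. by move=> [a b] [c d]; rewrite !addEE /conjE /=; congr Eis; ring. Qed.
Lemma conjE_multiplicative : multiplicative conjE.
Proof. by split=> [x y|//]; exact: conjEM. Qed.
HB.instance Definition _ := GRing.isAdditive.Build eis eis conjE conjE_additive.
HB.instance Definition _ := GRing.isMultiplicative.Build eis eis conjE conjE_multiplicative.

(* the two reductions onto F_7, under w |-> 2 and under w |-> 4 *)
Definition redE (t : 'F_7) (x : eis) : 'F_7 := (ea x)%:~R + t * (eb x)%:~R.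
Definition red2 := redE 2.
Definition red4 := redE 4.

Lemma redE_additive t : additive (redE t).
Proof. by move=> x y; rewrite /redE /= !rmorphD !rmorphN /=; ring. Qed.

Lemma redE_multiplicative t : 1 + t + t ^+ 2 = 0 -> multiplicative (redE t).
Proof.
move=> ht; split=> [x y|]; last by rewrite /redE /= mulr0 addr0.
rewrite /redE mulEE /= !rmorphB !rmorphD !rmorphM /=.
rewrite -[LHS]addr0 -(mul0r ((eb x)%:~R * (eb y)%:~R)) -ht; ring.
Qed.

Lemma root_2 : 1 + 2 + 2 ^+ 2 = 0 :> 'F_7. Proof. by apply/eqP. Qed.
Lemma root_4 : 1 + 4 + 4 ^+ 2 = 0 :> 'F_7. Proof. by apply/eqP. Qed.

HB.instance Definition _ := GRing.isAdditive.Build eis 'F_7 red2 (redE_additive 2).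
HB.instance Definition _ := GRing.isMultiplicative.Build eis 'F_7 red2
  (redE_multiplicative root_2).
HB.instance Definition _ := GRing.isAdditive.Build eis 'F_7 red4 (redE_additive 4).
HB.instance Definition _ := GRing.isMultiplicative.Build eis 'F_7 red4
  (redE_multiplicative root_4).

Lemma seven_int (k : int) : (k * 7)%:~R = 0 :> 'F_7.
Proof. by rewrite rmorphM /= (_ : 7%:~R = 0 :> 'F_7) ?mulr0 //; apply/eqP. Qed.

Lemma red_res t (x : eis) : redE t%:R x = (resE t x)%:R.
Proof.
have [k h] := resE_eq t x.
have := congr1 (fun z : int => z%:~R : 'F_7) h.
by rewrite /redE !rmorphD /= seven_int add0r rmorphM.
Qed.

Lemma red_norm (x : eis) : red2 x * red4 x = (nmE x)%:R.
Proof.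
rewrite -[(nmE x)%:R]/((nmE x)%:Z%:~R) nmEE.
have -> : red4 x = red2 (conjE x).
  rewrite /red2 /red4 /redE /conjE /= rmorphB rmorphN /=.
  apply/eqP; rewrite -subr_eq0 (_ : _ - _ = 7 * (eb x)%:~R); last by ring.
  by rewrite seven0 mul0r.
rewrite -rmorphM mulE_conj.
have h : red2 (Eis (normE x) 0) = (normE x)%:~R by rewrite /red2 /redE /= mulr0 addr0.
exact: h.
Qed.

Lemma pow3_dlog7 n : ~~ (7 %| n)%N -> (pow3 (dlog7 n))%:R = n%:R :> 'F_7.
Proof.
move=> h; rewrite -(Zp_nat_mod (isT : 1 < 7)%N n); move: h; rewrite /dlog7 /dvdn.
by have := ltn_pmod n (isT : 0 < 7)%N; move: (n %% 7)%N; do 7?[case=> //].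
Qed.

Lemma pow3D a b : (pow3 (a + b))%:R = (pow3 a)%:R * (pow3 b)%:R :> 'F_7.
Proof.
rewrite /pow3 -modnDm.
have := ltn_pmod a (isT : 0 < 6)%N; have := ltn_pmod b (isT : 0 < 6)%N.
by move: (a %% 6)%N (b %% 6)%N; do 6?[case=> [|] //]; do 6?[case=> //]; move=> *; apply/eqP.
Qed.

Lemma good_class_eq (x : eis) : unit14 x -> good_class (classE x) ->
  let c := 2 ^+ k2E x in red4 x * (1 + 3 * c - c ^+ 2) + 2 * (red4 x * red2 x) = 0.
Proof.
move=> ux; have [h2 h4] := unit14_res ux.
rewrite /good_class /classE /= => /andP[_].
rewrite (dvdn_pcharf (pchar_Fp (isT : prime 7))) natrD !natrM pow3D !pow3_dlog7 // -!red_res.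
rewrite -/red4 -/red2 => /eqP <-; congr (_ * _ + _).
by rewrite /k2E; case: ifP => _; [|case: ifP => _]; apply/eqP.
Qed.

Lemma omega3 : omega ^+ 3 = 1. Proof. by []. Qed.

Lemma k2E_twice (x y : eis) : k2E (x + 2 * y) = k2E x.
Proof.
have -> : 2 = Eis 2 0 by [].
rewrite /k2E mulEE addEE /= !dvd2_oddz !(oddzD, oddzN, oddzM) /=.
by rewrite !addbF.
Qed.

Lemma k2EN (x : eis) : k2E (- x) = k2E x.
Proof. by rewrite /k2E oppEE /= !dvd2_oddz !oddzN. Qed.

(** * The cubic Jacobi sum as an Eisenstein integer *)

Section EisJ.
Variables (p : nat) (g : 'F_p).
Hypothesis pp : prime p.
Hypothesis p12 : (p %% 12 = 7)%N.
Hypothesis hg : (p.-1).-primitive_root g.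

Let p2 : (2 < p)%N. Proof. by move: p12; lia. Qed.

Lemma root_omega k : rootA p (omega ^+ k).
Proof.
rewrite /rootA -exprM mulnC exprM (_ : p.-1 = 3 * (p.-1 %/ 3))%N; last by lia.
by rewrite exprM omega3 !expr1n.
Qed.

Lemma reg_eis (t : eis) : t != 1 -> regA t.
Proof. by move=> t1 y /mulE_eq0[/eqP|//]; rewrite subr_eq0 (negbTE t1). Qed.

Definition JE k : eis := J g (omega ^+ k) (omega ^+ k).

Lemma chi_omega_value k (x : 'F_p) : x != 0 ->
  exists2 i, chi g (omega ^+ k) x = omega ^+ i & (i < 3)%N.
Proof.
move=> x0; exists ((k * dlogp g x) %% 3)%N; last exact: ltn_pmod.
rewrite /chi (negbTE x0) -exprM {1}(divn_eq (k * dlogp g x) 3) exprD mulnC exprM omega3.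
by rewrite expr1n mul1r.
Qed.

Lemma omega_power_cases i : (i < 3)%N ->
  omega ^+ i \in [:: 1; omega; - 1 - omega].
Proof. by case: i => [|[|[|]]]. Qed.

(** Values of the cubic character at nonzero points are congruent to 1 modulo [1 - w], and
    [(1 - w) ^ 2] is an associate of 3. So 3 divides the sum of [(chi x - 1) * (chi (1 - x) - 1)]
    over [x] other than 0 and 1, which expands to [JE k + p]. *)
Lemma JE_mod3 k : (0 < k < 3)%N -> exists q, JE k = - p%:R + 3 * q.
Proof.
move=> hk; set t := omega ^+ k.
have ht : rootA p t by exact: root_omega.
have rt : regA t by apply: reg_eis; case: k hk @t ht => [|[|[|]]].
have dv (x : 'F_p) : x != 0 -> x != 1 -> exists q, (chi g t x - 1) * (chi g t (1 - x) - 1) = 3 * q.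
  move=> x0 x1; have x1' : 1 - x != 0 by rewrite subr_eq0 eq_sym.
  have [i -> /omega_power_cases hi] := chi_omega_value k x0.
  have [j -> /omega_power_cases hj] := chi_omega_value k x1'.
  have w2 : omega * omega = -1 - omega by [].
  move: hi hj; rewrite !inE => /or3P[]/eqP-> /or3P[]/eqP->.
  - by exists 0; rewrite subrr mul0r mulr0.
  - by exists 0; rewrite subrr mul0r mulr0.
  - by exists 0; rewrite subrr mul0r mulr0.
  - by exists 0; rewrite subrr !mulr0.
  - by exists (- omega).
  - by exists 1.
  - by exists 0; rewrite subrr !mulr0.
  - by exists 1.
  - by exists (1 + omega).
have [q hq] : exists q, \sum_(x : 'F_p | (x != 0) && (x != 1)) (chi g t x - 1) * (chi g t (1 - x) - 1) = 3 * q.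
  elim/big_rec: _ => [|x s /andP[x0 x1] [q ->]]; first by exists 0; rewrite mulr0.
  by have [r ->] := dv x x0 x1; exists (r + q); rewrite mulrDr.
exists q; rewrite -hq.
under eq_bigr do rewrite mulrBl mulrBr mul1r mulr1.
have S0 : \sum_(x : 'F_p) chi g t x = 0 by exact: (chi_sum0 pp p2 hg).
have S1 : \sum_(x : 'F_p) chi g t (1 - x) = 0.
  rewrite -[RHS]S0 [RHS](reindex_inj (inv_inj (_ : involutive (fun x : 'F_p => 1 - x)))) //.
  by move=> x; rewrite subKr.
have split2 (F : 'F_p -> eis) : \sum_(x : 'F_p) F x = F 0 + (F 1 + \sum_(x : 'F_p | (x != 0) && (x != 1)) F x).
  by rewrite (bigD1 0) //= (bigD1 1) ?oner_neq0.
have c1 := chi1 pp p2 hg ht; have c0 := chi0 g t.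
have J1 : JE k = \sum_(x : 'F_p | (x != 0) && (x != 1)) chi g t x * chi g t (1 - x).
  by rewrite /JE -/t /J split2 c0 subrr c0 mul0r mulr0 !add0r.
have A1 : \sum_(x : 'F_p | (x != 0) && (x != 1)) chi g t x = -1.
  by move/eqP: S0; rewrite split2 c0 c1 add0r addrC addr_eq0 => /eqP.
have A2 : \sum_(x : 'F_p | (x != 0) && (x != 1)) chi g t (1 - x) = -1.
  by move/eqP: S1; rewrite split2 subr0 subrr c0 c1 add0r addrC addr_eq0 => /eqP.
have A3 : \sum_(x : 'F_p | (x != 0) && (x != 1)) 1 = p%:R - 2 :> eis.
  have : \sum_(w : 'F_p) (1 : eis) = p%:R by rewrite sumr_const card_Fp.
  by rewrite split2 => <-; ring.
rewrite big_split /= sumrN big_split /= sumrN sumrB A1 A2 A3 -J1; ring.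
Qed.

Lemma JE_primary k : (0 < k < 3)%N -> primary (- JE k).
Proof.
move=> /JE_mod3[q ->].
have -> : - (- p%:R + 3 * q) = Eis (p%:Z - 3 * ea q) (- (3 * eb q)).
  rewrite natEE; have -> : 3 = Eis 3 0 by [].
  by rewrite mulEE; apply: eisP => /=; ring.
by rewrite /primary /=; move: p12; lia.
Qed.

Lemma JE_conj : conjE (JE 1) = JE 2.
Proof. by rewrite /JE rmorph_J rmorphXn. Qed.

Lemma JE_norm : JE 1 * JE 2 = p%:R.
Proof.
apply: (J_norm pp p2 hg); rewrite ?expr1; try exact: root_omega.
- exact: (root_omega 1).
- by [].
- exact: reg_eis.
- exact: reg_eis.
Qed.

Lemma JE_nm k : (0 < k < 3)%N -> nmE (JE k) = p.
Proof.
move=> hk; have -> : nmE (JE k) = nmE (JE 1).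
  by case: k hk => [|[|[|k]]] // _; rewrite -JE_conj nmE_conj.
have : nmE p%:R = (p * p)%N.
  by rewrite natEE; apply/eqP; rewrite -eqz_nat nmEE /normE PoszM /=; apply/eqP; ring.
by rewrite -JE_norm nmEM -JE_conj nmE_conj => /eqP; rewrite !mulnn eqn_sqr => /eqP.
Qed.

(** The pairing of [k] with [th] is the one for which [red4] maps [omega ^ k] to [th ^ 2], so [red4]
    carries [JE k] to the Jacobi sum in [count_J], while [red2] maps [omega ^ k] to [th ^ 4]. By
    [J_mod2] the class of [JE k] modulo 2 is the value of the cubic character at [4^-1], which is
    what [k2E] reads off. *)
Lemma JE_count k (th : 'F_7) : (k == 1%N) && (th == 5) || (k == 2%N) && (th == 3) ->
  let x := - JE k in let c := 2 ^+ k2E x in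
  #|solutions g th|%:R = - (red4 x * (1 + 3 * c - c ^+ 2) + 2 * (red4 x * red2 x)).
Proof.
move=> hk x c.
have hth : (th == 3) || (th == 5) by case/orP: hk => /andP[_ ->]; rewrite ?orbT.
have e4 : red4 (omega ^+ k) = th ^+ 2 by case/orP: hk => /andP[/eqP-> /eqP->]; apply/eqP.
have e2 : red2 (omega ^+ k) = th ^+ 4 by case/orP: hk => /andP[/eqP-> /eqP->]; apply/eqP.
rewrite (count_J pp p12 hg hth).
have -> : J g (th ^+ 2) (th ^+ 2) = - red4 x.
  by rewrite /x rmorphN opprK /JE rmorph_J /= -/red4 e4.
have c3 := quarter3 pp p12 hg hth.
have cE : chi g th 4^-1 = c.
  have [q hq] := J_mod2 pp p2 hg (root_omega k).
  have q0 : 4^-1 != 0 :> 'F_p.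
    by rewrite invr_eq0 (_ : 4 = 2 * 2) ?mulf_neq0 ?(two_neq0 pp p2) //; ring.
  have [i hi i3] := chi_omega_value k q0.
  have ki : k2E x = i.
    by rewrite /x k2EN /JE hq k2E_twice hi; case: i i3 {hi} => [|[|[|]]].
  (* Being a cube root of unity, the value equals its fourth power, which is the value of the
     character attached to [th ^ 4], the [red2] image of the cubic character. *)
  have c4 : chi g th 4^-1 ^+ 4 = chi g th 4^-1 by rewrite exprSr c3 mul1r.
  rewrite /c ki -[LHS]c4 -chi_exp // -e2 -rmorph_chi hi rmorphXn.
  have ro : red2 omega = 2 by apply/eqP.
  exact: (congr1 (fun u : 'F_7 => u ^+ i) ro).
rewrite cE.
have -> : p%:R = red4 x * red2 x.
  rewrite mulrC red_norm; congr (_ *+ _).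
  have hk3 : (0 < k < 3)%N by case/orP: hk => /andP[/eqP-> _].
  by rewrite -[LHS](JE_nm hk3) /x -mulN1r nmEM mul1n.
ring.
Qed.

End EisJ.

(** * Counting S and its translate *)

Lemma prE_rational (d : eis) n : prE d -> (0 < n)%N -> dvdE d (Eis n%:Z 0) ->
  exists2 q, prime q & dvdE d (Eis q%:Z 0).
Proof.
move=> prd; elim: {n}n.+1 {-2}n (ltnSn n) => // m IH n nm n0 dn.
have d0 := prE_neq0 prd.
have [n1|n1] := leqP n 1.
  have nE : n = 1%N by lia.
  have := dvdE_leq d0 _ dn; rewrite nE => /(_ isT).
  by rewrite leqNgt prE_gt1.
have pq := pdiv_prime n1; have [k hk] := dvdnP (pdiv_dvd n).
have e : Eis n%:Z 0 = Eis (pdiv n)%:Z 0 * Eis k%:Z 0.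
  by rewrite mulEE /= {1}hk PoszM; apply: eisP => /=; ring.
rewrite e in dn; case/orP: (prE_prime prd dn) => h; first by exists (pdiv n).
have q1 := prime_gt1 pq.
apply: (IH k) => //; first by move: nm n1; rewrite {1 2}hk; nia.
by move: n0; rewrite {1}hk muln_gt0 => /andP[].
Qed.

(** The norm divides [q ^ 2] for some rational prime [q], and a square is never 3 modulo 4. *)
Lemma prE_norm_prime (d : eis) : prE d -> (nmE d %% 4 = 3)%N -> prime (nmE d).
Proof.
move=> prd d4; have d0 := prE_neq0 prd; have n0 : (0 < nmE d)%N by rewrite nmE_gt0.
have [|q pq /(dvdEP _ d0)[y hy]] := prE_rational prd n0.
  by apply/(dvdEP _ d0); exists (conjE d); rewrite mulE_conj nmEE.
have : (nmE d %| q ^ 2)%N.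
  have -> : (q ^ 2 = nmE (Eis q%:Z 0))%N.
    by apply/eqP; rewrite -eqz_nat nmEE /normE -mulnn PoszM /=; apply/eqP; ring.
  by rewrite hy nmEM dvdn_mulr.
case/(dvdn_pfactor _ _ pq) => -[|[|[|//]]] _ hd.
- by have := prE_gt1 prd; rewrite hd.
- by rewrite hd.
move: d4; rewrite hd -mulnn -modnMm.
by have := ltn_pmod q (isT : 0 < 4)%N; move: (q %% 4)%N; do 4?[case=> //].
Qed.

(** Conjugation sends [w] to [w ^ 2], and squaring exchanges 2 and 4 modulo 7. *)
Lemma class_conj (x : eis) : odd (nmE x) -> classE (conjE x) = conj_class (classE x).
Proof.
move=> ox; rewrite /classE /conj_class /= /e4E nmE_conj; congr (_, _, _, _).
- apply: dlog7_mod; have [k hk] := resE_eq 2 x.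
  by apply: (@resE_unique _ _ (k - eb x)); rewrite /conjE /=; lia.
- apply: dlog7_mod; have [k hk] := resE_eq 4 x.
  by apply: (@resE_unique _ _ (k - eb x)); rewrite /conjE /=; lia.
move: ox; rewrite odd_nmE /k2E !dvd2_oddz /conjE /= !(oddzD, oddzN).
by case: (oddz (ea x)); case: (oddz (eb x)).
Qed.

Lemma Fp_eq_mod p m n : prime p -> (m%:R == n%:R :> 'F_p) = (m == n %[mod p]).
Proof. by move=> pp; rewrite -val_eqE /= !val_Fp_nat. Qed.

Lemma Fp_mod p m k : prime p -> (p %| k)%N -> (m %% k)%:R = m%:R :> 'F_p.
Proof. by move=> pp pk; apply/eqP; rewrite Fp_eq_mod // modn_dvdm. Qed.

(** * The generator modulo [7 * p] and the intersection of S with its translate *)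

Section SpqCount.
Variables (p : nat) (g : 'F_p) (th : 'F_7).
Hypothesis pp : prime p.
Hypothesis p12 : (p %% 12 = 7)%N.
Hypothesis p7 : p != 7%N.
Hypothesis hg : (p.-1).-primitive_root g.
Hypothesis hth : (th == 3) || (th == 5).

Let p2 : (2 < p)%N. Proof. by move: p12; lia. Qed.
Let n0 : (0 < p * 7)%N. Proof. by move: p2; lia. Qed.
Let pr7 : prime 7. Proof. by []. Qed.
Let co : coprime p 7.
Proof. by rewrite prime_coprime // dvdn_prime2 ?p7. Qed.
Let dp : (p %| p * 7)%N. Proof. by rewrite dvdn_mulr. Qed.
Let d7 : (7 %| p * 7)%N. Proof. by rewrite dvdn_mull. Qed.
Let rt : rootA p th.
Proof. have := root_th pp p12 hg hth 1. rewrite expr1. exact. Qed.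

Definition crt7 (u : 'F_p) (v : 'F_7) : nat := (chinese p 7 u v %% (p * 7))%N.

Lemma crt7_lt u v : (crt7 u v < p * 7)%N. Proof. exact: ltn_pmod. Qed.

Lemma crt7_p u v : (crt7 u v)%:R = u.
Proof.
rewrite /crt7 Fp_mod // -[RHS]natr_Zp; apply/eqP; rewrite Fp_eq_mod //.
by rewrite chinese_modl.
Qed.

Lemma crt7_7 u v : (crt7 u v)%:R = v.
Proof.
rewrite /crt7 Fp_mod // -[RHS]natr_Zp; apply/eqP; rewrite Fp_eq_mod //.
by rewrite chinese_modr.
Qed.

Lemma eq_crt7 m n : m%:R = n%:R :> 'F_p -> m%:R = n%:R :> 'F_7 -> m = n %[mod p * 7].
Proof.
move=> /eqP h1 /eqP h2; apply/eqP.
by rewrite chinese_remainder // -!Fp_eq_mod // h1 h2.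
Qed.

Definition gen7 : nat := crt7 g th.

Local Notation X := (chi g th).

Lemma mem_Spq (x : 'I_(p * 7)) :
  (x \in Spq p 7 gen7) = ((x : nat)%:R != 0 :> 'F_p) && ((x : nat)%:R == X (x : nat)%:R :> 'F_7).
Proof.
rewrite inE; apply/existsP/andP => [[j /eqP ->]|[x0 /eqP xX]].
  rewrite !Fp_mod // !natrX crt7_p crt7_7; split.
    by rewrite expf_neq0 // (g_neq0 pp p2 hg).
  by rewrite (chiX pp p2 hg).
have [lt hx] := dlogpP pp hg x0; exists (Ordinal lt).
rewrite -[X in X == _](modn_small (ltn_ord x)) /=; apply/eqP; apply: eq_crt7.
  by rewrite natrX crt7_p hx.
by rewrite natrX crt7_7 xX /chi (negbTE x0).
Qed.

(** If [x = y + 1] with [x] and [y] in S, then [z = 1 - x] equals [- y] modulo [p], and since [chi]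
    is odd, [chi z] is [- y] modulo 7, which is [1 - x]. The solutions [z = 0] and [z = 1] would
    correspond to [y = 0] and [x = 0] modulo [p], excluded from S, hence the 2. *)
Lemma card_Spq : (#|Spq p 7 gen7 :&: shift1 (Spq p 7 gen7)| + 2 = #|solutions g th|)%N.
Proof.
pose f (x : 'I_(p * 7)) : 'F_p := 1 - (x : nat)%:R.
set S := Spq p 7 gen7.
have X0 : X 0 = 0 by exact: chi0.
have X1 : X 1 = 1 by exact: (chi1 pp p2 hg rt).
have XN (u : 'F_p) : X (- u) = - X u.
  rewrite -mulN1r (chiM pp p2 hg _ _ rt).
  by have := chi_th_neg1 pp p12 hg hth 1; rewrite !expr1 => ->; rewrite mulN1r.
have f_inj : {in S :&: shift1 S &, injective f}.
  move=> x y; rewrite !inE -!/S => /andP[xS _] /andP[yS _].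
  have {}xS : x \in S by rewrite inE.
  have {}yS : y \in S by rewrite inE.
  rewrite /f => /addrI/oppr_inj h.
  move: xS yS; rewrite !mem_Spq => /andP[_ /eqP hx] /andP[_ /eqP hy].
  apply: val_inj; rewrite /= -(modn_small (ltn_ord x)) -(modn_small (ltn_ord y)).
  by apply: eq_crt7 => //; rewrite hx hy h.
rewrite -(card_in_imset f_inj).
have -> : f @: (S :&: shift1 S) = solutions g th :\ 0 :\ 1.
  apply/setP => z; apply/imsetP/idP => [[x]|].
    rewrite inE => /andP[xS]; rewrite inE => /existsP[y /andP[yS /eqP xy]] ->.
    move: xS yS; rewrite !mem_Spq => /andP[x0 /eqP hx] /andP[y0 /eqP hy].
    have ep : (x : nat)%:R = (y : nat)%:R + 1 :> 'F_p by rewrite xy Fp_mod // -natr1.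
    have e7 : (x : nat)%:R = (y : nat)%:R + 1 :> 'F_7 by rewrite xy Fp_mod // -natr1.
    rewrite !inE /f; apply/and3P; split.
    - by rewrite -subr_eq0 addrAC subrr add0r oppr_eq0.
    - by rewrite ep opprD addrCA subrr addr0 oppr_eq0.
    rewrite subKr {1}ep opprD addrCA subrr addr0 XN -hx -hy e7.
    by rewrite addKr.
  rewrite !inE => /and3P[z1 z0 /eqP hz].
  have lt1 := crt7_lt (1 - z) (X (1 - z)); have lt2 := crt7_lt (- z) (X (- z)).
  exists (Ordinal lt1); last by rewrite /f /= crt7_p subKr.
  rewrite inE mem_Spq /= crt7_p crt7_7 eqxx andbT subr_eq0 eq_sym z1 /=.
  rewrite inE; apply/existsP; exists (Ordinal lt2); rewrite mem_Spq /= crt7_p crt7_7 eqxx andbT.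
  rewrite oppr_eq0 z0 /= -[X in X == _](modn_small lt1); apply/eqP; apply: eq_crt7.
    by rewrite -natr1 !crt7_p addrC.
  by rewrite -natr1 !crt7_7 XN -hz addrA addNr add0r.
have s0 : 0 \in solutions g th by rewrite inE subr0 X0 X1 add0r.
have s1 : 1 \in solutions g th :\ 0 by rewrite !inE oner_neq0 subrr X0 X1 addr0 eqxx.
by rewrite (cardsD1 0 (solutions g th)) s0 (cardsD1 1 (_ :\ 0)) s1 addnC.
Qed.

Lemma gen7_generates : generates_units_mod p gen7.
Proof.
split.
  rewrite coprime_sym prime_coprime // (dvdn_pcharf (pchar_Fp pp)) crt7_p.
  exact: (g_neq0 pp p2 hg).
move=> b cb; have b0 : b%:R != 0 :> 'F_p.
  by rewrite -(dvdn_pcharf (pchar_Fp pp)) -prime_coprime // coprime_sym.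
have [_ hb] := dlogpP pp hg b0; exists (dlogp g b%:R); apply/eqP.
by rewrite -Fp_eq_mod // natrX crt7_p hb.
Qed.

Lemma gen7_half : (gen7 ^ (p.-1)./2 + 1 = 0 %[mod 7 * p])%N.
Proof.
rewrite mulnC -divn2; apply: eq_crt7.
  by rewrite natrD natrX crt7_p -(minus_one_exp pp p12 hg) addNr.
rewrite natrD natrX crt7_7 -(chiX pp p2 hg _ rt) -(minus_one_exp pp p12 hg).
by have := chi_th_neg1 pp p12 hg hth 1; rewrite !expr1 => ->; rewrite addNr.
Qed.

Lemma gen7_coprime : coprime gen7 (7 * p).
Proof.
rewrite coprimeMr; have [-> _] := gen7_generates; rewrite andbT.
rewrite coprime_sym prime_coprime // (dvdn_pcharf (pchar_Fp pr7)) crt7_7.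
by case/orP: hth => /eqP->.
Qed.

End SpqCount.

(** The prime [d] divides [p = JE 1 * JE 2], and both [- JE 1] and [- JE 2] are primary of norm [p],
    so [d] is one of them. If the conjugate of [d] is the good one, the other index is taken; the
    index then dictates whether [g] is paired with 3 or with 5. *)
Lemma exists_prime_solutions_eq0 N : exists (p : nat) (g : 'F_p) (th : 'F_7),
  [/\ (N < p)%N, prime p, (p %% 12 = 7)%N & p != 7%N] /\
  [/\ (p.-1).-primitive_root g, (th == 3) || (th == 5) & #|solutions g th|%:R = 0 :> 'F_7].
Proof.
(* The analytic part only asks for an Archimedean real closed field, so the real algebraic numbers
   serve. *)
have [d [prd Nd ud td]] := exists_target_prime realalg N.
move: td => /andP[_ gd].
have e4 : (nmE d %% 4 = 3)%N.
  by case/orP: gd => /andP[/eqP]; rewrite /= /e4E; case: eqP.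
have pp := prE_norm_prime prd e4; have d3 := primary_nm (prE_primary prd).
pose p := nmE d.
(* The norm of a primary element is 1 modulo 3, and a good class has norm 3 modulo 4. *)
have p12 : (p %% 12 = 7)%N by rewrite /p; lia.
move: (ud); rewrite unit14E => /andP[od nd7].
have p7 : p != 7%N by apply: contraNneq nd7; rewrite /p => ->.
have [g hg] := Fp_generator pp.
have d0 := prE_neq0 prd.
have split_J : dvdE d (- JE g 1) \/ dvdE d (- JE g 2).
  have : dvdE d (JE g 1 * JE g 2).
    rewrite (JE_norm pp p12 hg) natEE; apply/(dvdEP _ d0); exists (conjE d).
    by rewrite mulE_conj nmEE.
  have neg x : dvdE d x -> dvdE d (- x).
    by move=> /(dvdEP _ d0)[y ->]; apply/(dvdEP _ d0); exists (- y); rewrite mulrN.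
  by case/(prE_prime prd)/orP => /neg; [left | right].
have eqJ k : (0 < k < 3)%N -> dvdE d (- JE g k) -> d = - JE g k.
  move=> hk /(dvdE_primary (prE_primary prd) (JE_primary pp p12 hg hk))[y py hy].
  have ny : nmE y = 1%N.
    have := JE_nm pp p12 hg hk; rewrite -[JE g k]opprK hy -mulN1r nmEM mul1n nmEM -/p.
    by rewrite -[in RHS](muln1 p) => /eqP; rewrite eqn_pmul2l ?prime_gt0 // => /eqP.
  by rewrite hy (primary_nm1 py ny) mulr1.
have cJ : conjE (- JE g 1) = - JE g 2 by rewrite rmorphN /= (JE_conj g).
have [k [hk gk uk]] : exists k, [/\ (0 < k < 3)%N, good_class (classE (- JE g k)) & unit14 (- JE g k)].
  have uc : unit14 (conjE d) by rewrite /unit14 nmE_conj.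
  case/orP: gd => gd; last rewrite -class_conj // in gd.
    by case: split_J => [/(@eqJ 1%N isT)|/(@eqJ 2%N isT)] dE; [exists 1%N | exists 2%N]; rewrite -dE.
  case: split_J => [/(@eqJ 1%N isT)|/(@eqJ 2%N isT)] dE.
    by exists 2%N; rewrite -cJ -dE.
  by exists 1%N; rewrite -[- JE g 1]conjEK cJ -dE.
have [th [hth hk7]] : exists th : 'F_7, (th == 3) || (th == 5) /\
    (k == 1%N) && (th == 5) || (k == 2%N) && (th == 3).
  by case: k hk {gk uk} => [|[|[|k]]] // _; [exists 5 | exists 3].
have c0 : #|solutions g th|%:R = 0 :> 'F_7.
  by rewrite (JE_count pp p12 hg hk7) (good_class_eq uk gk) oppr0.
by exists p, g, th.
Qed.

Local Close Scope complex_scope.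
Local Close Scope ring_scope.

Theorem mainTheorem16 :
  forall N : nat, exists p : nat, N < p /\ prime p /\
    exists a : nat, a < 7 * p /\ coprime a (7 * p) /\
      generates_units_mod p a /\
      a ^ (p.-1)./2 + 1 = 0 %[mod 7 * p] /\
      #|Spq p 7 a :&: shift1 (Spq p 7 a)| + 2 = 0 %[mod 7].
Proof.
move=> N; have [p [g [th [[Np pp p12 p7] [hg hth c0]]]]] := exists_prime_solutions_eq0 N.
exists p; split=> //; split=> //; exists (gen7 g th).
split; first by rewrite mulnC; exact: (crt7_lt pp p12 p7 hg hth).
split; first exact: gen7_coprime.
split; first exact: gen7_generates.
split; first exact: gen7_half.
by apply/eqP; rewrite card_Spq // -Fp_eq_mod // c0.
Qed.
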